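(* Let $p$ be a prime and $d\geq 2$ an integer, and let $F$ be the free metabelian pro-$p$ group on $d$ generators. Then $F$ is finitely axiomatizable in the class of all profinite groups: there is a first-order sentence $\sigma$ in the language of group theory such that $F\models\sigma$, and every profinite group $G$ with $G\models\sigma$ is (continuously) isomorphic to $F$.
   Context: The free metabelian pro-$p$ group on $d$ generators is $\Phi/\Phi''$, where $\Phi$ is the free pro-$p$ group on $d$ generators and $\Phi''$ is the closed second derived subgroup. First-order sentences are in the ordinary first-order language of groups (multiplication, inverse, identity), interpreted in the underlying abstract group. Isomorphism of profinite groups means continuous isomorphism. *)

(* Defs.v *)
From HB Require Import structures.
From mathcomp Require Import all_boot.
From mathcomp Require Import boolp classical_sets topology.

Set Implicit Arguments.
Unset Strict Implicit.
Unset Printing Implicit Defensive.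

Local Open Scope classical_set_scope.

Record TopGroup := {
  tg_T :> topologicalType;
  tg_mul : tg_T -> tg_T -> tg_T;
  tg_inv : tg_T -> tg_T;
  tg_one : tg_T;
  tg_mulA : forall x y z, tg_mul x (tg_mul y z) = tg_mul (tg_mul x y) z;
  tg_mul1g : forall x, tg_mul tg_one x = x;
  tg_mulg1 : forall x, tg_mul x tg_one = x;
  tg_mulVg : forall x, tg_mul (tg_inv x) x = tg_one;
  tg_mulgV : forall x, tg_mul x (tg_inv x) = tg_one;
  tg_mul_cont : continuous (fun xy : tg_T * tg_T => tg_mul xy.1 xy.2);
  tg_inv_cont : continuous tg_inv
}.

Arguments tg_mul {t}.
Arguments tg_inv {t}.
Arguments tg_one {t}.

Definition profinite (G : TopGroup) : Prop :=
  [/\ compact [set: G], hausdorff_space G & totally_disconnected [set: G]].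

Definition is_hom (G H : TopGroup) (f : G -> H) : Prop :=
  forall x y, f (tg_mul x y) = tg_mul (f x) (f y).

Definition cont_hom (G H : TopGroup) (f : G -> H) : Prop :=
  is_hom f /\ continuous f.

Definition topgroup_isomorphic (G H : TopGroup) : Prop :=
  exists (f : G -> H) (g : H -> G),
    [/\ cont_hom f, continuous g, cancel f g & cancel g f].

Definition is_subgroup (G : TopGroup) (N : set G) : Prop :=
  [/\ N tg_one,
      (forall x y, N x -> N y -> N (tg_mul x y)) &
      (forall x, N x -> N (tg_inv x))].

Definition is_normal_subgroup (G : TopGroup) (N : set G) : Prop :=
  is_subgroup N /\
  forall g x, N x -> N (tg_mul (tg_inv g) (tg_mul x g)).

Definition has_index (G : TopGroup) (N : set G) (n : nat) : Prop :=
  exists s : seq G, size s = n /\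
    (forall g, exists i, (i < n)%N /\ N (tg_mul g (tg_inv (nth tg_one s i)))) /\
    (forall i j, (i < n)%N -> (j < n)%N ->
       N (tg_mul (nth tg_one s i) (tg_inv (nth tg_one s j))) -> i = j).

Definition pro_p (p : nat) (G : TopGroup) : Prop :=
  profinite G /\
  forall N : set G, open N -> is_normal_subgroup N ->
    exists k, has_index N (p ^ k).

Definition free_pro_p (p d : nat) (Phi : TopGroup) (iota : 'I_d -> Phi) : Prop :=
  pro_p p Phi /\
  forall (H : TopGroup) (f : 'I_d -> H), pro_p p H ->
    exists phi : Phi -> H,
      [/\ cont_hom phi, (forall i, phi (iota i) = f i) &
          (forall psi : Phi -> H, cont_hom psi -> (forall i, psi (iota i) = f i) ->
             forall x, psi x = phi x)].

Definition closed_gen (G : TopGroup) (S : set G) : set G :=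
  fun x => forall K : set G, is_subgroup K -> closed K -> S `<=` K -> K x.

Definition commg (G : TopGroup) (x y : G) : G :=
  tg_mul (tg_inv x) (tg_mul (tg_inv y) (tg_mul x y)).

Definition closed_derived (G : TopGroup) (A : set G) : set G :=
  closed_gen [set z | exists x y, [/\ A x, A y & z = commg x y]].

Definition derived1 (G : TopGroup) : set G := @closed_derived G setT.
Definition derived2 (G : TopGroup) : set G := @closed_derived G (@derived1 G).

(* F is (isomorphic to) the free metabelian pro-p group on d generators Phi/Phi'':
   there is a continuous surjective homomorphism Phi -> F with kernel Phi''.
   (Phi compact, F Hausdorff, so such a map induces a topological isomorphism
   Phi/Phi'' ~= F.) *)
Definition quotient_map_by_derived2 (Phi F : TopGroup) (pi : Phi -> F) : Prop :=
  [/\ cont_hom pi, (forall y : F, exists x, pi x = y) &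
      (forall x, pi x = tg_one <-> @derived2 Phi x)].

Inductive gterm : Type :=
| TVar of nat
| TOne
| TMul of gterm & gterm
| TInv of gterm.

Inductive gform : Type :=
| FEq of gterm & gterm
| FFalse
| FNot of gform
| FAnd of gform & gform
| FOr of gform & gform
| FImp of gform & gform
| FForall of nat & gform
| FExists of nat & gform.

Fixpoint term_fv (t : gterm) : seq nat :=
  match t with
  | TVar n => [:: n]
  | TOne => [::]
  | TMul a b => term_fv a ++ term_fv b
  | TInv a => term_fv a
  end.

Fixpoint form_fv (f : gform) : seq nat :=
  match f with
  | FEq a b => term_fv a ++ term_fv b
  | FFalse => [::]
  | FNot g => form_fv g
  | FAnd g h | FOr g h | FImp g h => form_fv g ++ form_fv h
  | FForall n g | FExists n g => seq.filter (fun m => m != n) (form_fv g)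
  end.

Definition is_sentence (f : gform) : bool := nilp (form_fv f).

Section Eval.
Variable G : TopGroup.

Fixpoint teval (e : nat -> G) (t : gterm) : G :=
  match t with
  | TVar n => e n
  | TOne => tg_one
  | TMul a b => tg_mul (teval e a) (teval e b)
  | TInv a => tg_inv (teval e a)
  end.

Definition upd (e : nat -> G) (n : nat) (x : G) : nat -> G :=
  fun m => if m == n then x else e m.

Fixpoint holds (e : nat -> G) (f : gform) : Prop :=
  match f with
  | FEq a b => teval e a = teval e b
  | FFalse => False
  | FNot g => ~ holds e g
  | FAnd g h => holds e g /\ holds e h
  | FOr g h => holds e g \/ holds e h
  | FImp g h => holds e g -> holds e h
  | FForall n g => forall x : G, holds (upd e n x) g
  | FExists n g => exists x : G, holds (upd e n x) g
  end.

Definition models (f : gform) : Prop := forall e : nat -> G, holds e f.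
End Eval.

(* Main.v *)
(* Write C_i for the centralizer of x_i, A for that of [x_0, x_1], and D_r for
   the set of products of commutators [a_i, x_i] with a_i in A and i < r.  In the
   free metabelian pro-p group F with basis x, A is the derived subgroup and C_i
   is isomorphic to Z_p, so both are definable.  The sentence [pres_axioms]
   states a few facts about these sets, and it is true in F because it holds in
   the Magnus group of pairs (u, v) with v in Lambda^d, u = 1 + sum v_i X_i a
   product of elements of the closures of the cyclic groups generated by 1 + X_i,
   and Lambda = Z_p[[X_0, ..., X_(d-1)]]; there it comes down to the exactness
   of the Koszul complex of X_0, ..., X_(r-1) in degree 1.

   Conversely let G be a profinite group with elements x_i satisfying the axioms.
   The commutator form C_i x C_j -> A / D_d makes every integer prime to p act
   invertibly on C_i.  On A, for w a power of x_0, [a, w] is also of the form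
   [b, w^n] with n prime to p, so a = b b^w ... b^(w^(n-1)) and a agrees with b^n
   in every finite quotient where w is trivial.  Hence every finite quotient of G
   is a p-group, generated by the images of the x_i, and freeness gives a
   surjection F -> G.  An element of its kernel lies in A_F, then in D_d, and then
   successively in D_r for r = d, ..., 0: by the axiom on the equation
   [a, x_r] in D_r and the nilpotency of finite p-groups, the kernel is contained
   in D_r as soon as it is contained in D_(r+1). *)

From HB Require Import structures.
Require Import Defs.
From mathcomp Require Import all_boot all_fingroup all_algebra all_solvable.
From mathcomp Require Import ring.
From mathcomp Require Import boolp classical_sets functions cardinality topology.

Set Implicit Arguments.
Unset Strict Implicit.
Unset Printing Implicit Defensive.

(** * Zero-dimensional compact spaces *)

Local Open Scope classical_set_scope.

(** A first-order sentence sees neither the topology nor Z_p. An exponent in Z_p is therefore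
    carried by an element of some C_i, and products and divisibility of exponents are read off the
    commutator form modulo D_d; hence the axioms on units and divisors are congruences between
    commutators. [Dset] and [Lset] have a fixed number of factors, which makes them first-order, and
    in a compact group such products of closed sets are closed, so that membership can be tested in
    finite quotients.

    The truth of the sentence in F comes from the converse half: the Magnus group is a profinite
    model, and the uniqueness argument itself identifies it with F. It is defined by explicit
    conditions on vectors, so that centralizers and the sets D_r can be computed coordinate by
    coordinate.

    In the uniqueness argument no axiom is available in F. The facts about F that mirror the axioms
    ([AF_span], [F_span], [Z_root]) are derived from topological generation by the y_i. The D_r
    filter [A, G] along the regular sequence X_0, ..., X_(d-1), and the descent ends because D_0 is
    trivial. *)

Section ZeroDimensional.
Variable T : topologicalType.

(** Otherwise the sets [A] minus [U] generate a proper filter; by closedness its cluster point lies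
    in every [A], hence in the open set [U], which all these traces avoid. With [U] empty this
    extracts finite subcovers. *)
Lemma compact_bigcap_sub (F : set (set T)) (U : set T) :
  compact [set: T] -> F setT -> (forall A B, F A -> F B -> F (A `&` B)) ->
  (forall A, F A -> closed A) -> open U ->
  (forall y, (forall A, F A -> A y) -> U y) ->
  exists2 A, F A & A `<=` U.
Proof.
move=> cT FT FI Fcl oU FU; apply: contrapT => nA.
pose G := filter_from F (fun A => A `&` ~` U).
have FG : ProperFilter G.
  apply: filter_from_proper; last first.
    move=> A FA; apply/set0P/eqP => A0; apply: nA; exists A => // y Ay.
    by apply: contrapT => Uy; have : (A `&` ~` U) y by []; rewrite A0.
  apply: filter_from_filter; first by exists setT.
  move=> A B FA FB; exists (A `&` B); first exact: FI.
  by move=> y [[Ay By] Uy]; split.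
have [y [_ cy]] := cT G FG filterT.
have Uy : U y.
  apply: FU => A FA; apply: contrapT => Ay.
  have [] // := cy (A `&` ~` U) (~` A); first by exists A.
    by apply: open_nbhs_nbhs; split => //; apply: closed_openC; exact: Fcl.
  by move=> z [[]].
have [] := cy (~` U) U; first by exists setT => // z [].
  by apply: open_nbhs_nbhs; split.
by move=> z [].
Qed.

(** The quasi-component [Q] of [x] is connected. If it split into two closed pieces, normality would
    put them in disjoint open sets [U] and [V]; some clopen [D] around [x] lies in their union, and
    [D] cut by [U] is a clopen set missing a piece of [Q]. *)
Lemma totally_disconnected_zero_dimensional :
  compact [set: T] -> hausdorff_space T -> totally_disconnected [set: T] ->
  zero_dimensional T.
Proof.
move=> cT hT tdT x y xy; apply: contrapT => noU.
pose F := [set C : set T | clopen C /\ C x].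
pose Q := [set z | forall C, F C -> C z].
have Qx : Q x by move=> C [].
have Qy : Q y.
  move=> C [cC Cx]; apply: contrapT => nCy; apply: noU; by exists C.
have clQ : closed Q.
  have -> : Q = \bigcap_(C in F) C.
    by apply/seteqP; split.
  by apply: closed_bigI => C [[]].
have cQ : connected Q.
  apply/connectedP => E [E0 QE [sep2 sep1]].
  have clE b : closed (E b).
    rewrite closure_id; apply/seteqP; split; first exact: subset_closure.
    move=> z clz; have : Q z.
      rewrite closure_id in clQ; rewrite clQ.
      by apply: closureS clz => w Ew; rewrite QE; case: b Ew; [right|left].
    rewrite QE => -[Ez|Ez]; case: b clz => // clz.
    - by have : (E false `&` closure (E true)) z by []; rewrite (sep1, sep2).
    - by have : (closure (E false) `&` E true) z by []; rewrite (sep1, sep2).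
  wlog Exf : E E0 QE sep1 sep2 clE / E false x.
    move=> W; have : Q x by []; rewrite QE => -[Ex|Ex]; first exact: (W E).
    apply: (W (fun b => E (~~ b))) => //.
    - by rewrite QE setUC.
    - by rewrite setIC.
    - by rewrite setIC.
  have nE : set_nbhs (E false) (~` E true).
    move=> z Ez; apply: open_nbhs_nbhs; split; first exact: closed_openC.
    by move=> Ez'; have : (E false `&` closure (E true)) z;
      [split => //; exact: subset_closure | rewrite (sep1, sep2)].
  have [C nC clC] := compact_normal hT cT (clE false) nE.
  pose U := C°; pose V := ~` closure C.
  have EU : E false `<=` U by move=> z /nC.
  have EV : E true `<=` V by move=> z Ez /clC.
  have oU : open U by exact: open_interior.
  have oV : open V by apply: closed_openC; exact: closed_closure.
  have [D FD DUV] : exists2 D, F D & D `<=` U `|` V.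
    apply: compact_bigcap_sub => //.
    - by split; [exact: clopenT|].
    - by move=> A B [cA Ax] [cB Bx]; split; [exact: clopenI|].
    - by move=> A [[]].
    - exact: openU.
    - by move=> z Qz; have : Q z by []; rewrite QE => -[/EU|/EV]; [left|right].
  have [z Ez] := E0 true.
  have : F (D `&` U).
    case: FD => -[oD cD] Dx; split; last by split=> //; exact: EU.
    split; first exact: openI.
    have -> : D `&` U = D `&` ~` V.
      apply/seteqP; split => w [Dw UV]; split => //.
        by move=> nV; apply: nV; apply: subset_closure; exact: interior_subset.
      by case: (DUV _ Dw).
    by apply: closedI => //; exact: open_closedC.
  have Qz : Q z by have : (E false `|` E true) z by [right]; rewrite -QE.
  move=> /Qz [_ Uz]; apply: (EV z Ez).
  by apply: subset_closure; exact: interior_subset.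
have : connected_component [set: T] x y by exists Q.
by rewrite tdT // => yx; rewrite yx eqxx in xy.
Qed.

End ZeroDimensional.

(** * Topological groups *)

Local Open Scope classical_set_scope.
Local Open Scope group_scope.

HB.mixin Record isTopologicalGroup G of monoid.Group G & Topological G := {
  mulg_continuous : continuous (fun xy : G * G => (xy.1 * xy.2)%g);
  invg_continuous : continuous (fun x : G => x^-1%g)
}.

#[short(type="tgroupType")]
HB.structure Definition TGroup :=
  {G of isTopologicalGroup G & monoid.Group G & Topological G}.

Section Continuity.
Variables (X : topologicalType) (G : tgroupType).
Implicit Types f g : X -> G.

Lemma continuousMg f g :
  continuous f -> continuous g -> continuous (fun x => f x * g x).
Proof.
move=> cf cg x; apply: (@continuous2_cvg _ _ _ _ _ _ f g (fun a b : G => a * b)).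
- exact: (mulg_continuous (f x, g x)).
- exact: cf.
- exact: cg.
Qed.

Lemma continuousVg f : continuous f -> continuous (fun x => (f x)^-1).
Proof.
by move=> cf x; apply: (continuous_comp (cf x)); exact: invg_continuous.
Qed.

Lemma continuousXg f n : continuous f -> continuous (fun x => f x ^+ n).
Proof.
move=> cf; elim: n => [|n IH]; first exact: cst_continuous.
by rewrite (_ : (fun x => _) = fun x => f x * f x ^+ n);
  [exact: continuousMg | apply/funext => x; rewrite expgS].
Qed.

Lemma continuousRg f g :
  continuous f -> continuous g -> continuous (fun x => [~ f x, g x]).
Proof.
move=> cf cg; apply: continuousMg; first exact: continuousVg.
by apply: continuousMg; [exact: continuousVg | exact: continuousMg].
Qed.

End Continuity.

Lemma id_continuous (X : topologicalType) : continuous (fun x : X => x).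
Proof. by move=> x; exact: cvg_id. Qed.

Lemma closed_preimage (X Y : topologicalType) (f : X -> Y) (A : set Y) :
  continuous f -> closed A -> closed [set x | A (f x)].
Proof. by move/continuous_closedP => cf /cf. Qed.

Lemma closed_forall (X : topologicalType) (I : Type) (P : I -> Prop) (A : I -> set X) :
  (forall i, P i -> closed (A i)) -> closed [set x | forall i, P i -> A i x].
Proof. exact: closed_bigI. Qed.

Lemma hausdorff_closed1 (X : topologicalType) (x : X) :
  hausdorff_space X -> closed [set x].
Proof. by move/hausdorff_accessible/accessible_closed_set1; apply. Qed.

Lemma closed_image (X Y : topologicalType) (f : X -> Y) (A : set X) :
  compact [set: X] -> hausdorff_space Y -> continuous f -> closed A ->
  closed (f @` A).
Proof.
move=> cX hY cf clA; apply: compact_closed => //.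
apply: continuous_compact; first by apply: continuous_subspaceT.
exact: subclosed_compact clA cX _.
Qed.

Definition subgrp (G : groupType) (H : set G) : Prop :=
  [/\ H 1, forall x y, H x -> H y -> H (x * y) & forall x, H x -> H x^-1].

Definition normal_subgrp (G : groupType) (H : set G) : Prop :=
  subgrp H /\ forall g x, H x -> H (x ^ g).

Definition cgen (G : tgroupType) (S : set G) : set G :=
  [set x | forall K, subgrp K -> closed K -> S `<=` K -> K x].

Definition mulset (G : groupType) (A B : set G) : set G :=
  [set z | exists a b, [/\ A a, B b & z = a * b]].

Section Subgroups.
Variable G : groupType.
Implicit Types (H K : set G) (x y g : G).

Lemma subgrpX H x n : subgrp H -> H x -> H (x ^+ n).
Proof.
by move=> [H1 HM _] Hx; elim: n => [|n IH]; rewrite ?expg0 // expgS; exact: HM.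
Qed.

Lemma subgrp_prod H n (F : nat -> G) :
  subgrp H -> (forall i, (i < n)%N -> H (F i)) -> H (\prod_(i < n) F i).
Proof.
move=> [H1 HM _] HF; elim: n HF => [|n IH] HF; first by rewrite big_ord0.
by rewrite big_ord_recr; apply: HM; [apply: IH => i /ltnW|]; exact: HF.
Qed.

Lemma subgrp_cen x : subgrp [set g | g * x = x * g].
Proof.
split => [|g h /= gx hx|g /= gx]; first by rewrite /= mul1g mulg1.
  by rewrite -mulgA hx mulgA gx mulgA.
by apply: (mulgI g); rewrite mulVKg mulgA gx mulgK.
Qed.

End Subgroups.

Section ClosedGen.
Variable G : tgroupType.
Implicit Types (S H K : set G).

Lemma subgrp_cgen S : subgrp (cgen S).
Proof.
split=> [K [] //|x y Sx Sy K gK cK SK|x Sx K gK cK SK]; have [_ KM KV] := gK.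
  by apply: KM; [exact: Sx|exact: Sy].
by apply: KV; exact: Sx.
Qed.

Lemma closed_cgen S : closed (cgen S).
Proof.
rewrite (_ : cgen S = \bigcap_(K in [set K | [/\ subgrp K, closed K & S `<=` K]]) K).
  by apply: closed_bigI => K [].
apply/seteqP; split=> [x Sx K [gK cK SK]|x Sx K gK cK SK]; first exact: Sx.
exact: Sx.
Qed.

Lemma sub_cgen S : S `<=` cgen S.
Proof. by move=> x Sx K _ _; apply. Qed.

Lemma cgen_min S K : subgrp K -> closed K -> S `<=` K -> cgen S `<=` K.
Proof. by move=> gK cK SK x; apply. Qed.

Lemma closed_cen (x : G) : hausdorff_space G -> closed [set g | g * x = x * g].
Proof.
move=> hG; rewrite (_ : [set g | _] = [set g | [set 1] [~ g, x]]).
  apply: closed_preimage; last exact: hausdorff_closed1.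
  by apply: continuousRg; [exact: id_continuous | exact: cst_continuous].
apply/seteqP; split => g /= E.
  by apply/eqP/commgP.
by apply/commgP/eqP.
Qed.

Lemma cgen_commute S x y : hausdorff_space G ->
  (forall s t, S s -> S t -> s * t = t * s) -> cgen S x -> cgen S y -> x * y = y * x.
Proof.
move=> hG SC Sx Sy; move: x Sx; apply: (cgen_min (subgrp_cen y)).
  exact: closed_cen.
move=> s Ss /=; apply/esym; move: y Sy; apply: (cgen_min (subgrp_cen s)).
  exact: closed_cen.
by move=> t St /=; exact/esym/SC.
Qed.

Lemma closed_mulset (A B : set G) : compact [set: G] -> hausdorff_space G ->
  closed A -> closed B -> closed (mulset A B).
Proof.
move=> cG hG cA cB.
have -> : mulset A B = (fun xy : G * G => xy.1 * xy.2) @` (A `*` B).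
  apply/seteqP; split => [z [a [b [Aa Bb ->]]]|z [[a b] [Aa Bb] <-]].
    by exists (a, b).
  by exists a, b.
apply: compact_closed => //.
apply: continuous_compact; first by apply: continuous_subspaceT; exact: mulg_continuous.
by apply: compact_setX; exact: subclosed_compact cG _.
Qed.

End ClosedGen.

(** Continuity for the discrete topology is encoded as openness of the kernel, so that [gT] can stay
    a bare finite group. *)
Definition fquot (G : tgroupType) (gT : finGroupType) (f : G -> gT) : Prop :=
  [/\ {morph f : x y / x * y}, (forall y, exists x, f x = y) &
      open [set x | f x = 1]].

(** Zero-dimensionality stands for total disconnectedness: clopen neighbourhoods are what the
    construction of open normal subgroups starts from. *)
Definition profin (G : tgroupType) : Prop :=
  [/\ compact [set: G], hausdorff_space G & zero_dimensional G].

Section MorphTheory.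
Variables (G H : groupType) (f : G -> H).
Hypothesis fM : {morph f : x y / x * y}.

Lemma morph1g : f 1 = 1.
Proof. by apply: (mulgI (f 1)); rewrite -fM !mulg1. Qed.

Lemma morphVg x : f x^-1 = (f x)^-1.
Proof. by apply: (mulgI (f x)); rewrite -fM !mulgV morph1g. Qed.

Lemma morphXg n x : f (x ^+ n) = f x ^+ n.
Proof. by elim: n => [|n IH]; rewrite ?morph1g // !expgS fM IH. Qed.

Lemma morphRg x y : f [~ x, y] = [~ f x, f y].
Proof. by rewrite /commg /conjg !fM !morphVg. Qed.

Lemma morph_prodg n (F : nat -> G) : f (\prod_(i < n) F i) = \prod_(i < n) f (F i).
Proof.
by elim: n => [|n IH]; rewrite ?big_ord0 ?morph1g // !big_ord_recr fM IH.
Qed.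

Lemma subgrp_preimage (K : set H) : subgrp K -> subgrp [set x | K (f x)].
Proof.
move=> [K1 KM KV]; split => /=; first by rewrite morph1g.
- by move=> x y; rewrite fM; exact: KM.
- by move=> x; rewrite morphVg; exact: KV.
Qed.

Lemma subgrp_image (K : set G) : subgrp K -> subgrp (f @` K).
Proof.
move=> [K1 KM KV]; split => /=; first by exists 1 => //; exact: morph1g.
- by move=> _ _ [x Kx <-] [y Ky <-]; exists (x * y); [exact: KM|exact: fM].
- by move=> _ [x Kx <-]; exists x^-1; [exact: KV|exact: morphVg].
Qed.

End MorphTheory.

Section OpenNormal.
Variable G : tgroupType.

Lemma nbhs_translate (A : set G) (a x b : G) : nbhs (a * x * b) A ->
  nbhs x [set y | A (a * y * b)].
Proof.
move=> nA; have : continuous (fun y : G => a * y * b).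
  apply: continuousMg; last exact: cst_continuous.
  by apply: continuousMg; [exact: cst_continuous|exact: id_continuous].
by move=> /(_ x A nA).
Qed.

Lemma nbhs_open_subgrp (H : set G) : subgrp H -> nbhs 1 H -> open H.
Proof.
move=> [H1 HM HV] nH; rewrite openE => x Hx; rewrite /interior /=.
have := @nbhs_translate H x^-1 x 1.
rewrite mulVg mulg1 => /(_ nH); apply: filterS => y /=; rewrite mulg1 => Hy.
by rewrite -(mulVKg x y); exact: HM.
Qed.

(* For a clopen neighbourhood V of 1, {g | g V = V} is an open subgroup by
   the tube lemma; the intersection of its conjugates is open for the same
   reason. *)
Lemma open_normal_basis (V : set G) : profin G -> nbhs 1 V ->
  exists U : set G, [/\ open U, normal_subgrp U & U `<=` V].
Proof.
move=> [cG hG zG] nV.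
have [W [W1 cW] WV] := zero_dimensional_cvg hG zG cG nV.
have tube (h : G * G -> G) (K : set G) (g0 : G) (P : set G) : continuous h -> compact K ->
    open P -> (forall k, K k -> P (h (g0, k))) -> nbhs g0 [set g | forall k, K k -> P (h (g, k))].
  move=> ch cK oP hP.
  have := (compact_near_coveringP K).1 cK G (nbhs g0) (fun g k => P (h (g, k))) _.
  apply => k Kk; have : nbhs (g0, k) [set x | P (h x)].
    by apply: ch; apply: open_nbhs_nbhs; split => //; exact: hP.
  move=> [[A B] [/= nA nB] AB]; exists (B, A) => //= -[y x] [/= By Ax].
  exact: (AB (x, y)).
have [oW clW] := cW.
have cpW : compact W by exact: subclosed_compact clW cG _.
pose H := [set g | (forall w, W w -> W (g * w)) /\ (forall w, W w -> W (g^-1 * w))].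
have gH : subgrp H.
  split=> [|x y [x1 x2] [y1 y2]|x [x1 x2]].
  - by split=> w; rewrite ?invg1 mul1g.
  - split=> w Ww; first by rewrite -mulgA; apply: x1; exact: y1.
    by rewrite invgM -mulgA; apply: y2; exact: x2.
  - by split=> // w; rewrite invgK; exact: x1.
have HW : H `<=` W by move=> g [/(_ 1 W1)]; rewrite mulg1.
have nH : nbhs 1 H.
  apply: filterI.
    apply: (tube (fun xy => xy.1 * xy.2)) => //; first exact: mulg_continuous.
    by move=> w; rewrite /= mul1g.
  apply: (tube (fun xy => xy.1^-1 * xy.2)) => //.
    apply: continuousMg; last by move=> ?; exact: cvg_snd.
    by apply: continuousVg => ?; exact: cvg_fst.
  by move=> w; rewrite /= invg1 mul1g.
have oH := nbhs_open_subgrp gH nH.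
pose U := [set x | forall g, H (x ^ g)].
exists U; split.
- apply: nbhs_open_subgrp.
    have [H1 HM HV] := gH.
    split => [g|x y Ux Uy g|x Ux g]; first by rewrite conj1g.
      by rewrite conjMg; apply: HM.
    by rewrite conjVg; exact: HV.
  have -> : U = [set x | forall g, setT g -> H (x ^ g)].
    by apply/seteqP; split => x /= Ux g => [_|]; exact: Ux.
  apply: (tube (fun xy => xy.1 ^ xy.2)) => //.
    apply: continuousMg; first by apply: continuousVg => ?; exact: cvg_snd.
    by apply: continuousMg => ?; [exact: cvg_fst|exact: cvg_snd].
  by move=> g _ /=; rewrite conj1g; case: gH.
- split; last by move=> g x Ux h; rewrite -conjgM.
  have [H1 HM HV] := gH.
  split => [g|x y Ux Uy g|x Ux g]; first by rewrite conj1g.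
    by rewrite conjMg; apply: HM.
  by rewrite conjVg; exact: HV.
- by move=> x /(_ 1); rewrite conjg1 => /HW /WV.
Qed.

End OpenNormal.

(** * Finite quotients *)

Section FiniteQuotient.
Variable G : tgroupType.
Implicit Types U : set G.

Definition transversal U n (s : 'I_n -> G) (r : G -> 'I_n) : Prop :=
  (forall g, U (g * (s (r g))^-1)) /\ (forall i j, U (s i * (s j)^-1) -> i = j).

Lemma transversal_eq U n (s : 'I_n -> G) r g h : subgrp U -> transversal U s r ->
  r g = r h <-> U (g * h^-1).
Proof.
move=> [_ UM UV] [rU sU]; split => [E|Ugh].
  by have := UM _ _ (rU g) (UV _ (rU h)); rewrite -E mulgKA.
apply: sU; have := UM _ _ (UM _ _ (UV _ (rU g)) Ugh) (rU h).
by rewrite invgM invgK -!mulgA mulKg mulKg.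
Qed.

Lemma transversalK U n (s : 'I_n -> G) r : subgrp U -> transversal U s r -> cancel s r.
Proof. by move=> gU [rU sU] i; apply: sU; have [_ _ UV] := gU; rewrite -invgF; apply: UV. Qed.

(* G acts on the cosets of U by right multiplication. *)
Lemma transversal_fquot U n (s : 'I_n -> G) r :
  open U -> normal_subgrp U -> transversal U s r ->
  exists (gT : finGroupType) (f : G -> gT),
    [/\ fquot f, (forall x, f x = 1 <-> U x) & #|gT| = n].
Proof.
move=> oU nU tU; have [gU UJ] := nU; have [U1 UM UV] := gU.
have rE := transversal_eq _ _ gU tU; have sK := transversalK gU tU.
have rJ i g : r (s i * g) = i <-> U g.
  rewrite -{2}(sK i) rE -[s i * g * _]mulgA; split => H.
    by have := UJ (s i) _ H; rewrite conjgE !mulgA mulVg mul1g mulgVK.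
  by have := UJ (s i)^-1 _ H; rewrite conjgE invgK mulgA.
have rho_inj g : injective (fun i => r (s i * g)).
  move=> i j /rE; rewrite invgM !mulgA mulgK => H.
  by case: tU => _; apply.
pose rho g := perm (@rho_inj g).
have rhoM : {morph rho : x y / x * y}.
  move=> x y; apply/permP => i; rewrite permM !permE; apply/rE.
  rewrite invgM !mulgA mulgK.
  by have := UV _ (proj1 tU (s i * x)); rewrite invgM invgK => H; rewrite -[_ * _]invgK; apply: UV; rewrite invgM invgK.
have gH : group_set [set y | `[< exists x, rho x = y >]]%SET.
  apply/group_setP; split.
    by rewrite finset.inE; apply/asboolP; exists 1; apply/permP => i; rewrite perm1 permE; apply/rJ.
  move=> y z; rewrite !finset.inE => /asboolP[a <-] /asboolP[b <-]; apply/asboolP.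
  by exists (a * b); rewrite rhoM.
pose H := Group gH.
have inH x : rho x \in H by rewrite finset.inE; apply/asboolP; exists x.
pose f x : subg_of H := subg H (rho x).
have fM : {morph f : x y / x * y} by move=> x y; rewrite /f rhoM subgM.
have fS y : exists x, f x = y.
  have := subgP y; rewrite finset.inE => /asboolP[x xE]; exists x.
  by rewrite /f xE sgvalK.
have f1 x : f x = 1 <-> U x.
  split => [E|Ux].
    have : rho x = 1 by rewrite -(@subgK _ H _ (inH x)) -/(f x) E.
    move=> /permP E1; have i := r 1.
    by apply/(rJ i); have := E1 i; rewrite permE perm1.
  rewrite /f (_ : rho x = 1) ?morph1 //.
  by apply/permP => i; rewrite perm1 permE; apply/rJ.
exists (subg_of H), f; split => //.
  split => //; rewrite (_ : [set x | f x = 1] = U) //.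
  by apply/seteqP; split => x /f1.
rewrite -[RHS]card_ord; pose k i := f (s i).
apply/esym; apply: (@bij_eq_card _ _ k).
have fE x y : f x = f y <-> U (x * y^-1).
  rewrite -f1 fM (morphVg fM); split => [->|E]; first by rewrite mulgV.
  by apply/divg1_eq.
exists (fun y => r (xget 1 [set x | f x = y])) => [i|y].
  rewrite -[RHS]sK; apply/rE/fE.
  case: xgetP => //= H0; by case: (H0 (s i)).
rewrite /k; case: xgetP => [x _ <-|H0]; last first.
  by have [x xy] := fS y; case: (H0 x).
by apply/fE; rewrite -[_ * _]invgK; apply: UV; rewrite invgM invgK; case: tU.
Qed.

(** Compactness gives a finite list [D] meeting every coset. Sending [g] to the first entry [c g] of
    [D] in its coset, and removing repetitions, leaves one representative per coset. *)
Lemma compact_transversal U : compact [set: G] -> open U -> normal_subgrp U ->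
  exists n s r, @transversal U n s r.
Proof.
move=> cG oU [gU UJ]; have [U1 UM UV] := gU.
have [D DU] : exists D : seq G, forall g, exists2 x, x \in D & U (g * x^-1).
  (* The family consists of the sets avoiding finitely many cosets. A point in all of them would
     avoid its own coset, so one of them is empty. *)
  have [|A B [s ->] [t ->]|A [s ->]||y yF|_ [s ->] sF] := @compact_bigcap_sub G
    [set A | exists s : seq G, A = [set g | forall x, x \in s -> ~ U (g * x^-1)]] set0 cG.
  - by exists [::]; apply/seteqP; split.
  - exists (s ++ t); apply/seteqP; split => g /=.
      by move=> [gs gt] x; rewrite mem_cat => /orP[/gs|/gt].
    by move=> gst; split => x xs; apply: gst; rewrite mem_cat xs ?orbT.
  - apply: closed_forall => x _; apply: open_closedC.
    apply: (open_comp (f := fun g : G => g * x^-1)) => // g _.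
    by apply: continuousMg; [exact: id_continuous|exact: cst_continuous].
  - exact: open0.
  - have := yF [set g | forall x, x \in [:: y] -> ~ U (g * x^-1)].
    apply; first by exists [:: y].
    by apply/mem_head.
    by rewrite mulgV.
  exists s => g; apply: contrapT => nx; apply: (sF g) => x xs Ux.
  by apply: nx; exists x.
pose E g x := `[< U (g * x^-1) >].
pose c g := nth 1 D (find (E g) D).
have hasE g : has (E g) D.
  have [x xD Ux] := DU g.
  by apply/hasP; exists x => //; apply/asboolP.
have cU g : U (g * (c g)^-1) by apply/asboolP/(nth_find 1 (hasE g)).
have cE g h : U (g * h^-1) -> c g = c h.
  move=> Ugh; rewrite /c; congr (nth _ _ _); apply: eq_find => x.
  apply/asboolP/asboolP => H.
    by have := UM _ _ (UV _ Ugh) H; rewrite invgM invgK -!mulgA mulKg.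
  by have := UM _ _ Ugh H; rewrite -!mulgA mulKg.
pose t := undup [seq c g | g <- D].
have ct g : c g \in t.
  rewrite mem_undup (cE _ _ (cU g)); apply/mapP; exists (c g) => //.
  by apply: mem_nth; rewrite -has_find.
have t1 : (index (c 1%g) t < size t)%N by rewrite index_mem.
exists (size t), (fun i => nth 1 t i), (fun g => Ordinal (etrans (index_mem (c g) t) (ct g))).
split=> [g|i j] /=; first by rewrite nth_index.
have cK k : (k < size t)%N -> c (nth 1 t k) = nth 1 t k.
  move=> kt; have : nth 1 t k \in t by rewrite mem_nth.
  rewrite mem_undup => /mapP[g _ ->]; apply: cE.
  by rewrite -invgF; apply: UV.
move=> /cE; rewrite !cK // => /eqP; rewrite nth_uniq ?undup_uniq // => /eqP.
exact: val_inj.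
Qed.

Lemma fquot_ker U : compact [set: G] -> open U -> normal_subgrp U ->
  exists (gT : finGroupType) (f : G -> gT), fquot f /\ forall x, f x = 1 <-> U x.
Proof.
move=> cG oU nU; have [n [s [r tU]]] := compact_transversal cG oU nU.
by have [gT [f [qf fU _]]] := transversal_fquot oU nU tU; exists gT, f.
Qed.

(** If [x] is outside [A], some coset of an open normal [U] through [x] misses [A], and the quotient
    by [U] separates [x] from [A]. This is the tool that reduces statements on profinite groups to
    finite ones. *)
Lemma fquot_separates (A : set G) x : profin G -> closed A ->
  (forall (gT : finGroupType) (f : G -> gT), fquot f -> exists2 a, A a & f a = f x) ->
  A x.
Proof.
move=> pG cA Ax; apply: contrapT => nAx; have [cG _ _] := pG.
have n1 : nbhs 1 [set y | ~ A (x * y)].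
  have := @nbhs_translate G (~` A) x 1 1; rewrite !mulg1 => H.
  have : nbhs x (~` A) by apply: open_nbhs_nbhs; split => //; exact: closed_openC.
  by move=> /H; apply: filterS => y /=; rewrite mulg1.
have [U [oU nU sU]] := open_normal_basis pG n1.
have [gT [f [qf fU]]] := fquot_ker cG oU nU.
have [a Aa E] := Ax gT f qf; have [fM _ _] := qf.
apply: (sU (x^-1 * a)); last by rewrite mulVKg.
by apply/fU; rewrite fM (morphVg fM) E mulVg.
Qed.

Lemma fquot_eq1 x : profin G ->
  (forall (gT : finGroupType) (f : G -> gT), fquot f -> f x = 1) -> x = 1.
Proof.
move=> pG x1; have [_ hG _] := pG.
apply: (fquot_separates (A := [set y | y = 1])) => //; first exact: hausdorff_closed1.
by move=> gT f qf; exists 1 => //; rewrite (x1 _ _ qf); have [fM _ _] := qf; exact: morph1g.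
Qed.

(** [cgen S] is closed, so it is tested in finite quotients, where its image is a subgroup
    containing the image of [S]. *)
Lemma fquot_cgen (S : set G) : profin G ->
  (forall (gT : finGroupType) (f : G -> gT), fquot f ->
     forall K : {group gT}, (forall s, S s -> f s \in K) -> K :=: [set: gT]%SET) ->
  cgen S = [set: G].
Proof.
move=> pG SG; apply/seteqP; split => // x _; apply: fquot_separates => //.
  exact: closed_cgen.
move=> gT f qf; have [fM _ _] := qf.
have [g1 gM gV] := subgrp_cgen S.
have gK : group_set [set y | `[< exists2 a, cgen S a & f a = y >]]%SET.
  apply/group_setP; split.
    by rewrite finset.inE; apply/asboolP; exists 1; rewrite ?(morph1g fM).
  move=> y z; rewrite !finset.inE => /asboolP[a Sa <-] /asboolP[b Sb <-].
  by apply/asboolP; exists (a * b); [exact: gM|rewrite fM].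
have E := SG gT f qf (Group gK).
have : f x \in Group gK.
  by rewrite E ?finset.inE // => s Ss; rewrite finset.inE; apply/asboolP; exists s => //; exact: sub_cgen.
by rewrite finset.inE => /asboolP.
Qed.

End FiniteQuotient.

Lemma fquot_open (G : tgroupType) (gT : finGroupType) (f : G -> gT) (B : set gT) :
  fquot f -> open [set x | B (f x)].
Proof.
move=> [fM fS oK].
rewrite (_ : [set x | _] = \bigcup_(y in [set y | B (f y)]) [set z | f (z * y^-1) = 1]).
  apply: bigcup_open => y _; apply: (open_comp (f := fun z : G => z * y^-1) (D := [set z | f z = 1])) => // z _.
  by apply: continuousMg; [exact: id_continuous|exact: cst_continuous].
apply/seteqP; split => [y By|y [z Bz E]]; first by exists y => //=; rewrite mulgV (morph1g fM).
rewrite /= (_ : f y = f z) //.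
by apply/divg1_eq; rewrite -(morphVg fM) -fM.
Qed.

(** * Metabelian congruences *)

Section Congruence.
Variables (G : groupType) (N : set G).
Hypothesis nN : normal_subgrp N.
Implicit Types u v w z : G.

Definition eqm u v := N (u * v^-1).

Lemma eqm_refl u : eqm u u.
Proof. by have [[N1 _ _] _] := nN; rewrite /eqm mulgV. Qed.

Lemma eqm_sym u v : eqm u v -> eqm v u.
Proof. by have [[_ _ NV] _] := nN; rewrite /eqm => /NV; rewrite invgF. Qed.

Lemma eqm_trans v u w : eqm u v -> eqm v w -> eqm u w.
Proof.
have [[_ NM _] _] := nN => uv vw; have := NM _ _ uv vw.
by rewrite mulgA mulgVK.
Qed.

Lemma eqmM u v w z : eqm u v -> eqm w z -> eqm (u * w) (v * z).
Proof.
have [[_ NM _] NJ] := nN => uv wz; have := NM _ _ (NJ v^-1 _ wz) uv.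
move=> H; have := NM _ _ uv (NJ v^-1 _ wz).
by rewrite /eqm conjgE invgK invgM !mulgA mulgVK.
Qed.

Lemma eqmV u v : eqm u v -> eqm u^-1 v^-1.
Proof.
have [[_ _ NV] NJ] := nN => uv; have := NJ u _ (NV _ uv).
by rewrite /eqm conjgE invgM !invgK !mulgA mulgVK.
Qed.

Lemma eqmX n u v : eqm u v -> eqm (u ^+ n) (v ^+ n).
Proof.
by move=> uv; elim: n => [|n IH]; rewrite ?expg0 ?expgS; [exact: eqm_refl|exact: eqmM].
Qed.

Lemma eqm1 u : eqm u 1 <-> N u.
Proof. by rewrite /eqm invg1 mulg1. Qed.

Lemma eqm_mem u v : eqm u v -> N v -> N u.
Proof. by move=> uv Nv; apply/eqm1; apply: (eqm_trans uv); exact/eqm1. Qed.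

Hypothesis NC : forall u v, N [~ u, v].

Lemma eqmC u v : eqm (u * v) (v * u).
Proof. by rewrite /eqm (commgCV u v) mulgK; exact: NC. Qed.

Lemma eqm_prodM n (E F : nat -> G) :
  eqm ((\prod_(i < n) E i) * \prod_(i < n) F i) (\prod_(i < n) (E i * F i)).
Proof.
elim: n => [|n IH]; first by rewrite !big_ord0 mulg1; exact: eqm_refl.
rewrite !big_ord_recr /=; set e := \prod_(i < n) E i; set f := \prod_(i < n) F i.
apply: (@eqm_trans (e * f * (E n * F n))); last exact: eqmM (eqm_refl _).
rewrite -!mulgA; apply: eqmM; first exact: eqm_refl.
rewrite !mulgA; apply: eqmM; last exact: eqm_refl.
exact: eqmC.
Qed.

Lemma eqm_prodX n (E : nat -> G) m :
  eqm ((\prod_(i < n) E i) ^+ m) (\prod_(i < n) (E i ^+ m)).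
Proof.
elim: m => [|m IH].
  by rewrite expg0 big1 => [|i _]; rewrite ?expg0 //; exact: eqm_refl.
rewrite expgS; apply: (@eqm_trans ((\prod_(i < n) E i) * \prod_(i < n) E i ^+ m)).
  by apply: eqmM; [exact: eqm_refl|].
apply: eqm_trans (eqm_prodM n E (fun i => E i ^+ m)) _.
by under eq_bigr do rewrite -expgS; exact: eqm_refl.
Qed.

End Congruence.

Lemma conj_comm (G : groupType) (a g : G) : a ^ g = a * [~ a, g].
Proof. by rewrite /commg mulVKg. Qed.

Lemma prod_single (G : groupType) (F : nat -> G) r i : (i < r)%N ->
  (forall j, j != i -> F j = 1) -> \prod_(j < r) F j = F i.
Proof.
move=> + F1; elim: r => // r IH; rewrite ltnS leq_eqVlt big_ord_recr /=.
case: eqVneq => [<- _|ir /= /IH ->]; last first.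
  by rewrite (F1 r) ?mulg1 1?eq_sym.
by rewrite big1 ?mul1g // => j _; apply: F1; rewrite ltn_eqF.
Qed.

Section Metabelian.
Variables (G : groupType) (A : set G).
Hypothesis gA : subgrp A.
Hypothesis AC : forall g h, A [~ g, h].
Hypothesis Aab : forall a b, A a -> A b -> a * b = b * a.
Implicit Types (a b c g h k : G).

Lemma met_conj a g : A a -> A (a ^ g).
Proof.
by have [_ AM _] := gA => Aa; rewrite conj_comm; exact: AM.
Qed.

Lemma met_normal : normal_subgrp A.
Proof. by split=> // g a; exact: met_conj. Qed.

Lemma met_conjA a b : A a -> A b -> a ^ b = a.
Proof. by move=> Aa Ab; rewrite conjgE (Aab Aa Ab) mulKg. Qed.

Lemma commMl g h k : [~ g * h, k] = [~ g, k] ^ h * [~ h, k].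
Proof. by rewrite /commg !conjgE !invgM !mulgA !mulgK. Qed.

Lemma commMr g h k : [~ g, h * k] = [~ g, k] * [~ g, h] ^ k.
Proof. by rewrite /commg !conjgE !invgM !mulgA !mulgK. Qed.

Lemma commVr g h : [~ g, h^-1] = ([~ g, h] ^ h^-1)^-1.
Proof. by rewrite -conjVg invgR /commg !conjgE !invgK !mulgA mulgV mul1g. Qed.

Lemma commVl g h : [~ g^-1, h] = ([~ g, h] ^ g^-1)^-1.
Proof. by rewrite -conjVg invgR /commg !conjgE !invgK !mulgA mulgK. Qed.

Lemma met_commM a b g : A a -> A b -> [~ a * b, g] = [~ a, g] * [~ b, g].
Proof. by move=> Aa Ab; rewrite commMl met_conjA. Qed.

Lemma met_commV a g : A a -> [~ a^-1, g] = [~ a, g]^-1.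
Proof. by have [_ _ AV] := gA => Aa; rewrite commVl met_conjA //; exact: AV. Qed.

Lemma met_comm_mul a b g : A a -> A b -> [~ a, g * b] = [~ a, g].
Proof.
move=> Aa Ab; rewrite commMr (met_conjA (AC _ _) Ab).
by rewrite (_ : [~ a, b] = 1) ?mul1g //; apply/eqP/commgP; exact: Aab.
Qed.

Lemma met_comm_conj a g h : A a -> [~ a, g] ^ h = [~ a ^ h, g].
Proof.
move=> Aa; rewrite conjRg (_ : g ^ h = g * [~ g, h]); last by rewrite mulVKg.
by rewrite met_comm_mul //; exact: met_conj.
Qed.

(** Expanding the commutator of [g * h] with [k], directly and through [g * h = h * g * [~ g, h]],
    gives [E]; the rest is cancellation in the abelian group [A]. *)
Lemma met_jacobi g h k : [~ [~ g, h], k] = [~ [~ g, k], h] * [~ [~ h, k], g]^-1.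
Proof.
have E : [~ g, k] ^ h * [~ h, k] = [~ h, k] ^ g * [~ g, k] * [~ [~ g, h], k].
  rewrite -!commMl (commgC g h) commMl met_conjA //; exact: AC.
move: E; rewrite !conj_comm => E.
have gen a b c u v : A a -> A b -> A c -> A u -> A v ->
    a * u * b = b * v * a * c -> c = u * v^-1.
  have [_ AM _] := gA => Aa Ab Ac Au Av Euv.
  have Aau := AM _ _ Aa Au; apply: (mulgI (b * v * a)); rewrite -Euv.
  rewrite (Aab Ab Av) -!mulgA (mulgA a u v^-1) (mulgA b) (mulgA v) (Aab Av (AM _ _ Ab Aau)) mulgK.
  by rewrite [a * (u * b)]mulgA; exact: Aab.
by apply: gen E; exact: AC.
Qed.

Section Dset.
Variable x : nat -> G.

(** One commutator per generator is enough: [a] maps to [[~ a, x i]] by a homomorphism on the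
    abelian group [A], so these products already form a subgroup. For fixed [r] the set is
    first-order. *)
Definition Dset r : set G :=
  [set z | exists a : nat -> G,
     (forall i, (i < r)%N -> A (a i)) /\ z = \prod_(i < r) [~ a i, x i]].

Lemma sub_Dset r : Dset r `<=` A.
Proof. by move=> _ [a [_ ->]]; apply: (subgrp_prod (F := fun i => [~ a i, x i])) => // i _; exact: AC. Qed.

Lemma prodA n (E F : nat -> G) : (forall i, A (E i)) -> (forall i, A (F i)) ->
  (\prod_(i < n) E i) * (\prod_(i < n) F i) = \prod_(i < n) (E i * F i).
Proof.
move=> AE AF; elim: n => [|n IH]; first by rewrite !big_ord0 mulg1.
rewrite !big_ord_recr /= -IH -!mulgA; congr (_ * _); rewrite !mulgA; congr (_ * _).
by apply: Aab; [exact: AE|apply: (subgrp_prod (F := F)) => // i _; exact: AF].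
Qed.

Lemma prodAV n (E : nat -> G) : (forall i, A (E i)) ->
  (\prod_(i < n) E i)^-1 = \prod_(i < n) (E i)^-1.
Proof.
move=> AE; have [_ _ AV] := gA.
apply: (mulgI (\prod_(i < n) E i)); rewrite mulgV (@prodA _ E (fun i => (E i)^-1)) //; last by move=> i; exact: AV.
by rewrite big1 // => i _; rewrite mulgV.
Qed.

(** Conjugation by [g] changes [x i] only by a factor in [A], which commutes with [a i ^ g]; so it
    acts on the parameters [a i] alone. *)
Lemma normal_Dset r : normal_subgrp (Dset r).
Proof.
have [A1 AM AV] := gA; split.
  split.
  - by exists (fun=> 1); split => //; rewrite big1 // => i _; rewrite comm1g.
  - move=> _ _ [a [Aa ->]] [b [Ab ->]]; exists (fun i => a i * b i); split.
      by move=> i ir; apply: AM; [exact: Aa|exact: Ab].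
    rewrite (prodA _ (fun i => AC (a i) (x i)) (fun i => AC (b i) (x i))).
    by apply: eq_bigr => i _; rewrite met_commM //; [exact: Aa|exact: Ab].
  - move=> _ [a [Aa ->]]; exists (fun i => (a i)^-1); split.
      by move=> i ir; apply: AV; exact: Aa.
    rewrite (prodAV _ (fun i => AC (a i) (x i))).
    by apply: eq_bigr => i _; rewrite met_commV //; exact: Aa.
move=> g _ [a [Aa ->]]; exists (fun i => a i ^ g); split.
  by move=> i ir; apply: met_conj; exact: Aa.
by rewrite conjg_prod; apply: eq_bigr => i _; rewrite met_comm_conj //; exact: Aa.
Qed.

Lemma Dset_comm r i a : (i < r)%N -> A a -> Dset r [~ a, x i].
Proof.
move=> ir Aa; have [A1 _ _] := gA; exists (fun j => if j == i then a else 1); split.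
  by move=> j _; case: eqP.
rewrite (prod_single (F := fun j => [~ if j == i then a else 1, x j]) ir) ?eqxx //.
by move=> j /negbTE ->; exact: comm1g.
Qed.

Lemma Dset_recrP r z : Dset r.+1 z ->
  exists a e, [/\ A a, Dset r e & z = e * [~ a, x r]].
Proof.
move=> [b [Ab ->]]; exists (b r), (\prod_(i < r) [~ b i, x i]); split.
- exact: Ab.
- by exists b; split => // i /ltnW; exact: Ab.
- by rewrite big_ord_recr.
Qed.

End Dset.
End Metabelian.

(** * Bilinearity of the commutator where commutators are central *)

Section Bilinear.
Variables (G : groupType) (N : set G).
Hypothesis nN : normal_subgrp N.
Hypothesis NCC : forall g h k, N [~ [~ g, h], k].

Lemma eqm_commMl g h k : eqm N [~ g * h, k] ([~ g, k] * [~ h, k]).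
Proof.
rewrite commMl conj_comm; apply: eqmM => //; last exact: eqm_refl.
rewrite -[X in eqm _ _ X]mulg1; apply: eqmM => //; first exact: eqm_refl.
by apply/eqm1; exact: NCC.
Qed.

Lemma eqm_commMr g h k : eqm N [~ g, h * k] ([~ g, h] * [~ g, k]).
Proof.
rewrite -[[~ g, h * k]]invgR -[X in eqm _ _ X]invgK; apply: eqmV => //.
rewrite invgM !invgR; apply: (eqm_trans nN) (eqm_commMl _ _ _) _.
rewrite [_ * _]commgC -[X in eqm _ _ X]mulg1; apply: eqmM => //; first exact: eqm_refl.
by apply/eqm1; exact: NCC.
Qed.

Lemma eqm_commXl g h n : eqm N [~ g ^+ n, h] ([~ g, h] ^+ n).
Proof.
elim: n => [|n IH]; first by rewrite !expg0 comm1g; exact: eqm_refl.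
rewrite !expgS; apply: (eqm_trans nN) (eqm_commMl _ _ _) _.
by apply: eqmM => //; exact: eqm_refl.
Qed.

Lemma eqm_commXr g h n : eqm N [~ g, h ^+ n] ([~ g, h] ^+ n).
Proof.
elim: n => [|n IH]; first by rewrite !expg0 commg1; exact: eqm_refl.
rewrite !expgS; apply: (eqm_trans nN) (eqm_commMr _ _ _) _.
by apply: eqmM => //; exact: eqm_refl.
Qed.

Lemma eqm_commVl g h : eqm N [~ g^-1, h] [~ g, h]^-1.
Proof.
rewrite commVl; apply: eqmV => //; rewrite conj_comm -[X in eqm _ _ X]mulg1.
by apply: eqmM => //; [exact: eqm_refl|apply/eqm1; exact: NCC].
Qed.

Lemma eqm_prod n (E F : nat -> G) : (forall i, (i < n)%N -> eqm N (E i) (F i)) ->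
  eqm N (\prod_(i < n) E i) (\prod_(i < n) F i).
Proof.
elim: n => [|n IH] EF; first by rewrite !big_ord0; exact: eqm_refl.
rewrite !big_ord_recr /=; apply: eqmM => //; last exact: EF.
by apply: IH => i /ltnW; exact: EF.
Qed.

End Bilinear.

(** * The axioms and their finite quotients *)

Section Presentation.
Variables (p d : nat) (G : groupType) (x : nat -> G).

Definition Acen : set G := [set g | g * [~ x 0%N, x 1%N] = [~ x 0%N, x 1%N] * g].

Definition Cx i : set G := [set g | g * x i = x i * g].

(** Stands for products of the basic commutators [[y i, y j]], [i < j], with exponents in Z_p: each
    exponent is carried by an element of [C i] put in place of a power of [y i]. *)
Definition Lset (C : nat -> set G) (y : nat -> G) r : set G :=
  [set z | exists g : nat -> nat -> G,
     (forall j i, (j < r)%N -> (i < j)%N -> C i (g j i)) /\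
     z = \prod_(j < r) \prod_(i < j) [~ g j i, y j]].

(* In the free metabelian pro-p group F with basis [x], [Acen] is the derived
   subgroup F', [Cx i] is the closed subgroup generated by [x i], a copy of the
   p-adic integers, and [Dset Acen x d] is [F', F]. *)
Record pres_axioms : Prop := PresAxioms {
  ax_comm : forall g h, Acen [~ g, h];
  ax_abel : forall a b, Acen a -> Acen b -> a * b = b * a;
  ax_gen : forall g, exists c : nat -> G, exists a,
    [/\ forall i, (i < d)%N -> Cx i (c i), Acen a & g = (\prod_(i < d) c i) * a];
  ax_indep : forall c : nat -> G, (forall i, (i < d)%N -> Cx i (c i)) ->
    Acen (\prod_(i < d) c i) -> forall i, (i < d)%N -> c i = 1;
  ax_root : forall i, (i < d)%N -> forall g, Cx i g ->
    exists e h, [/\ (e < p)%N, Cx i h & g = x i ^+ e * h ^+ p];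
  ax_aug : forall i, (i < d)%N -> forall z a, Cx i z -> Acen a -> Dset Acen x d [~ a, z];
  ax_prim : forall i, (i < d)%N -> forall h, Cx i h -> x i <> h ^+ p;
  ax_nondeg : forall i, (i < d)%N -> forall j, (j < d)%N -> i <> j -> forall h, Cx j h ->
    Dset Acen x d [~ x i, h] -> h = 1;
  (* In [F], not being a [p]-th power in [Cx i] says that the exponent of [z] is a unit; [h'] is [h]
     raised to its inverse. *)
  ax_unit : forall i, (i < d)%N -> forall j, (j < d)%N -> i <> j -> forall z h, Cx i z -> Cx j h ->
    (forall y, Cx i y -> z <> y ^+ p) ->
    exists2 h', Cx j h' & eqm (Dset Acen x d) [~ z, h'] [~ x i, h];
  (* In [F] the congruence says that the exponent of [w] is that of [z] times that of [h]; then [w]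
     is a p-adic power of [z]. *)
  ax_dvd : forall w z h, Cx 0 w -> Cx 0 z -> Cx 1 h ->
    eqm (Dset Acen x d) [~ w, x 1%N] [~ z, h] ->
    forall a, Acen a -> exists2 b, Acen b & [~ a, w] = [~ b, z];
  ax_cenp : forall y a, Cx 0 y -> Acen a -> [~ a, y ^+ p] = 1 -> [~ a, y] = 1;
  ax_span : forall a, Acen a -> mulset (Dset Acen x d) (Lset Cx x d) a;
  ax_free : forall g : nat -> nat -> G,
    (forall j i, (j < d)%N -> (i < j)%N -> Cx i (g j i)) ->
    Dset Acen x d (\prod_(j < d) \prod_(i < j) [~ g j i, x j]) ->
    forall j i, (j < d)%N -> (i < j)%N -> g j i = 1;
  ax_tors : forall i, (i < d)%N -> forall h, Cx i h -> h ^+ p = 1 -> h = 1;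
  (* Regularity of the sequence of the X_i: in Magnus coordinates [[~ a, x r]] is [a] multiplied by
     X_r. *)
  ax_reg : forall r, (r < d)%N -> forall a, Acen a -> Dset Acen x r [~ a, x r] ->
    mulset (Dset Acen x r) (Lset Cx x r) a
}.

End Presentation.

(** * Profinite models are pro-p and topologically generated by the x_i *)

Section ProP.
Variables (p d : nat) (G : tgroupType) (x : nat -> G).
Hypothesis pp : prime p.
Hypothesis d2 : (2 <= d)%N.
Hypothesis pG : profin G.
Hypothesis ax : pres_axioms p d x.

Let A := Acen x.
Let C i := Cx x i.
Let D r := Dset A x r.

Let d0 : (0 < d)%N. Proof. exact: ltnW. Qed.

Lemma gA : subgrp A. Proof. exact: subgrp_cen. Qed.
Lemma gC i : subgrp (C i). Proof. exact: subgrp_cen. Qed.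

Let AC := ax_comm ax.
Let Aab := ax_abel ax.
Let nA : normal_subgrp A := met_normal gA AC.
Let nD r : normal_subgrp (D r) := normal_Dset gA AC Aab x r.

(** [ax_aug] settles factors taken from the [C i], and [ax_gen] writes [g] as a product of such
    factors times an element of [A], which commutes with [a]. *)
Lemma DcommA a g : A a -> D d [~ a, g].
Proof.
move=> Aa; have [c [b [Cc Ab ->]]] := ax_gen ax g.
have [[D1 DM _] DJ] := nD d.
rewrite (met_comm_mul AC Aab) //.
have H i : (i < d)%N -> D d [~ a, c i] by move=> id; apply: (ax_aug ax id (Cc i id)).
suff H' n : (n <= d)%N -> D d [~ a, \prod_(i < n) c i] by exact: H'.
elim: n => [|n IH] nd; first by rewrite big_ord0 commg1.
rewrite big_ord_recr /= commMr; apply: DM; first exact: H.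
by apply: DJ; apply: IH; exact: ltnW.
Qed.

Let NCC g h k : D d [~ [~ g, h], k]. Proof. by apply: DcommA; exact: AC. Qed.
Let eqD_commMr := eqm_commMr (nD d) NCC.
Let eqD_commXl := eqm_commXl (nD d) NCC.
Let eqD_commXr := eqm_commXr (nD d) NCC.

Lemma exists_other j : (j < d)%N -> exists2 i, (i < d)%N & i <> j.
Proof. by case: j => [|j] _; [exists 1%N|exists 0%N]. Qed.

Lemma C_A1 j c : (j < d)%N -> C j c -> A c -> c = 1.
Proof.
move=> jd Cc Ac; have [i id ij] := exists_other jd.
apply: (ax_nondeg ax id jd ij Cc); rewrite -invgR.
by have [[_ _ DV] _] := nD d; apply: DV; exact: DcommA.
Qed.

(** The commutator lies both in [C j] and in [A], which meet trivially by [C_A1]. *)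
Lemma C_commute j g h : (j < d)%N -> C j g -> C j h -> g * h = h * g.
Proof.
move=> jd Cg Ch; apply/commgP/eqP; apply: (C_A1 jd); last exact: AC.
by have [_ CM CV] := gC j; apply: (CM); [exact: CV|apply: (CM); [exact: CV|exact: CM]].
Qed.

Lemma xX_prim i n y : (i < d)%N -> coprime n p -> C i y -> x i ^+ n <> y ^+ p.
Proof.
move=> id cnp Cy E; have [_ CM CV] := gC i.
have Cxi : C i (x i) by [].
have n0 : (0 < n)%N.
  by case: n cnp {E} => //; rewrite /coprime gcd0n => /eqP p1; have := pp; rewrite p1.
(* Bezout: [km * n = kn * p + 1]. From [x i ^+ n = y ^+ p] it follows that [x i] is the [p]-th power
   of [y ^+ km * (x i ^+ kn)^-1], against [ax_prim]. *)
have [km kn mE _] := egcdnP p n0.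
have Ch : C i (y ^+ km * (x i ^+ kn)^-1).
  by apply: CM; [exact: subgrpX (gC i) Cy|apply: CV; exact: subgrpX (gC i) Cxi].
apply: (ax_prim ax id Ch).
have cm : commute (y ^+ km) (x i ^+ kn)^-1.
  by apply: commuteV; apply: commuteX2.
rewrite expgMn // -expgnA mulnC expgnA -E -expgnA mulnC mE.
move: cnp; rewrite /coprime => /eqP ->.
by rewrite addnC expgnDr expg1 expVgn -expgnA mulgK.
Qed.

(** [ax_unit] with [z = x i ^+ n], no [p]-th power by [xX_prim], gives [h']; bilinearity moves the
    exponent, so [[~ x i, h' ^+ n]] and [[~ x i, h]] agree modulo [D d], and [ax_nondeg] cancels
    [x i]. *)
Lemma C_divisible j h n : (j < d)%N -> coprime n p -> C j h ->
  exists2 h', C j h' & h = h' ^+ n.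
Proof.
move=> jd cnp Ch; have [i id ij] := exists_other jd.
have Cz : C i (x i ^+ n) by exact: subgrpX (gC i) _.
have [h' Ch' E] := ax_unit ax id jd ij Cz Ch (fun y Cy => xX_prim id cnp Cy).
exists h' => //; apply/esym/divg1_eq/(ax_nondeg ax id jd ij).
  have [_ CM CV] := gC j.
  by apply: CM; [exact: subgrpX (gC j) Ch'|exact: CV].
apply: (eqm_mem (nD d)) (eqD_commMr _ _ _) _.
have [[_ _ DV] _] := nD d.
have -> : [~ x i, h^-1] = [~ x i, h]^-1 ^ h^-1 by rewrite commVr conjVg.
rewrite conj_comm; apply/eqm1.
have : eqm (D d) ([~ x i, h' ^+ n] * [~ x i, h]^-1) 1.
  rewrite -(mulgV [~ x i, h]); apply: eqmM => //; last exact: eqm_refl.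
  apply: eqm_trans E => //; apply: eqm_trans (eqD_commXr _ _ _) _ => //.
  by apply: eqm_sym => //; exact: eqD_commXl.
move=> H; rewrite mulgA -[X in eqm _ _ X]mulg1; apply: eqmM => //.
apply/eqm1; apply: DcommA.
by have [_ _ AV] := gA; apply: AV; exact: AC.
Qed.

Section Quotient.
Variables (gT : finGroupType) (f : G -> gT).
Hypothesis qf : fquot f.

Let fM : {morph f : x y / x * y}. Proof. by case: qf. Qed.
(** The order of the quotient is [n * P] with [n] prime to [p] and [P] a power of [p]. The exponent
    [n * P] kills everything; the point is to get rid of [n]. *)
Let n := (#|gT| `_p^')%N.
Let P := (#|gT| `_p)%N.

Let cnp : coprime n p.
Proof. by rewrite coprime_sym prime_coprime // -p'natE // part_pnat. Qed.

Let nP : (n * P)%N = #|gT|.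
Proof. by rewrite mulnC partnC //; apply/card_gt0P; exists 1. Qed.

Let expP (z : gT) : (z ^+ n) ^+ P = 1.
Proof. by rewrite -expgM nP -cardsT; apply: expg_cardG; rewrite finset.inE. Qed.

(** An [n]-th root of [h] exists already in [C j], and [n * P] kills its image. *)
Lemma quot_CX j h : (j < d)%N -> C j h -> f h ^+ P = 1.
Proof.
move=> jd Ch; have [h' Ch' ->] := C_divisible jd cnp Ch.
by rewrite (morphXg fM); exact: expP.
Qed.

(** Killed by [f] thanks to [quot_CX], while commutation with it is still injective on [A]. *)
Let w := x 0%N ^+ P.

(** [ax_cenp] removes the factors [p] of the exponent one at a time. For [x 0] itself, [ax_reg] with
    [r = 0] applies: both factors of its conclusion are then empty products. *)
Lemma comm_w_inj a : A a -> [~ a, w] = 1 -> a = 1.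
Proof.
move=> Aa; rewrite /w /P p_part; elim: (logn p _) => [|k IH].
  rewrite expn0 expg1 => E.
  have [|u [v [[b [_ ->]] [g [_ ->]] ->]]] := ax_reg ax d0 Aa.
  - by rewrite E; exists (fun=> 1); rewrite big_ord0.
  - by rewrite !big_ord0 mulg1.
rewrite expnSr expgnA => E; apply: IH.
by apply: (ax_cenp ax _ Aa E); exact: subgrpX (gC 0) _.
Qed.

Lemma quot_AX a : A a -> f a ^+ P = 1.
Proof.
move=> Aa; have d1 : (1 < d)%N by [].
(* [h'] acts as an [n]-th root of [x 1]: raising to the power [P] makes [[~ w ^+ n, h']] congruent
   to [[~ w, x 1]], the premise of [ax_dvd] with [z = w ^+ n]. *)
have [h' Ch' E] : exists2 h', C 1 h' & eqm (D d) [~ x 0%N ^+ n, h'] [~ x 0%N, x 1%N].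
  apply: (ax_unit ax d0 d1) => //; first exact: subgrpX (gC 0) _.
  by move=> y; exact: xX_prim.
have Cw : C 0 w by exact: subgrpX (gC 0) _.
have [||b Ab Eb] := ax_dvd ax Cw (_ : C 0 (w ^+ n)) Ch' _ Aa.
- exact: subgrpX (gC 0) _.
- rewrite /w -expgnA mulnC expgnA.
  apply: eqm_trans (eqD_commXl _ _ _) _ => //.
  apply: eqm_trans (eqm_sym _ (eqD_commXl _ _ _)) => //.
  by apply: eqmX => //; apply: eqm_sym.
have fw : f w = 1 by rewrite /w (morphXg fM); apply: (quot_CX d0).
pose N m := \prod_(i < m) (b ^ (w ^+ i)).
have AN m : A (N m).
  apply: (subgrp_prod (F := fun i => b ^ (w ^+ i)) gA) => i _.
  by apply: (met_conj gA AC).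
have NE m : [~ b, w ^+ m] = [~ N m, w].
  elim: m => [|m IH]; first by rewrite /N big_ord0 expg0 commg1 comm1g.
  rewrite /N big_ord_recr /= -/(N m) (met_commM AC Aab _ (AN m)); last by apply: (met_conj gA AC).
  rewrite expgS commMr IH; congr (_ * _).
  by rewrite (met_comm_conj gA AC).
have fN m : f (N m) = f b ^+ m.
  elim: m => [|m IH]; first by rewrite /N big_ord0 (morph1g fM).
  rewrite /N big_ord_recr /= -/(N m) fM IH expgSr; congr (_ * _).
  by rewrite /conjg !fM (morphVg fM) (morphXg fM) fw expg1n invg1 mul1g mulg1.
suff -> : a = N n by rewrite fN; exact: expP.
apply/divg1_eq/comm_w_inj.
  by have [_ AM AV] := gA; apply: AM => //; apply: AV.
have [_ _ AV] := gA.
by rewrite (met_commM AC Aab) ?(met_commV gA AC Aab) ?Eb ?NE ?mulgV //; exact: AV.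
Qed.

(** One factor [P] of the exponent brings [f g] into the image of [A], since it kills the components
    in the [C i]; the second kills that image. Cauchy's theorem then excludes other primes. *)
Lemma quot_pgroup : p.-group [set: gT]%SET.
Proof.
have pw g : f g ^+ (P * P) = 1.
  have [c [a [Cc Aa gE]]] := ax_gen ax g.
  have E : eqm A (g ^+ P) (\prod_(i < d) (c i ^+ P)).
    apply: (eqm_trans nA) (eqm_prodX nA AC d c P).
    rewrite gE; apply: eqmX => //; rewrite -[X in eqm _ _ X]mulg1.
    by apply: eqmM => //; [exact: eqm_refl|apply/eqm1].
  rewrite expgM -(morphXg fM).
  suff -> : f (g ^+ P) = f (g ^+ P * (\prod_(i < d) (c i ^+ P))^-1) by exact: quot_AX.
  rewrite [RHS]fM (morphVg fM) (morph_prodg fM d (fun i => c i ^+ P)) big1 ?invg1 ?mulg1 //.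
  by move=> i _; rewrite (morphXg fM); apply: quot_CX => //; exact: Cc.
rewrite /pgroup; apply/pnatP; first by rewrite cardsT; apply/card_gt0P; exists 1.
move=> q pq qG; have [y _ yq] := Cauchy pq qG.
have [_ fS _] := qf; have [g gy] := fS y.
have := pw g; rewrite gy => /eqP; rewrite -order_dvdn yq /P p_part -expnD Euclid_dvdX // => /andP[].
by rewrite dvdn_prime2 // => /eqP -> _; rewrite finset.inE /=.
Qed.

(** Iterating [ax_root] writes [h] as a power of [x j] times a [p ^ k]-th power from [C j]; once
    [p ^ k] is the [p]-part of the group order, the latter dies in the quotient. *)
Lemma quot_eq_pow j h : (j < d)%N -> C j h -> exists e, f h = f (x j) ^+ e.
Proof.
move=> jd Ch.
suff H k : exists e h', C j h' /\ h = x j ^+ e * h' ^+ (p ^ k).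
  have [e [h' [Ch' ->]]] := H (logn p #|gT|); exists e.
  by rewrite fM !(morphXg fM) -p_part -/P (quot_CX jd Ch') mulg1.
elim: k => [|k [e [h' [Ch' ->]]]].
  by exists 0%N, h; rewrite expn0 expg0 mul1g expg1.
have [e' [h'' [_ Ch'' ->]]] := ax_root ax jd Ch'.
exists (e + e' * p ^ k)%N, h''; split => //.
rewrite expgMn; last by apply: (C_commute jd); [exact: subgrpX (gC j) _|exact: subgrpX (gC j) _].
by rewrite mulgA -!expgnA -expgnDr expnS.
Qed.

(** Generation of a finite [p]-group may be checked modulo its Frattini subgroup. That subgroup
    contains the commutators, hence the image of [A] by [ax_span]; the [C i] are covered by
    [quot_eq_pow]. *)
Lemma quot_gen (K : {group gT}) :
  (forall i, (i < d)%N -> f (x i) \in K) -> K :=: [set: gT]%SET.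
Proof.
move=> Kx; have pT := quot_pgroup.
suff E : ('Phi([set: gT]) <*> K = [set: gT])%SET.
  by rewrite -[RHS](Phi_nongen E) genGid.
apply/eqP; rewrite finset.eqEsubset finset.subsetT /=; apply/fintype.subsetP => y _.
have [_ fS _] := qf; have [g <-] := fS y.
have [c [a [Cc Aa ->]]] := ax_gen ax g.
rewrite fM groupM //.
  rewrite (morph_prodg fM d c); apply: group_prod => i _.
  have [e ->] := quot_eq_pow (ltn_ord i) (Cc i (ltn_ord i)).
  by rewrite groupX // mem_gen // finset.inE Kx ?orbT.
apply: mem_gen; rewrite finset.inE (Phi_joing pT); apply/orP; left.
apply: mem_gen; rewrite finset.inE; apply/orP; left.
have com g1 g2 : f [~ g1, g2] \in [~: [set: gT], [set: gT]]%SET.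
  by rewrite (morphRg fM) mem_commg ?finset.inE.
have [u [v [[b [_ ->]] [k [_ ->]] ->]]] := ax_span ax Aa.
rewrite fM groupM //.
  by rewrite (morph_prodg fM d (fun i => [~ b i, x i])); apply: group_prod => i _.
rewrite (morph_prodg fM d (fun j => \prod_(i < j) [~ k j i, x j])).
apply: group_prod => j _.
by rewrite (morph_prodg fM j (fun i => [~ k j i, x j])); apply: group_prod => i _.
Qed.

End Quotient.

Lemma C_sub_cgen j : (j < d)%N -> C j `<=` cgen [set x j].
Proof.
move=> jd h Ch; apply: fquot_separates => //; first exact: closed_cgen.
move=> gT f qf; have [e E] := quot_eq_pow qf jd Ch.
exists (x j ^+ e); last by rewrite E; have [fM _ _] := qf; rewrite (morphXg fM).
by apply: (subgrpX (H := cgen [set x j])); [exact: subgrp_cgen|exact: sub_cgen].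
Qed.

Lemma cgen_x : cgen [set x i | i in [set i | (i < d)%N]] = [set: G].
Proof.
apply: fquot_cgen => // gT f qf K Kx; apply: (quot_gen qf) => i id.
by apply: Kx; exists i.
Qed.

End ProP.

(** * Uniqueness of the model *)

(** Common shape of [Dset] and [Lset], from which both inherit closedness as finite products of
    compact sets. *)
Definition prodset (G : groupType) (S : nat -> set G) n : set G :=
  [set z | exists s : nat -> G, (forall i, (i < n)%N -> S i (s i)) /\ z = \prod_(i < n) s i].

Definition commset (G : groupType) (A : set G) (y : G) : set G :=
  (fun a => [~ a, y]) @` A.

Section ClosedProducts.
Variable G : tgroupType.
Hypothesis cG : compact [set: G].
Hypothesis hG : hausdorff_space G.

Lemma closed_prodset (S : nat -> set G) n :
  (forall i, (i < n)%N -> closed (S i)) -> closed (prodset S n).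
Proof.
elim: n => [|n IH] cS.
  rewrite (_ : prodset S 0 = [set 1]); first exact: hausdorff_closed1.
  apply/seteqP; split => [z [s [_ ->]]|_ ->]; first by rewrite big_ord0.
  by exists (fun=> 1); rewrite big_ord0.
rewrite (_ : prodset S n.+1 = mulset (prodset S n) (S n)).
  apply: closed_mulset => //; last exact: cS.
  by apply: IH => i /ltnW; exact: cS.
apply/seteqP; split => [z [s [Ss ->]]|z [_ [b [[s [Ss ->]] Sb ->]]]].
  exists (\prod_(i < n) s i), (s n); rewrite big_ord_recr; split => //; last exact: Ss.
  by exists s; split => // i /ltnW; exact: Ss.
exists (fun j => if j == n then b else s j); split.
  by move=> i; case: eqP => [->//|/eqP ni]; rewrite ltnS leq_eqVlt (negbTE ni) => /Ss.
rewrite big_ord_recr /= eqxx; congr (_ * _); apply: eq_bigr => i _.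
by rewrite ltn_eqF.
Qed.

Lemma closed_commset (A : set G) y : closed A -> closed (commset A y).
Proof.
move=> cA; apply: closed_image => //; apply: continuousRg.
  exact: id_continuous.
exact: cst_continuous.
Qed.

Lemma DsetE (A : set G) (y : nat -> G) r :
  Dset A y r = prodset (fun i => commset A (y i)) r.
Proof.
apply/seteqP; split => [z [a [Aa ->]]|z [s [Ss ->]]].
  exists (fun i => [~ a i, y i]); split => // i ir; exists (a i) => //; exact: Aa.
have /choice[a Ha] : forall i, exists a, (i < r)%N -> A a /\ [~ a, y i] = s i.
  move=> i; case: (ltnP i r) => [/Ss[a Aa <-]|_]; last by exists 1.
  by exists a.
exists a; split; first by move=> i /Ha[].
by apply: eq_bigr => i _; have [_ ->] := Ha i (ltn_ord i).
Qed.

Lemma closed_Dset (A : set G) (y : nat -> G) r : closed A -> closed (Dset A y r).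
Proof. by move=> cA; rewrite DsetE; apply: closed_prodset => i _; exact: closed_commset. Qed.

Lemma LsetE (C : nat -> set G) (y : nat -> G) r :
  Lset C y r = prodset (fun j => prodset (fun i => commset (C i) (y j)) j) r.
Proof.
apply/seteqP; split => [z [g [Cg ->]]|z [s [Ss ->]]].
  exists (fun j => \prod_(i < j) [~ g j i, y j]); split => // j jr.
  exists (fun i => [~ g j i, y j]); split => // i ij.
  by exists (g j i) => //; exact: Cg.
have /choice[g Hg] : forall j, exists g : nat -> G, (j < r)%N ->
    (forall i, (i < j)%N -> C i (g i)) /\ s j = \prod_(i < j) [~ g i, y j].
  move=> j; case: (ltnP j r) => [/Ss[t [St ->]]|_]; last by exists (fun=> 1).
  have /choice[g Hg] : forall i, exists g, (i < j)%N -> C i g /\ [~ g, y j] = t i.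
    move=> i; case: (ltnP i j) => [/St[a Ca <-]|_]; last by exists 1.
    by exists a.
  exists g => _; split; first by move=> i /Hg[].
  by apply: eq_bigr => i _; have [_ ->] := Hg i (ltn_ord i).
exists g; split; first by move=> j i jr ij; have [H _] := Hg j jr; exact: H.
by apply: eq_bigr => j _; have [_ ->] := Hg j (ltn_ord j).
Qed.

Lemma closed_Lset (C : nat -> set G) (y : nat -> G) r :
  (forall i, closed (C i)) -> closed (Lset C y r).
Proof.
move=> cC; rewrite LsetE; apply: closed_prodset => j _.
by apply: closed_prodset => i _; exact: closed_commset.
Qed.

End ClosedProducts.

Section Unique.
Variables (p d : nat) (F G : tgroupType) (x : nat -> G) (y : nat -> F) (phi : F -> G).
Hypothesis pp : prime p.
Hypothesis d2 : (2 <= d)%N.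
Hypothesis pF : profin F.
Hypothesis pG : profin G.
Hypothesis ax : pres_axioms p d x.
Hypothesis Fp : forall (gT : finGroupType) (f : F -> gT), fquot f -> p.-group [set: gT]%SET.
Hypothesis Fgen : cgen [set y i | i in [set i | (i < d)%N]] = [set: F].

Let AF : set F := cgen [set z | exists g h, z = [~ g, h]].
Hypothesis AFab : forall a b, AF a -> AF b -> a * b = b * a.
Hypothesis phiM : {morph phi : u v / u * v}.
Hypothesis phic : continuous phi.
Hypothesis phi_y : forall i, (i < d)%N -> phi (y i) = x i.

Let Z i : set F := cgen [set y i].
Let DF := Dset AF y.
Let A := Acen x.
Let C i := Cx x i.
Let D := Dset A x.

Let cF : compact [set: F]. Proof. by case: pF. Qed.
Let hF : hausdorff_space F. Proof. by case: pF. Qed.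
Let hG : hausdorff_space G. Proof. by case: pG. Qed.
Let gAF : subgrp AF. Proof. exact: subgrp_cgen. Qed.
Let cAF : closed AF. Proof. exact: closed_cgen. Qed.
Let AFC g h : AF [~ g, h]. Proof. by apply: sub_cgen; exists g, h. Qed.
Let nAF : normal_subgrp AF. Proof. exact: met_normal. Qed.
Let nDF r : normal_subgrp (DF r). Proof. exact: normal_Dset. Qed.
Let cDF r : closed (DF r). Proof. exact: closed_Dset. Qed.
Let gZ i : subgrp (Z i). Proof. exact: subgrp_cgen. Qed.
Let cZ i : closed (Z i). Proof. exact: closed_cgen. Qed.
Let Zy i : Z i (y i). Proof. exact: sub_cgen. Qed.

Let Zcomm i u v : Z i u -> Z i v -> u * v = v * u.
Proof.
move=> Zu Zv; apply: (@cgen_commute F [set y i] u v hF _ Zu Zv).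
by move=> s t -> ->.
Qed.

Lemma Fgen_ind (K : set F) : subgrp K -> closed K -> (forall i, (i < d)%N -> K (y i)) ->
  forall g, K g.
Proof.
move=> gK cK Ky g; have : [set: F] g by []; rewrite -Fgen; apply: cgen_min => //.
by move=> _ [i id <-]; exact: Ky.
Qed.

Lemma phi_surj g : exists u, phi u = g.
Proof.
suff : cgen [set x i | i in [set i | (i < d)%N]] `<=` phi @` setT.
  by rewrite (cgen_x pp d2 pG ax) => /(_ g I) [u _ <-]; exists u.
apply: cgen_min.
- by apply: (subgrp_image phiM); split.
- exact: closed_image.
- by move=> _ [i id <-]; exists (y i) => //; exact: phi_y.
Qed.

(** For fixed [c] in [AF], the [k] with [[~ c, k]] in [DF d] form a closed subgroup containing the
    generators [y i]. *)
Let NCCF g h k : DF d [~ [~ g, h], k].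
Proof.
suff H c : AF c -> DF d [~ c, k] by exact: H.
move=> Ac; move: k; apply: Fgen_ind.
- have [[D1 DM DV] DJ] := nDF d; split.
  + by rewrite /= commg1.
  + by move=> u v Du Dv; rewrite /= commMr; apply: DM => //; exact: DJ.
  + by move=> u Du; rewrite /= commVr; apply: DV; exact: DJ.
- apply: (closed_preimage (f := fun k => [~ c, k])) => //.
  by apply: continuousRg; [exact: cst_continuous|exact: id_continuous].
- by move=> i id; apply: Dset_comm.
Qed.

Let comm2 (g : nat -> nat -> F) r := \prod_(j < r) \prod_(i < j) [~ g j i, y j].

Let AF_comm1 (g : nat -> F) j k : AF (\prod_(i < j) [~ g i, k]).
Proof. by apply: (subgrp_prod (F := fun i => [~ g i, k])). Qed.

Let AF_comm2 g r : AF (comm2 g r).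
Proof. by apply: (subgrp_prod (F := fun j => \prod_(i < j) [~ g j i, y j])). Qed.

(** By bilinearity modulo [DF d] the right-hand side [K] is a closed subgroup, and its elements in
    [AF] stay in it under conjugation, which is trivial on [AF] modulo [DF d]. It contains every
    [[~ y i, y j]]; generation by the [y i], used once per argument, gives all commutators. *)
Lemma AF_span a : AF a -> mulset (DF d) (Lset Z y d) a.
Proof.
pose K : set F := mulset (DF d) (Lset Z y d).
have KE u : K u <-> exists g : nat -> nat -> F,
    (forall j i, (j < d)%N -> (i < j)%N -> Z i (g j i)) /\ eqm (DF d) u (comm2 g d).
  split=> [[e [_ [De [g [Zg ->]] ->]]]|[g [Zg E]]].
    by exists g; split => //; rewrite /eqm mulgK.
  exists (u * (comm2 g d)^-1), (comm2 g d); split => //; last by rewrite mulgVK.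
  by exists g.
have nd := nDF d.
have gK : subgrp K.
  split.
  - apply/KE; exists (fun _ _ => 1); split; first by move=> j i _ _; case: (gZ i).
    rewrite /comm2 big1; first exact: eqm_refl.
    by move=> j _; rewrite big1 // => i _; rewrite comm1g.
  - move=> u v /KE[g [Zg ug]] /KE[h [Zh vh]]; apply/KE.
    exists (fun j i => g j i * h j i); split.
      by move=> j i jd ij; have [_ ZM _] := gZ i; apply: ZM; [exact: Zg|exact: Zh].
    apply: (eqm_trans nd) (eqmM nd ug vh) _.
    rewrite /comm2 (prodA gAF AFab _ (fun j => AF_comm1 (g j) j (y j)) (fun j => AF_comm1 (h j) j (y j))).
    apply: (eqm_prod nd (E := fun j => (\prod_(i < j) [~ g j i, y j]) * \prod_(i < j) [~ h j i, y j])
      (F := fun j => \prod_(i < j) [~ g j i * h j i, y j])) => j _.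
    rewrite (prodA gAF AFab _ (fun i => AFC (g j i) (y j)) (fun i => AFC (h j i) (y j))).
    apply: (eqm_prod nd (E := fun i => [~ g j i, y j] * [~ h j i, y j])
      (F := fun i => [~ g j i * h j i, y j])) => i _.
    by apply: eqm_sym => //; exact: eqm_commMl.
  - move=> u /KE[g [Zg ug]]; apply/KE.
    exists (fun j i => (g j i)^-1); split.
      by move=> j i jd ij; have [_ _ ZV] := gZ i; apply: ZV; exact: Zg.
    apply: (eqm_trans nd) (eqmV nd ug) _.
    rewrite /comm2 (prodAV gAF AFab _ (fun j => AF_comm1 (g j) j (y j))).
    apply: (eqm_prod nd (E := fun j => (\prod_(i < j) [~ g j i, y j])^-1)
      (F := fun j => \prod_(i < j) [~ (g j i)^-1, y j])) => j _.
    rewrite (prodAV gAF AFab _ (fun i => AFC (g j i) (y j))).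
    apply: (eqm_prod nd (E := fun i => [~ g j i, y j]^-1) (F := fun i => [~ (g j i)^-1, y j])) => i _.
    by apply: eqm_sym => //; exact: eqm_commVl.
have cK : closed K by apply: closed_mulset => //; exact: closed_Lset.
have KJ u g : AF u -> K u -> K (u ^ g).
  move=> Au Ku; have [_ KM _] := gK; rewrite conj_comm; apply: KM => //.
  exists [~ u, g], 1; rewrite mulg1; split => //; last first.
    exists (fun _ _ => 1); split; first by move=> j i _ _; case: (gZ i).
    by rewrite big1 // => j _; rewrite big1 // => i _; rewrite comm1g.
  apply: (Fgen_ind (K := [set g | DF d [~ u, g]])).
  - have [[D1 DM DV] DJ] := nDF d; split.
    + by rewrite /= commg1.
    + by move=> v w Dv Dw; rewrite /= commMr; apply: DM => //; exact: DJ.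
    + by move=> v Dv; rewrite /= commVr; apply: DV; exact: DJ.
  - apply: (closed_preimage (f := fun k => [~ u, k])) => //.
    by apply: continuousRg; [exact: cst_continuous|exact: id_continuous].
  - by move=> i id; apply: Dset_comm.
have [K1 KM KV] := gK.
have Kyy i j : (i < j)%N -> (j < d)%N -> K [~ y i, y j].
  move=> ij jd; apply/KE.
  exists (fun j' i' => if (j' == j) && (i' == i) then y i else 1); split.
    by move=> j' i' _ _; case: ifP => [/andP[_ /eqP ->] //|_]; case: (gZ i').
  rewrite /comm2 (prod_single (F := fun j' => \prod_(i' < j') [~ if (j' == j) && (i' == i :> nat) then y i else 1, y j']) jd).
    rewrite (prod_single (F := fun i' => [~ if (j == j) && (i' == i) then y i else 1, y j]) ij).
      by rewrite !eqxx; exact: eqm_refl.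
    by move=> i' /negbTE ->; rewrite andbF comm1g.
  by move=> j' /negbTE ->; rewrite big1 // => i' _; rewrite comm1g.
have Ky j g : (j < d)%N -> K [~ g, y j].
  move=> jd; move: g; apply: Fgen_ind.
  - split.
    + by rewrite /= comm1g.
    + by move=> u v Ku Kv; rewrite /= commMl; apply: (KM) => //; exact: KJ.
    + by move=> u Ku; rewrite /= commVl; apply: (KV); exact: KJ.
  - apply: (closed_preimage (f := fun k => [~ k, y j])) => //.
    by apply: continuousRg; [exact: id_continuous|exact: cst_continuous].
  - move=> i id; case: (ltngtP i j) => [ij|ji|->]; first exact: Kyy.
      by rewrite /= -invgR; apply: (KV); exact: Kyy.
    by rewrite /= commgg.
move: a; apply: cgen_min => // _ [g [h ->]]; move: h; apply: Fgen_ind.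
- split.
  + by rewrite /= commg1.
  + by move=> u v Ku Kv; rewrite /= commMr; apply: (KM) => //; exact: KJ.
  + by move=> u Ku; rewrite /= commVr; apply: (KV); exact: KJ.
- apply: (closed_preimage (f := fun k => [~ g, k])) => //.
  by apply: continuousRg; [exact: cst_continuous|exact: id_continuous].
- by move=> j jd; exact: Ky.
Qed.

Lemma F_span g : exists (z : nat -> F) a,
  [/\ forall i, (i < d)%N -> Z i (z i), AF a & g = (\prod_(i < d) z i) * a].
Proof.
suff : mulset (prodset Z d) AF g by move=> [_ [a [[z [Zz ->]] Aa ->]]]; exists z, a.
pose W := mulset (prodset Z d) AF.
have WE u : W u <-> exists z : nat -> F, (forall i, (i < d)%N -> Z i (z i)) /\
    eqm AF u (\prod_(i < d) z i).
  split=> [[_ [a [[z [Zz ->]] Aa ->]]]|[z [Zz E]]].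
    exists z; split => //; rewrite -[X in eqm _ _ X]mulg1; apply: (eqmM nAF).
      exact: eqm_refl.
    exact/eqm1.
  exists (\prod_(i < d) z i), ((\prod_(i < d) z i)^-1 * u); split; first by exists z.
    have [_ AJ] := nAF; have := AJ (\prod_(i < d) z i) _ E.
    by rewrite conjgE !mulgA mulgVK.
  by rewrite mulVKg.
move: g; apply: Fgen_ind.
- split.
  + apply/WE; exists (fun=> 1); split; first by move=> i _; case: (gZ i).
    by rewrite big1 //; exact: eqm_refl.
  + move=> u v /WE[z [Zz uz]] /WE[t [Zt vt]]; apply/WE.
    exists (fun i => z i * t i); split.
      by move=> i id; have [_ ZM _] := gZ i; apply: ZM; [exact: Zz|exact: Zt].
    exact: eqm_trans (eqmM nAF uz vt) (eqm_prodM nAF AFC d z t).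
  + move=> u /WE[z [Zz uz]]; apply/WE; exists (fun i => (z i)^-1); split.
      by move=> i id; have [_ _ ZV] := gZ i; apply: ZV; exact: Zz.
    apply: (eqm_trans nAF) (eqmV nAF uz) _.
    have := eqm_prodM nAF AFC d z (fun i => (z i)^-1).
    rewrite [X in eqm _ _ X]big1 => [E|i _]; last by rewrite mulgV.
    have := eqmM nAF (eqm_refl nAF (\prod_(i < d) z i)^-1) E.
    by rewrite mulKg mulg1 => /(eqm_sym nAF).
- by apply: closed_mulset => //; exact: closed_prodset.
- move=> i id; apply/WE; exists (fun j => if j == i then y i else 1); split.
    by move=> j _; case: eqP => [->//|_]; case: (gZ j).
  rewrite (prod_single (F := fun j => if j == i then y i else 1) id) ?eqxx; first exact: eqm_refl.
  by move=> j /negbTE ->.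
Qed.

Lemma phi_Z i z : (i < d)%N -> Z i z -> C i (phi z).
Proof.
move=> id Zz; rewrite /C /Cx /= -phi_y // -!phiM; congr phi.
exact: (Zcomm Zz (@Zy i)).
Qed.

Lemma closed_powers (h : F) n : closed [set z | exists2 e, (e < n)%N & z = h ^+ e].
Proof.
elim: n => [|n IH].
  by rewrite (_ : [set _ | _] = set0); [exact: closed0|apply/seteqP; split => z // []].
rewrite (_ : [set _ | _] = [set z | exists2 e, (e < n)%N & z = h ^+ e] `|` [set h ^+ n]).
  by apply: closedU => //; exact: hausdorff_closed1.
apply/seteqP; split => z.
  move=> [e]; rewrite ltnS leq_eqVlt => /orP[/eqP -> ->|en ->]; first by right.
  by left; exists e.
by move=> [[e en ->]|->]; [exists e => //; exact: ltnW|exists n].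
Qed.

Lemma Z_root i z : Z i z -> exists e h, [/\ (e < p)%N, Z i h & z = y i ^+ e * h ^+ p].
Proof.
have p0 := prime_gt0 pp.
have Zc := @Zcomm i.
pose S : set F := mulset [set z | exists2 e, (e < p)%N & z = y i ^+ e] ((fun h => h ^+ p) @` Z i).
have SE u : S u <-> exists e h, Z i h /\ u = y i ^+ e * h ^+ p.
  split=> [[_ [_ [[e ep ->] [h Zh <-] ->]]]|[e [h [Zh ->]]]]; first by exists e, h.
  have [_ ZM _] := gZ i.
  exists (y i ^+ (e %% p)), ((y i ^+ (e %/ p) * h) ^+ p); split.
  - by exists (e %% p)%N => //; rewrite ltn_mod.
  - by exists (y i ^+ (e %/ p) * h) => //; apply: ZM => //; exact: (subgrpX _ (gZ i)).
  rewrite expgMn; last by apply: Zc => //; exact: (subgrpX _ (gZ i)).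
  by rewrite mulgA -expgnA -expgnDr addnC -divn_eq.
suff : Z i `<=` S by move=> ZS /ZS [_ [_ [[e ep ->] [h Zh <-] ->]]]; exists e, h.
have ZX e : Z i (y i ^+ e) by exact: (subgrpX _ (gZ i)).
have ZXp h : Z i h -> Z i (h ^+ p) by exact: (subgrpX _ (gZ i)).
have [Z1 ZM ZV] := gZ i.
apply: cgen_min.
- split.
  + by apply/SE; exists 0%N, 1; rewrite expg0 mul1g expg1n.
  + move=> u v /SE[e [h [Zh ->]]] /SE[e' [h' [Zh' ->]]]; apply/SE.
    exists (e + e')%N, (h * h'); split; first exact: ZM.
    rewrite expgMn ?expgnDr; last exact: Zc.
    rewrite -!mulgA; congr (_ * _); rewrite !mulgA; congr (_ * _).
    by apply: Zc; [exact: ZXp|exact: ZX].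
  + move=> u /SE[e [h [Zh ->]]]; apply/SE.
    (* The exponent must stay a natural number: [- e] is written as [e * (p - 1) - e * p], whose
       second part is a [p]-th power. *)
    exists (e * p.-1)%N, (y i ^- e * h^-1); split.
      by apply: ZM; exact: ZV.
    rewrite expgMn; last by apply: Zc; exact: ZV.
    rewrite mulgA expVgn -expgnA.
    have -> : y i ^+ (e * p.-1) * y i ^- (e * p) = y i ^- e.
      rewrite -[in X in _ * X](prednK p0) mulnS addnC expgnDr invgM mulgA.
      rewrite (_ : y i ^+ (e * p.-1) * y i ^- e = y i ^- e * y i ^+ (e * p.-1)) ?mulgK //.
      by apply: Zc => //; exact: ZV.
    by rewrite invgM expVgn; apply: Zc; apply: ZV => //; exact: ZXp.
- apply: closed_mulset => //; first exact: closed_powers.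
  apply: closed_image => //; apply: continuousXg; exact: id_continuous.
- move=> _ ->; apply/SE; exists 1%N, 1; split => //.
  by rewrite expg1 expg1n mulg1.
Qed.

(** Write a kernel element as [y i ^+ e * h ^+ p]. A nonzero [e < p] would contradict [xX_prim], so
    [e = 0] and [h] is in the kernel by [ax_tors]. Kernel elements are thus infinitely [p]-divisible
    and vanish in all finite quotients, which are [p]-groups. *)
Lemma phi_Z_inj i z : (i < d)%N -> Z i z -> phi z = 1 -> z = 1.
Proof.
move=> id; have [C1 CM CV] := gC x i.
have step u : Z i u -> phi u = 1 -> exists2 h, Z i h /\ phi h = 1 & u = h ^+ p.
  move=> Zu; have [e [h [ep Zh ->]]] := Z_root Zu.
  rewrite phiM !(morphXg phiM) phi_y //.
  case: e ep => [|e] ep.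
    rewrite expg0 mul1g => E; exists h; last by rewrite expg0 mul1g.
    by split => //; apply: (ax_tors ax id) E; exact: phi_Z.
  move=> E; have cop : coprime e.+1 p.
    rewrite coprime_sym prime_coprime //; apply/negP => /dvdn_leq.
    by move=> /(_ isT); rewrite leqNgt ep.
  have Cn : C i (phi h)^-1 by apply: CV; exact: phi_Z.
  case: (xX_prim pp ax id cop Cn).
  by rewrite expVgn; apply: (mulIg (phi h ^+ p)); rewrite E mulVg.
move=> Zz z1; apply: fquot_eq1 => // gT f qf; have [fM _ _] := qf.
have H k : exists2 h, Z i h /\ phi h = 1 & z = h ^+ (p ^ k).
  elim: k => [|k [h [Zh h1] ->]]; first by exists z; rewrite ?expn0 ?expg1.
  have [h' Hh' ->] := step h Zh h1; exists h' => //.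
  by rewrite -expgnA expnS.
have [h _ ->] := H (logn p #|gT|).
have /card_pgroup E := Fp qf; rewrite (morphXg fM) -cardsT -E.
by apply: expg_cardG; rewrite finset.inE.
Qed.

Lemma phi_AF c : AF c -> A (phi c).
Proof.
move: c; apply: cgen_min.
- by apply: (subgrp_preimage phiM); exact: gA.
- by apply: closed_preimage => //; exact: closed_cen.
- by move=> _ [g [h ->]] /=; rewrite (morphRg phiM); exact: (ax_comm ax).
Qed.

Lemma A_lift a : A a -> exists2 c, AF c & phi c = a.
Proof.
have gI : subgrp (phi @` AF) by exact: subgrp_image.
have com g h : (phi @` AF) [~ g, h].
  by have [u <-] := phi_surj g; have [v <-] := phi_surj h; exists [~ u, v] => //; exact: morphRg.
move=> Aa; have [_ [_ [[b [_ ->]] [k [_ ->]] ->]]] := ax_span ax Aa.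
have [_ IM _] := gI; suff [c Ac <-] : (phi @` AF)
  ((\prod_(i < d) [~ b i, x i]) * \prod_(j < d) \prod_(i < j) [~ k j i, x j]) by exists c.
apply: IM.
  by apply: (subgrp_prod (F := fun i => [~ b i, x i])).
apply: (subgrp_prod (F := fun j => \prod_(i < j) [~ k j i, x j])) => // j _.
by apply: (subgrp_prod (F := fun i => [~ k j i, x j])).
Qed.

Lemma C_lift i g : (i < d)%N -> C i g -> exists2 z, Z i z & phi z = g.
Proof.
move=> id /(C_sub_cgen pp d2 pG ax id); suff : cgen [set x i] `<=` phi @` Z i.
  by move=> H /H [z Zz <-]; exists z.
apply: cgen_min; first exact: subgrp_image.
  exact: closed_image.
by move=> _ ->; exists (y i) => //; exact: phi_y.
Qed.

Lemma phi_Dset r c : (r <= d)%N -> DF r c -> D r (phi c).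
Proof.
move=> rd [a [Aa ->]]; exists (fun i => phi (a i)); split.
  by move=> i ir; apply: phi_AF; exact: Aa.
rewrite (morph_prodg phiM r (fun i => [~ a i, y i])); apply: eq_bigr => i _.
by rewrite (morphRg phiM) phi_y // (leq_trans (ltn_ord i)).
Qed.

Lemma phi_comm2 (g : nat -> nat -> F) r : (r <= d)%N ->
  phi (comm2 g r) = \prod_(j < r) \prod_(i < j) [~ phi (g j i), x j].
Proof.
move=> rd; rewrite (morph_prodg phiM r (fun j => \prod_(i < j) [~ g j i, y j])).
apply: eq_bigr => j _; rewrite (morph_prodg phiM j (fun i => [~ g j i, y j])).
by apply: eq_bigr => i _; rewrite (morphRg phiM) phi_y // (leq_trans (ltn_ord j)).
Qed.

(** The image of the product of the [z i] falls into [A], so [ax_indep] kills each [phi (z i)] and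
    [phi_Z_inj] each [z i]. *)
Lemma ker_AF n : phi n = 1 -> AF n.
Proof.
have [z [a [Zz Aa ->]]] := F_span n; rewrite phiM (morph_prodg phiM d z) => E.
have Cz i : (i < d)%N -> C i (phi (z i)) by move=> id; apply: phi_Z => //; exact: Zz.
have Az : A (\prod_(i < d) phi (z i)).
  have [_ _ AV] := gA x; rewrite (_ : \prod_(i < d) _ = (phi a)^-1); first by apply: AV; exact: phi_AF.
  by apply: (mulIg (phi a)); rewrite E mulVg.
rewrite big1 ?mul1g // => i _; apply: (phi_Z_inj (ltn_ord i)); first exact: Zz.
exact: (ax_indep ax Cz Az).
Qed.

(** The same comparison one level deeper: [AF_span] supplies the coefficients in the [Z i], and
    [ax_free] shows that their images are trivial. *)
Lemma ker_DF n : phi n = 1 -> DF d n.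
Proof.
move=> n1; have [e [_ [De [g [Zg ->]] nE]]] := AF_span (ker_AF n1).
have E : D d (\prod_(j < d) \prod_(i < j) [~ phi (g j i), x j]).
  have [[_ _ DV] _] := normal_Dset (gA x) (ax_comm ax) (ax_abel ax) x d.
  rewrite -phi_comm2 // /comm2 (_ : phi _ = (phi e)^-1); first by apply: DV; exact: phi_Dset.
  by apply/esym/mulg1_eq; rewrite -phiM -nE.
have g1 := ax_free ax (fun j i jd ij => phi_Z (ltn_trans ij jd) (Zg j i jd ij)) E.
rewrite nE big1 ?mulg1 // => j _; rewrite big1 // => i _.
rewrite (phi_Z_inj _ (Zg j i (ltn_ord j) (ltn_ord i)) (g1 _ _ (ltn_ord j) (ltn_ord i))) ?comm1g //.
exact: ltn_trans (ltn_ord i) (ltn_ord j).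
Qed.

(** For [i, j < r] the Jacobi identity turns [[~ [~ y i, y j], y r]] into commutators ending in
    [y j] and [y i], which lie in [DF r]; density extends this from [y i] to [Z i]. *)
Lemma Lset_comm_DF r l : (r < d)%N -> Lset Z y r l -> DF r [~ l, y r].
Proof.
move=> rd [g [Zg ->]]; have [[D1 DM DV] DJ] := nDF r.
have gS : subgrp [set c | AF c /\ DF r [~ c, y r]].
  have [A1 AM AV] := gAF; split.
  - by split => //; rewrite comm1g.
  - move=> u v [Au Du] [Av Dv]; split; first exact: AM.
    by rewrite (met_commM AFC AFab _ Au Av); exact: DM.
  - move=> u [Au Du]; split; first exact: AV.
    by rewrite (met_commV gAF AFC AFab _ Au); exact: DV.
suff [] : [set c | AF c /\ DF r [~ c, y r]] (\prod_(j < r) \prod_(i < j) [~ g j i, y j]) by [].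
apply: (subgrp_prod (F := fun j => \prod_(i < j) [~ g j i, y j])) => // j jr.
apply: (subgrp_prod (F := fun i => [~ g j i, y j])) => // i ij; split => //.
have := Zg j i jr ij; move: (g j i) => z; move: z; apply: cgen_min.
- split => /=; first by rewrite !comm1g.
    move=> u v Du Dv; rewrite commMl (met_commM AFC AFab) //; last by apply: (met_conj gAF AFC).
    by apply: DM => //; rewrite -(met_comm_conj gAF AFC AFab) //; exact: DJ.
  move=> u Du; rewrite commVl (met_commV gAF AFC AFab) //; last by apply: (met_conj gAF AFC).
  by apply: DV; rewrite -(met_comm_conj gAF AFC AFab) //; exact: DJ.
- apply: (closed_preimage (f := fun z => [~ [~ z, y j], y r])) => //.
  apply: continuousRg; last exact: cst_continuous.
  by apply: continuousRg; [exact: id_continuous|exact: cst_continuous].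
- move=> _ -> /=; rewrite (met_jacobi gAF AFC AFab); apply: DM.
    by apply: Dset_comm.
  by apply: DV; apply: Dset_comm => //; exact: ltn_trans ij jr.
Qed.

Lemma ker_descent r : (r < d)%N -> (forall n, phi n = 1 -> DF r.+1 n) ->
  forall n, phi n = 1 -> DF r n.
Proof.
move=> rd Nr1; have [[D1 DM DV] DJ] := nDF r.
have [A1 AM AV] := gAF.
(* Modulo [DF r] a kernel element is [[~ a, y r]]. By [ax_reg], [phi a] is a product of elements of
   [D r] and of the corresponding [Lset]; they lift to [u] and [v], whose commutators with [y r] lie
   in [DF r], so [a] may be replaced by the kernel element [m = a * (u * v)^-1]. *)
have step n : phi n = 1 -> exists m e, [/\ phi m = 1, DF r e & n = [~ m, y r] * e].
  move=> n1; have [a [e [Aa De nE]]] := Dset_recrP (Nr1 n n1).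
  have Ae : AF e by exact: (sub_Dset gAF AFC De).
  have Da : D r [~ phi a, x r].
    have [[_ _ GV] _] := normal_Dset (gA x) (ax_comm ax) (ax_abel ax) x r.
    rewrite -phi_y // -(morphRg phiM) (_ : phi _ = (phi e)^-1).
      by apply: GV; apply: phi_Dset => //; exact: ltnW.
    by apply/esym/mulg1_eq; rewrite -phiM -nE.
  have [_ [_ [[b [Ab ->]] [g [Cg ->]] aE]]] := ax_reg ax rd (phi_AF Aa) Da.
  have /choice[b' Hb'] : forall i, exists b', (i < r)%N -> AF b' /\ phi b' = b i.
    move=> i; case: (ltnP i r) => [/Ab /A_lift[c Ac <-]|_]; last by exists 1.
    by exists c.
  have /choice[g' Hg'] : forall j, exists g' : nat -> F, forall i, (j < r)%N -> (i < j)%N ->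
      Z i (g' i) /\ phi (g' i) = g j i.
    move=> j; suff /choice[h Hh] : forall i, exists c, (j < r)%N -> (i < j)%N ->
        Z i c /\ phi c = g j i by exists h.
    move=> i; case: (ltnP j r) => jr; last by exists 1.
    case: (ltnP i j) => ij; last by exists 1.
    have id : (i < d)%N by exact: ltn_trans (ltn_trans ij jr) rd.
    by have [z Zz <-] := C_lift id (Cg j i jr ij); exists z.
  pose u := \prod_(i < r) [~ b' i, y i]; pose v := comm2 g' r.
  have Du : DF r u by exists b'; split => // i /Hb'[].
  have Lv : Lset Z y r v.
    by exists g'; split => // j i jr ij; have [] := Hg' j i jr ij.
  have Au : AF u by exact: (sub_Dset gAF AFC Du).
  have Av : AF v by exact: AF_comm2.
  have phiu : phi u = \prod_(i < r) [~ b i, x i].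
    rewrite /u (morph_prodg phiM r (fun i => [~ b' i, y i])); apply: eq_bigr => i _.
    have [_ <-] := Hb' i (ltn_ord i).
    by rewrite (morphRg phiM) phi_y // (ltn_trans (ltn_ord i)).
  have phiv : phi v = \prod_(j < r) \prod_(i < j) [~ g j i, x j].
    rewrite phi_comm2 ?(ltnW rd) //; apply: eq_bigr => j _; apply: eq_bigr => i _.
    by have [_ ->] := Hg' j i (ltn_ord j) (ltn_ord i).
  exists (a * (u * v)^-1), ([~ u, y r] * [~ v, y r] * e); split.
  - by rewrite phiM (morphVg phiM) phiM phiu phiv -aE mulgV.
  - apply: (DM) => //; apply: (DM); last exact: Lset_comm_DF.
    by rewrite /commg; apply: (DM); [exact: DV|exact: DJ].
  have Auv := AM _ _ Au Av.
  rewrite -(met_commM AFC AFab _ Au Av) mulgA -(met_commM AFC AFab _ _ Auv) ?mulgVK; last first.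
    by apply: AM => //; exact: AV.
  by rewrite nE; apply: AFab.
move=> n n1; apply: fquot_separates => // gT f qf; have [fM fS _] := qf.
(* Each use of [step] adds one commutator, so modulo [DF r] the element sinks along the lower
   central series of the finite quotient. *)
have H k : forall n, phi n = 1 -> exists c e, [/\ AF c, DF r e, n = c * e & f c \in 'L_k.+1([set: gT]%SET)].
  elim: k => [|k IH] u u1.
    by exists u, 1; rewrite mulg1 lcn1 finset.inE; split => //; exact: ker_AF.
  have [m [e [m1 De uE]]] := step u u1.
  have [c [e' [Ac De' mE fc]]] := IH m m1.
  have Ae' : AF e' by exact: (sub_Dset gAF AFC De').
  exists [~ c, y r], ([~ e', y r] * e); split => //.
  - by apply: (DM) => //; rewrite /commg; apply: (DM); [exact: DV|exact: DJ].
  - by rewrite uE mE (met_commM AFC AFab _ Ac Ae') -[LHS]mulgA.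
  - by rewrite lcnSn (morphRg fM) mem_commg ?finset.inE.
have nilT : nilpotent [set: gT]%SET by exact: pgroup_nil (Fp qf).
have [c [e [Ac De nE fc]]] := H (nil_class [set: gT]%SET) n n1.
exists e => //; rewrite nE fM.
suff -> : f c = 1 by rewrite mul1g.
move: fc; rewrite (_ : 'L_(nil_class [set: gT]%SET).+1([set: gT]%SET) = 1%SET :> {set gT}).
  by move/set1gP.
exact/(lcn_nil_classP (nil_class _) nilT).
Qed.

Lemma phi_ker n : phi n = 1 -> n = 1.
Proof.
have H k : (k <= d)%N -> forall n, phi n = 1 -> DF (d - k) n.
  elim: k => [|k IH] kd u u1; first by rewrite subn0; exact: ker_DF.
  apply: ker_descent u1; first by rewrite ltn_subrL (leq_trans _ kd).
  move=> v v1; have -> : (d - k.+1).+1 = (d - k)%N by rewrite -subSn // subSS.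
  exact: (IH (ltnW kd)).
by move=> /(H d (leqnn d)); rewrite subnn => -[a [_ ->]]; rewrite big_ord0.
Qed.

Theorem phi_bij : exists psi : G -> F, [/\ {morph psi : u v / u * v}, continuous psi,
  cancel phi psi & cancel psi phi].
Proof.
have /choice[psi psiK] := phi_surj.
have phiI u v : phi u = phi v -> u = v.
  move=> E; apply/divg1_eq/phi_ker.
  by rewrite phiM (morphVg phiM) E mulgV.
have phiK : cancel phi psi by move=> u; apply: phiI; rewrite psiK.
exists psi; split => //.
  by move=> u v; apply: phiI; rewrite phiM !psiK.
apply/continuous_closedP => K cK.
rewrite (_ : psi @^-1` K = phi @` K); first exact: closed_image.
apply/seteqP; split => [u Ku|_ [u Ku <-]] /=; last by rewrite phiK.
by exists (psi u).
Qed.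

End Unique.

(** * Interface with the records of topological groups *)

Definition gs (G : TopGroup) : Type := G.

HB.instance Definition _ (G : TopGroup) := Topological.copy (gs G) G.
HB.instance Definition _ (G : TopGroup) := isGroup.Build (gs G)
  (@tg_mulA G) (@tg_mul1g G) (@tg_mulg1 G) (@tg_mulVg G) (@tg_mulgV G).
HB.instance Definition _ (G : TopGroup) := isTopologicalGroup.Build (gs G)
  (@tg_mul_cont G) (@tg_inv_cont G).

Definition topg (G : tgroupType) : TopGroup :=
  Build_TopGroup (@mulgA G) (@mul1g G) (@mulg1 G) (@mulVg G) (@mulgV G)
    (@mulg_continuous G) (@invg_continuous G).

Definition discg (gT : finGroupType) : Type := gT.

HB.instance Definition _ (gT : finGroupType) := Topological.copy (discg gT) (discrete_topology gT).
HB.instance Definition _ (gT : finGroupType) := monoid.Group.copy (discg gT) gT.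

Lemma discg_open (gT : finGroupType) (A : set (discg gT)) : open A.
Proof. exact: (@discrete_open (discrete_topology gT)). Qed.

Lemma discg_mul_continuous (gT : finGroupType) :
  continuous (fun xy : discg gT * discg gT => (xy.1 * xy.2)%g).
Proof.
move=> [x y] A /= nA; exists ([set x], [set y]); last first.
  by move=> [u v] [/= -> ->]; exact: nbhs_singleton nA.
by split; apply: open_nbhs_nbhs; split => //; exact: discg_open.
Qed.

Lemma discg_inv_continuous (gT : finGroupType) : continuous (fun x : discg gT => x^-1%g).
Proof.
move=> x A nA; apply: (@filterS _ (nbhs x) _ [set x]); first by move=> _ ->; exact: nbhs_singleton nA.
by apply: open_nbhs_nbhs; split => //; exact: discg_open.
Qed.

HB.instance Definition _ (gT : finGroupType) := isTopologicalGroup.Build (discg gT)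
  (@discg_mul_continuous gT) (@discg_inv_continuous gT).

Lemma discg_profin (gT : finGroupType) : profin (discg gT).
Proof.
split.
- by apply: (@finite_compact (discrete_topology gT)); exact: finite_finset.
- exact: (@discrete_hausdorff (discrete_topology gT)).
- exact: (@discrete_zero_dimension (discrete_topology gT)).
Qed.

Definition fquots_pgroup (p : nat) (G : tgroupType) : Prop :=
  forall (gT : finGroupType) (f : G -> gT), fquot f -> p.-group [set: gT]%SET.

Lemma discg_pgroup (p : nat) (gT : finGroupType) : p.-group [set: gT]%SET -> fquots_pgroup p (discg gT).
Proof.
rewrite /pgroup cardsT => pT rT f [fM fS _].
rewrite -pnat_exponent; apply: pnat_dvd pT.
apply/exponentP => y _; have [x <-] := fS y.
rewrite -(morphXg fM) (_ : (x : gT) ^+ #|gT| = 1) ?(morph1g fM) //.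
by rewrite -cardsT; apply: expg_cardG; rewrite finset.inE.
Qed.

Lemma profinite_profin (G : TopGroup) : profinite G -> profin (gs G).
Proof.
by move=> [cG hG tG]; split => //; exact: totally_disconnected_zero_dimensional.
Qed.

Lemma profin_profinite (G : tgroupType) : profin G -> profinite (topg G).
Proof. by move=> [cG hG zG]; split => //; exact: zero_dimension_totally_disconnected. Qed.

Lemma pro_p_fquots p (G : TopGroup) : prime p -> pro_p p G -> fquots_pgroup p (gs G).
Proof.
move=> pp [_ Gp] gT f [fM fS fo].
have nK : is_normal_subgroup ([set x | f x = 1] : set G).
  split; first split => /=.
  - exact: (morph1g fM).
  - by move=> x y fx fy; rewrite (fM x y) fx fy mulg1.
  - by move=> x fx; rewrite (morphVg fM x) fx invg1.
  - move=> g x /= fx; rewrite (fM (g : gs G)^-1 ((x : gs G) * g)) (fM (x : gs G) g).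
    by rewrite fx mul1g (morphVg fM) mulVg.
have [k [s [sk [sS sI]]]] := Gp _ fo nK.
pose h (i : 'I_(p ^ k)) : gT := f (nth (1 : gs G) s i).
have fE (x y : gs G) : f x = f y <-> f (tg_mul (x : G) (tg_inv (y : G))) = 1.
  rewrite (fM x y^-1) (morphVg fM y); split => [->|]; first by rewrite mulgV.
  by move=> /divg1_eq.
have hI : injective h.
  by move=> i j /fE E; apply: val_inj; exact: (sI _ _ (ltn_ord i) (ltn_ord j) E).
have hS y : exists i, h i = y.
  have [x <-] := fS y; have [i [ik Ni]] := sS x.
  by exists (Ordinal ik); apply/esym/fE.
rewrite /pgroup cardsT; suff -> : #|gT| = (p ^ k)%N by rewrite pnatX pnat_id.
rewrite -[RHS]card_ord -(card_codom hI); apply: eq_card => y; rewrite !finset.inE.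
by apply/esym/codomP; have [i <-] := hS y; exists i.
Qed.

Lemma fquots_pro_p p (G : tgroupType) : prime p -> profin G -> fquots_pgroup p G ->
  pro_p p (topg G).
Proof.
move=> pp pG Gp; split; first exact: profin_profinite.
move=> N oN [[N1 NM NV] NJ].
have nN : normal_subgrp (N : set G) by [].
have [cG _ _] := pG.
have [n [s [r tN]]] := compact_transversal cG oN nN.
have [gT [f [qf _ nE]]] := transversal_fquot oN nN tN.
have := Gp _ _ qf; rewrite /pgroup cardsT nE => /p_natP [k kE].
exists k; rewrite -kE; exists (codom s); split; first by rewrite size_codom card_ord.
have sE i (iN : (i < n)%N) : nth 1 (codom s) i = s (Ordinal iN).
  by have := nth_codom 1 s (enum_rank (Ordinal iN)); rewrite enum_rankK enum_rank_ord.
have [rU sU] := tN; split.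
  move=> g; exists (r g); split; first exact: ltn_ord.
  have := rU g; rewrite (_ : s (r g) = nth 1 (codom s) (r g)) //.
  by rewrite (sE _ (ltn_ord (r g))); congr s; apply: val_inj.
move=> i j iN jN H.
have := sU (Ordinal iN) (Ordinal jN).
by rewrite -(sE i iN) -(sE j jN) => /(_ H) /(congr1 val).
Qed.

(** * The free metabelian pro-p group *)

Section FreeMetabelian.
Variables (p d : nat) (Phi F : TopGroup) (iota : 'I_d -> Phi) (pi : Phi -> F).
Hypothesis pp : prime p.
Hypothesis d2 : (2 <= d)%N.
Hypothesis freePhi : free_pro_p p iota.
Hypothesis proF : profinite F.
Hypothesis quoF : quotient_map_by_derived2 pi.

Let P := gs Phi.
Let Q := gs F.
Let f0 : P -> Q := pi.

Let piM : {morph f0 : u v / u * v}.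
Proof. by have [[hM _] _ _] := quoF; exact: hM. Qed.
Let pi_cont : continuous f0.
Proof. by have [[_ cM] _ _] := quoF; exact: cM. Qed.
Let pi_surj y : exists x, f0 x = y.
Proof. by have [_ hS _] := quoF; exact: hS. Qed.
Let pi_ker x : f0 x = 1 <-> @derived2 Phi x.
Proof. by have [_ _ hK] := quoF; exact: hK. Qed.

Let pP : profin P.
Proof. by have [[pPhi _] _] := freePhi; exact: profinite_profin. Qed.
Let pQ : profin Q. Proof. exact: profinite_profin. Qed.

(** In a finite quotient, let [K] contain the images of the generators. The universal map to [K],
    followed by the inclusion, agrees with [f] on generators, so uniqueness forces [f] to take
    values in [K]. *)
Lemma free_gen : cgen (range (iota : 'I_d -> P)) = [set: P].
Proof.
apply: fquot_cgen => // gT f qf K Ki; have [fM fS fo] := qf.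
have Kg i : f (iota i) \in K by apply: Ki; exists i.
have gTp : p.-group [set: gT]%SET.
  by have [pPhi _] := freePhi; exact: (pro_p_fquots pp pPhi qf).
have Kp : p.-group [set: subg_of K]%SET.
  by rewrite /pgroup cardsT card_sub; exact: pgroupS (finset.subsetT K) gTp.
have [_ univ] := freePhi.
have proK : pro_p p (topg (discg (subg_of K))).
  by apply: fquots_pro_p => //; [exact: discg_profin|exact: discg_pgroup].
have pro_gT : pro_p p (topg (discg gT)).
  by apply: fquots_pro_p => //; [exact: discg_profin|exact: discg_pgroup].
have [h [[hM hC] hi _]] := univ _ (fun i => subg K (f (iota i)) : topg (discg (subg_of K))) proK.
have [k [_ _ kU]] := univ _ (fun i => f (iota i) : topg (discg gT)) pro_gT.
have fC : continuous (f : P -> topg (discg gT)).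
  by apply/continuousP => B _; exact: (fquot_open B qf).
have vC : continuous (fun x => sgval (h x) : topg (discg gT)).
  apply/continuousP => B _; apply: (open_comp (f := h) (D := [set u | B (sgval u)])) => [x _|].
    exact: hC.
  exact: (@discg_open (subg_of K)).
apply/eqP; rewrite finset.eqEsubset finset.subsetT /=; apply/fintype.subsetP => y _.
have [x <-] := fS y.
rewrite (kU (f : Phi -> topg (discg gT)) (conj fM fC)) //.
rewrite -(kU (fun x => sgval (h x) : topg (discg gT))); first exact: subgP.
  by split => // u v; rewrite hM.
by move=> i; rewrite hi subgK.
Qed.

Let y (i : nat) : Q := if insub i is Some j then f0 (iota j) else 1.

Let yE i (id : (i < d)%N) : y i = f0 (iota (Ordinal id)).
Proof. by rewrite /y insubT. Qed.

Lemma free_metabelian_gen : cgen [set y i | i in [set i | (i < d)%N]] = [set: Q].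
Proof.
apply/seteqP; split => // v _; have [u <-] := pi_surj v.
have : [set: P] u by [].
rewrite -free_gen; apply: (cgen_min (K := [set u | cgen [set y i | i in [set i | (i < d)%N]] (f0 u)])).
- exact: (subgrp_preimage piM (subgrp_cgen _)).
- by apply: closed_preimage => //; exact: closed_cgen.
- move=> _ [i _ <-]; apply: (@sub_cgen Q); exists (i : nat); first exact: ltn_ord.
  by rewrite (yE (ltn_ord i)); congr (f0 (iota _)); apply: val_inj.
Qed.

Lemma free_metabelian_fquots : fquots_pgroup p Q.
Proof.
move=> gT f [fM fS fo]; have [pPhi _] := freePhi.
apply: (pro_p_fquots pp pPhi (f := f \o f0)); split.
- by move=> u v /=; rewrite piM fM.
- by move=> v; have [w <-] := fS v; have [u <-] := pi_surj w; exists u.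
- by apply: (open_comp (f := f0) (D := [set x | f x = 1])) => // x _; exact: pi_cont.
Qed.

Lemma commg_gs (u v : Phi) : Defs.commg u v = [~ (u : P), (v : P)].
Proof. by []. Qed.

Lemma derived1_comm (u v : P) : @derived1 Phi [~ u, v].
Proof. by move=> K _ _; apply; exists u, v. Qed.

Lemma derived2_comm (u v : P) : @derived1 Phi u -> @derived1 Phi v -> @derived2 Phi [~ u, v].
Proof. by move=> Du Dv K _ _; apply; exists u, v. Qed.

Lemma free_metabelian_comm (a b : Q) : cgen [set z : Q | exists g h, z = [~ g, h]] a ->
  cgen [set z : Q | exists g h, z = [~ g, h]] b -> a * b = b * a.
Proof.
have [_ hQ _] := pQ; apply: cgen_commute => // _ _ [g [h ->]] [g' [h' ->]].
have [u <-] := pi_surj g; have [v <-] := pi_surj h.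
have [u' <-] := pi_surj g'; have [v' <-] := pi_surj h'.
rewrite -!(morphRg piM); apply/commgP/eqP; rewrite -(morphRg piM); apply/pi_ker.
by apply: derived2_comm; exact: derived1_comm.
Qed.

(** [G] is pro-p by [quot_pgroup], so [Phi] maps to it. The map kills [Phi''] because [Acen x] is
    closed, abelian and contains all commutators, and it descends to [F], where [phi_bij]
    applies. *)
Theorem pres_axioms_iso (G : tgroupType) (x : nat -> G) : profin G -> pres_axioms p d x ->
  exists (phi : Q -> G) (psi : G -> Q), [/\ {morph phi : u v / u * v}, continuous phi,
    {morph psi : u v / u * v}, continuous psi & cancel phi psi /\ cancel psi phi].
Proof.
move=> pG ax; have [_ univ] := freePhi; have [_ hG _] := pG.
have proG : pro_p p (topg G).
  by apply: fquots_pro_p => // gT f qf; exact: (quot_pgroup pp d2 ax qf).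
have [h [[hM hC] hi _]] := univ _ (fun i : 'I_d => x i : topg G) proG.
have {}hM : {morph (h : P -> G) : u v / u * v} by exact: hM.
have {}hC : continuous (h : P -> G) by exact: hC.
have h1 u : @derived1 Phi u -> Acen x (h u).
  move=> /(_ [set u : P | Acen x (h u)]); apply.
  - exact: (subgrp_preimage hM (subgrp_cen [~ x 0%N, x 1%N])).
  - by apply: (closed_preimage hC); exact: closed_cen.
  - by move=> _ [u1 [u2 [_ _ ->]]] /=; rewrite commg_gs (morphRg hM); exact: (ax_comm ax).
have h2 u : @derived2 Phi u -> h u = 1 :> G.
  move=> /(_ [set u : P | h u = 1 :> G]); apply.
  - by apply: (subgrp_preimage hM (K := [set 1])); split => //= [_ _ -> ->|_ ->]; rewrite ?mulg1 ?invg1.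
  - by apply: (closed_preimage hC (A := [set 1])); exact: hausdorff_closed1.
  - move=> _ [u1 [u2 [D1 D2 ->]]] /=; rewrite commg_gs (morphRg hM).
    by apply/eqP/commgP; apply: (ax_abel ax); exact: h1.
have hK (u v : P) : f0 u = f0 v -> h u = h v :> G.
  move=> E; apply/divg1_eq; rewrite -(morphVg hM) -hM; apply/h2/pi_ker.
  by rewrite piM (morphVg piM) E mulgV.
have /choice[s sK] := pi_surj.
pose phi (v : Q) : G := h (s v).
have phiE u : phi (f0 u) = h u by apply: hK; rewrite sK.
have phiM : {morph phi : u v / u * v}.
  by move=> u v; rewrite -[u]sK -[v]sK -piM !phiE hM.
have phiC : continuous phi.
  apply/continuous_closedP => K cK.
  rewrite (_ : phi @^-1` K = f0 @` [set u | K (h u)]).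
    apply: closed_image; first by case: pP.
    - by case: pQ.
    - exact: pi_cont.
    - exact: (closed_preimage hC).
  apply/seteqP; split => [v Kv|_ [u Ku <-]] /=; last by rewrite phiE.
  by exists (s v); rewrite ?sK.
have phi_y i : (i < d)%N -> phi (y i) = x i.
  by move=> id; rewrite (yE id) phiE hi.
have [psi [psiM psiC K1 K2]] :=
  phi_bij pp d2 pQ pG ax free_metabelian_fquots free_metabelian_gen free_metabelian_comm phiM phiC phi_y.
by exists phi, psi.
Qed.

End FreeMetabelian.

(** * First-order definability *)

(* [e' i = e (rho i)] for [i < N] both lets bound variables be renamed away
   from the free ones and records that [P] depends on finitely many entries
   of its environment, so that quantification over infinite families is
   first-order. *)
Definition definable (P : forall G : TopGroup, (nat -> gs G) -> Prop) : Prop :=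
  exists N, forall rho : nat -> nat, exists f : gform,
    forall (G : TopGroup) (e e' : nat -> gs G),
      (forall i, (i < N)%N -> e' i = e (rho i)) -> holds e f <-> P G e'.

Definition definable_term (t : forall G : TopGroup, (nat -> gs G) -> gs G) : Prop :=
  exists N, forall rho : nat -> nat, exists s : gterm,
    forall (G : TopGroup) (e e' : nat -> gs G),
      (forall i, (i < N)%N -> e' i = e (rho i)) -> teval e s = t G e'.

Lemma dt_var k : definable_term (fun G e => e k).
Proof. by exists k.+1 => rho; exists (TVar (rho k)) => G e e' E; rewrite E. Qed.

Lemma dt_one : definable_term (fun G e => 1).
Proof. by exists 0%N => rho; exists TOne. Qed.

Lemma dt_mul s t : definable_term s -> definable_term t ->
  definable_term (fun G e => s G e * t G e).
Proof.
move=> [N sN] [M tM]; exists (maxn N M) => rho.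
have [u uE] := sN rho; have [v vE] := tM rho.
exists (TMul u v) => G e e' E /=; rewrite (uE G e e') ?(vE G e e') // => i iN; apply: E.
  by rewrite leq_max iN orbT.
by rewrite leq_max iN.
Qed.

Lemma dt_inv s : definable_term s -> definable_term (fun G e => (s G e)^-1).
Proof.
move=> [N sN]; exists N => rho; have [u uE] := sN rho.
by exists (TInv u) => G e e' E /=; rewrite (uE G e e').
Qed.

Lemma dt_comm s t : definable_term s -> definable_term t ->
  definable_term (fun G e => [~ s G e, t G e]).
Proof.
move=> ds dt; apply: dt_mul; first exact: dt_inv.
by apply: dt_mul; [exact: dt_inv|exact: dt_mul].
Qed.

Lemma dt_exp s n : definable_term s -> definable_term (fun G e => s G e ^+ n).
Proof.
move=> ds; elim: n => [|n IH]; first exact: dt_one.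
rewrite (_ : (fun G e => _) = fun G e => s G e * s G e ^+ n); first exact: dt_mul.
by apply/functional_extensionality_dep => G; apply/funext => e; rewrite expgS.
Qed.

Lemma dt_prod n (F : 'I_n -> forall G : TopGroup, (nat -> gs G) -> gs G) :
  (forall i, definable_term (F i)) -> definable_term (fun G e => \prod_(i < n) F i G e).
Proof.
elim: n F => [|n IH] F dF.
  rewrite (_ : (fun G e => _) = fun G e => 1); first exact: dt_one.
  by apply/functional_extensionality_dep => G; apply/funext => e; rewrite big_ord0.
rewrite (_ : (fun G e => _) =
    fun G e => (\prod_(i < n) F (widen_ord (leqnSn n) i) G e) * F ord_max G e).
  by apply: dt_mul => //; apply: IH.
by apply/functional_extensionality_dep => G; apply/funext => e; rewrite big_ord_recr.
Qed.

Lemma d_ext P Q : (forall G e, P G e <-> Q G e) -> definable P -> definable Q.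
Proof.
move=> PQ [N PN]; exists N => rho; have [f fE] := PN rho.
by exists f => G e e' /fE ->.
Qed.

Lemma d_eq s t : definable_term s -> definable_term t -> definable (fun G e => s G e = t G e).
Proof.
move=> [N sN] [M tM]; exists (maxn N M) => rho.
have [u uE] := sN rho; have [v vE] := tM rho.
exists (FEq u v) => G e e' E /=; rewrite (uE G e e') ?(vE G e e') // => i iN; apply: E.
  by rewrite leq_max iN orbT.
by rewrite leq_max iN.
Qed.

Lemma d_true : definable (fun _ _ => True).
Proof. by exists 0%N => rho; exists (FEq TOne TOne) => G e e' _ /=; split. Qed.

Lemma d_not P : definable P -> definable (fun G e => ~ P G e).
Proof.
move=> [N PN]; exists N => rho; have [f fE] := PN rho.
by exists (FNot f) => G e e' /fE /= ->.
Qed.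

Lemma d_and P Q : definable P -> definable Q -> definable (fun G e => P G e /\ Q G e).
Proof.
move=> [N PN] [M QM]; exists (maxn N M) => rho.
have [f fE] := PN rho; have [g gE] := QM rho; exists (FAnd f g) => G e e' E /=.
rewrite (fE G e e') ?(gE G e e') // => i iN; apply: E; first by rewrite leq_max iN orbT.
by rewrite leq_max iN.
Qed.

Lemma d_imp P Q : definable P -> definable Q -> definable (fun G e => P G e -> Q G e).
Proof.
move=> dP dQ; apply: d_ext (d_not (d_and dP (d_not dQ))) => G e.
by split=> [H Pe|H [Pe Qe]]; [apply: contrapT => Qe; exact: H (conj Pe Qe)|exact/Qe/H].
Qed.

Lemma d_and3 P Q R : definable P -> definable Q -> definable R ->
  definable (fun G e => [/\ P G e, Q G e & R G e]).
Proof.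
move=> dP dQ dR; apply: d_ext (d_and dP (d_and dQ dR)) => G e.
by split=> [[? []]|[]].
Qed.

(** For side conditions on indices, such as [i <> j], which are decided while the formula is
    built. *)
Lemma d_assume (A : Prop) P : (A -> definable P) -> definable (fun G e => A -> P G e).
Proof.
case: (EM A) => [a /(_ a)|nA _]; first by apply: d_ext => G e; split=> // /(_ a).
by apply: d_ext d_true => G e; split.
Qed.

Lemma d_forall_lt (F : nat -> forall G : TopGroup, (nat -> gs G) -> Prop) n :
  (forall i, (i < n)%N -> definable (F i)) ->
  definable (fun G e => forall i, (i < n)%N -> F i G e).
Proof.
elim: n => [|n IH] dF; first by apply: d_ext d_true => G e; split.
apply: d_ext (d_and (IH _) (dF n (ltnSn n))) => [G e|i /ltnW]; last exact: dF.
split=> [[H Hn] i|H]; last by split=> [i /ltnW|]; exact: H.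
by rewrite ltnS leq_eqVlt => /orP[/eqP ->//|]; exact: H.
Qed.

Lemma d_forall_lt2 (F : nat -> nat -> forall G : TopGroup, (nat -> gs G) -> Prop) n :
  (forall j i, definable (F j i)) ->
  definable (fun G e => forall j i, (j < n)%N -> (i < j)%N -> F j i G e).
Proof.
move=> dF; have dFj j : definable (fun G e => forall i, (i < j)%N -> F j i G e).
  exact: d_forall_lt.
apply: d_ext (@d_forall_lt _ n (fun j _ => dFj j)) => G e.
by split=> H j i jn; exact: H.
Qed.

Lemma d_exists_lt (F : nat -> forall G : TopGroup, (nat -> gs G) -> Prop) n :
  (forall i, (i < n)%N -> definable (F i)) ->
  definable (fun G e => exists2 i, (i < n)%N & F i G e).
Proof.
move=> dF; apply: d_ext (d_not (d_forall_lt (fun i ni => d_not (dF i ni)))) => G e.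
split=> [H|[i ni Fi] H]; last exact: H Fi.
by apply: contrapT => nE; apply: H => i ni Fi; apply: nE; exists i.
Qed.

Definition block_upd (T : Type) (e c : nat -> T) M n : nat -> T :=
  fun m => if (M <= m < M + n)%N then c (m - M)%N else e m.

Lemma holds_block (G : TopGroup) (e : nat -> G) f M n :
  holds e (foldr FForall f (iota M n)) <-> forall c, holds (block_upd e c M n) f.
Proof.
elim: n M e => [|n IH] M e /=.
  suff E c : block_upd e c M 0 = e by split=> [H c|/(_ e)]; rewrite E.
  by apply/funext => m; rewrite /block_upd addn0; case: ltnP => //; case: ltnP.
have E x c : block_upd (upd e M x) c M.+1 n =
    block_upd e (fun i => if i is i'.+1 then c i' else x) M n.+1.
  apply/funext => m; rewrite /block_upd /upd addSnnS.
  case: (ltngtP m M) => [mM|mM|->].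
  - by [].
  - by rewrite /=; case: ifP => //; rewrite -(subnSK mM).
  - by rewrite subnn addnS ltnS leq_addr.
split=> [H c|H x]; last by apply/IH => c; rewrite E.
have /IH /(_ (fun i => c i.+1)) := H (c 0%N); rewrite E.
by rewrite (_ : (fun i => _) = c) //; apply/funext; case.
Qed.

(** Only the entries below [N] matter, so a block of [N] quantifiers replaces the one over families.
    In the premise a single environment interleaves both arguments: the new family at even places,
    the old environment at odd ones. *)
Lemma d_forall_fam (P : forall G : TopGroup, (nat -> gs G) -> (nat -> gs G) -> Prop) :
  definable (fun G e => P G (fun i => e i.*2.+1) (fun i => e i.*2)) ->
  definable (fun G e => forall c, P G e c).
Proof.
move=> [N PN]; exists N => rho.
have [M rhoM] : exists M, forall i, (i < N)%N -> (rho i < M)%N.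
  elim: (N) => [|n [M IH]]; first by exists 0%N.
  exists (maxn M (rho n).+1) => i; rewrite ltnS leq_eqVlt leq_max => /orP[/eqP ->|/IH -> //].
  by rewrite ltnSn orbT.
(* The bound block starts at [M], above all relevant [rho i], so that no variable is captured. *)
have [f fE] := PN (fun i => if odd i then rho i./2 else (M + i./2)%N).
exists (foldr FForall f (iota M N)) => G e e' E; rewrite holds_block.
suff H c : holds (block_upd e c M N) f <-> P G e' c by split=> H' c; apply/H/H'.
pose e2 i := if odd i then e' i./2 else c i./2.
have E1 : (fun i => e2 i.*2.+1) = e'.
  by apply/funext => i; rewrite /e2 /= odd_double /= uphalf_double.
have E2 : (fun i => e2 i.*2) = c by apply/funext => i; rewrite /e2 odd_double doubleK.
have := fE G (block_upd e c M N) e2; rewrite E1 E2; apply => i iN.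
have i2 : (i./2 < N)%N by rewrite (leq_ltn_trans _ iN) // -divn2 leq_div.
rewrite /e2 /block_upd; case: ifP => _; last by rewrite leq_addr ltn_add2l i2 addKn.
by rewrite leqNgt rhoM //= E.
Qed.

Lemma d_exists_fam (P : forall G : TopGroup, (nat -> gs G) -> (nat -> gs G) -> Prop) :
  definable (fun G e => P G (fun i => e i.*2.+1) (fun i => e i.*2)) ->
  definable (fun G e => exists c, P G e c).
Proof.
move=> dP; apply: d_ext (d_not (@d_forall_fam (fun G e c => ~ P G e c) (d_not dP))) => G e.
by split=> [/existsNP [c /contrapT]|[c Pc] /(_ c)]; first by exists c.
Qed.

Lemma d_forall (P : forall G : TopGroup, (nat -> gs G) -> gs G -> Prop) :
  definable (fun G e => P G (fun i => e i.*2.+1) (e 0%N)) ->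
  definable (fun G e => forall x, P G e x).
Proof.
move=> dP; apply: d_ext (@d_forall_fam (fun G e c => P G e (c 0%N)) dP) => G e.
by split=> H x; [exact: H (fun=> x)|exact: H].
Qed.

Lemma d_exists (P : forall G : TopGroup, (nat -> gs G) -> gs G -> Prop) :
  definable (fun G e => P G (fun i => e i.*2.+1) (e 0%N)) ->
  definable (fun G e => exists x, P G e x).
Proof.
move=> dP; apply: d_ext (@d_exists_fam (fun G e c => P G e (c 0%N)) dP) => G e.
by split=> [[c Pc]|[x Px]]; [exists (c 0%N)|exists (fun=> x)].
Qed.

Lemma d_exists2 (P Q : forall G : TopGroup, (nat -> gs G) -> gs G -> Prop) :
  definable (fun G e => P G (fun i => e i.*2.+1) (e 0%N)) ->
  definable (fun G e => Q G (fun i => e i.*2.+1) (e 0%N)) ->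
  definable (fun G e => exists2 x, P G e x & Q G e x).
Proof.
move=> dP dQ; have := @d_exists (fun G e x => P G e x /\ Q G e x) (d_and dP dQ).
by apply: d_ext => G e; split=> [[x []]|[x]]; exists x.
Qed.

Lemma d_forall_fam2 (P : forall G : TopGroup, (nat -> gs G) -> (nat -> nat -> gs G) -> Prop) :
  definable (fun G e => P G (fun i => e i.*2.+1) (fun j i => e (pickle (j, i)).*2)) ->
  definable (fun G e => forall g, P G e g).
Proof.
move=> dP.
apply: d_ext (@d_forall_fam (fun G e c => P G e (fun j i => c (pickle (j, i)))) dP) => G e.
split=> H g; last exact: H.
have := H (fun n => if unpickle n is Some ji then g ji.1 ji.2 else 1).
by congr (P _ _ _); apply/funext => j; apply/funext => i; rewrite pickleK.
Qed.

Lemma d_exists_fam2 (P : forall G : TopGroup, (nat -> gs G) -> (nat -> nat -> gs G) -> Prop) :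
  definable (fun G e => P G (fun i => e i.*2.+1) (fun j i => e (pickle (j, i)).*2)) ->
  definable (fun G e => exists g, P G e g).
Proof.
move=> dP; apply: d_ext (d_not (@d_forall_fam2 (fun G e g => ~ P G e g) (d_not dP))) => G e.
by split=> [/existsNP [g /contrapT]|[g Pg] /(_ g)]; first by exists g.
Qed.

Ltac dterm := repeat first [exact: dt_var | exact: dt_one | apply: dt_prod => ?
  | apply: dt_comm | apply: dt_exp | apply: dt_inv | apply: dt_mul].

Ltac dform := repeat first [apply: d_and3 | apply: d_and | apply: d_forall_lt => ? ? | apply: d_forall_lt2 => ? ?
  | apply: d_exists_lt => ? ? | apply: d_assume => ? | apply: d_not | apply: d_imp
  | apply: d_forall | apply: d_exists2 | apply: d_forall_fam | apply: d_forall_fam2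
  | apply: d_exists_fam | apply: d_exists_fam2 | apply: d_exists | apply: d_eq; dterm].

(** Puts the record into shapes that [dform] recognizes; in particular the exponent of the root
    axiom becomes a bounded [exists2]. *)
Lemma pres_axiomsE p d (G : groupType) (x : nat -> G) : pres_axioms p d x <->
  (forall g h, Acen x [~ g, h]) /\
  (forall a b, Acen x a -> Acen x b -> a * b = b * a) /\
  (forall g, exists c : nat -> G, exists a,
    [/\ forall i, (i < d)%N -> Cx x i (c i), Acen x a & g = (\prod_(i < d) c i) * a]) /\
  (forall c : nat -> G, (forall i, (i < d)%N -> Cx x i (c i)) ->
    Acen x (\prod_(i < d) c i) -> forall i, (i < d)%N -> c i = 1) /\
  (forall i, (i < d)%N -> forall g, Cx x i g ->
    exists2 e, (e < p)%N & exists2 h, Cx x i h & g = x i ^+ e * h ^+ p) /\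
  (forall i, (i < d)%N -> forall z a, Cx x i z -> Acen x a -> Dset (Acen x) x d [~ a, z]) /\
  (forall i, (i < d)%N -> forall h, Cx x i h -> x i <> h ^+ p) /\
  (forall i, (i < d)%N -> forall j, (j < d)%N -> i <> j -> forall h, Cx x j h ->
    Dset (Acen x) x d [~ x i, h] -> h = 1) /\
  (forall i, (i < d)%N -> forall j, (j < d)%N -> i <> j -> forall z h, Cx x i z -> Cx x j h ->
    (forall y, Cx x i y -> z <> y ^+ p) ->
    exists2 h', Cx x j h' & eqm (Dset (Acen x) x d) [~ z, h'] [~ x i, h]) /\
  (forall w z h, Cx x 0 w -> Cx x 0 z -> Cx x 1 h ->
    eqm (Dset (Acen x) x d) [~ w, x 1%N] [~ z, h] ->
    forall a, Acen x a -> exists2 b, Acen x b & [~ a, w] = [~ b, z]) /\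
  (forall y a, Cx x 0 y -> Acen x a -> [~ a, y ^+ p] = 1 -> [~ a, y] = 1) /\
  (forall a, Acen x a -> mulset (Dset (Acen x) x d) (Lset (Cx x) x d) a) /\
  (forall g : nat -> nat -> G,
    (forall j i, (j < d)%N -> (i < j)%N -> Cx x i (g j i)) ->
    Dset (Acen x) x d (\prod_(j < d) \prod_(i < j) [~ g j i, x j]) ->
    forall j i, (j < d)%N -> (i < j)%N -> g j i = 1) /\
  (forall i, (i < d)%N -> forall h, Cx x i h -> h ^+ p = 1 -> h = 1) /\
  (forall r, (r < d)%N -> forall a, Acen x a -> Dset (Acen x) x r [~ a, x r] ->
    mulset (Dset (Acen x) x r) (Lset (Cx x) x r) a).
Proof.
split=> [[H1 H2 H3 H4 H5 H6 H7 H8 H9 H10 H11 H12 H13 H14 H15]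
    |[H1 [H2 [H3 [H4 [H5 [H6 [H7 [H8 [H9 [H10 [H11 [H12 [H13 [H14 H15]]]]]]]]]]]]]]].
  do !split => //.
  by move=> i id g /(H5 i id) [e [h [? ? ?]]]; exists e => //; exists h.
by split=> // i id g /(H5 i id) [e ? [h]]; exists e, h.
Qed.

Lemma definable_pres_axioms p d :
  definable (fun G e => exists x : nat -> gs G, pres_axioms p d x).
Proof.
apply: d_exists_fam; apply: d_ext => [G e|]; first by apply: iff_sym; exact: pres_axiomsE.
dform.
Qed.

Lemma models_forall (G : TopGroup) f s : models G (foldr FForall f s) <-> models G f.
Proof.
elim: s => [|n s IH] //=; rewrite -IH; split=> [H e|H e x]; last exact: H.
have := H e (e n); rewrite (_ : upd e n (e n) = e) //.
by apply/funext => m; rewrite /upd; case: eqP => [->|].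
Qed.

Lemma form_fv_forall f s : form_fv (foldr FForall f s) = [seq m <- form_fv f | m \notin s].
Proof.
elim: s => [|n s IH] /=; first exact/esym/all_filterP/allP.
by rewrite IH -filter_predI; apply: eq_filter => m; rewrite /= in_cons negb_or.
Qed.

(** The formula obtained may have free variables although its truth ignores them; its universal
    closure is a sentence with the same models. *)
Lemma definable_sentence (P : TopGroup -> Prop) : definable (fun G _ => P G) ->
  exists2 sigma, is_sentence sigma & forall G, models G sigma <-> P G.
Proof.
move=> [N PN]; have [f fE] := PN id.
exists (foldr FForall f (form_fv f)).
  rewrite /is_sentence form_fv_forall /nilp size_filter -leqn0 leqNgt -has_count.
  by apply/hasPn => m ->.
move=> G; rewrite models_forall; split=> [H|PG e]; last exact/(fE G e e).
by apply/(fE G (fun=> 1) (fun=> 1)) => //; exact: H.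
Qed.

(** * Invariance of truth under isomorphism *)

Section Isomorphism.
Variables (G H : TopGroup) (f : G -> H) (g : H -> G).
Hypotheses (fM : is_hom f) (fK : cancel f g) (gK : cancel g f).

Lemma teval_iso (e : nat -> G) t : teval (f \o e) t = f (teval e t).
Proof.
elim: t => [n||a Ea b Eb|a Ea] //=.
- exact/esym/(morph1g (G := gs G) (H := gs H) fM).
- by rewrite Ea Eb fM.
- by rewrite Ea; exact/esym/(morphVg (G := gs G) (H := gs H) fM).
Qed.

Lemma holds_iso phi (e : nat -> G) : holds (f \o e) phi <-> holds e phi.
Proof.
have updE e' n x : upd (f \o e') n (f x) = f \o upd e' n x.
  by apply/funext => m; rewrite /upd /=; case: eqP.
elim: phi e => /= [a b|| a IH | a IHa b IHb | a IHa b IHb | a IHa b IHb | n a IH | n a IH] e //.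
- by rewrite !teval_iso; split=> [/(can_inj fK)|->].
- by rewrite IH.
- by rewrite IHa IHb.
- by rewrite IHa IHb.
- by rewrite IHa IHb.
- split=> Ha x; first by apply/IH; rewrite -updE; exact: Ha.
  by rewrite -[x]gK updE; apply/IH.
- split=> -[x Hx]; last by exists (f x); rewrite updE; apply/IH.
  by exists (g x); apply/IH; rewrite -updE gK.
Qed.

Lemma models_iso phi : models G phi <-> models H phi.
Proof.
split=> M e; last exact/holds_iso.
rewrite (_ : e = f \o (g \o e)); first exact/holds_iso.
by apply/funext => n /=; rewrite gK.
Qed.

End Isomorphism.

(** * Initial topologies and the p-adic integers *)

Import GRing.Theory.

Section InitialProfinite.
Variables (S : choiceType) (X : topologicalType) (v : S -> X).
Hypothesis vI : injective v.

Lemma initial_compact : compact (range v) -> compact [set: initial_topology v].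
Proof.
move=> cV F FF _.
have FT : (v @ F) (range v).
  by apply: (@filterS _ F _ setT); [move=> s _; exists s|exact: filterT].
have [_ [[s _ <-] cs]] := cV (v @ F) (fmap_proper_filter v FF) FT.
exists s; split => // A B FA [_ [[O oO <-] Os] OB].
have [] := cs (v @` A) O.
- by apply: (@filterS _ F _ A) => // t At; exists t.
- by apply: open_nbhs_nbhs.
by move=> _ [[t At <-] Ot]; exists t; split => //; exact: OB.
Qed.

Lemma initial_hausdorff : hausdorff_space X -> hausdorff_space (initial_topology v).
Proof.
move=> hX s t cst; apply: vI; apply: hX => A B As Bt.
have [] := cst (v @^-1` A) (v @^-1` B).
- by apply: (@initial_continuous _ _ v s).
- by apply: (@initial_continuous _ _ v t).
by move=> u [Au Bu]; exists (v u).
Qed.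

Lemma initial_zero_dimensional : zero_dimensional X -> zero_dimensional (initial_topology v).
Proof.
move=> zX s t st; have [|U [cU Us Ut]] := zX (v s) (v t).
  by apply: contra_neq st => /vI.
exists (v @^-1` U); split => //.
by apply: preimage_clopen => //; exact: initial_continuous.
Qed.

End InitialProfinite.

Lemma continuous_initial (S : choiceType) (X Y : topologicalType) (v : S -> X)
  (g : Y -> initial_topology v) :
  continuous (fun y => v (g y)) -> continuous g.
Proof.
move=> cvg y A [_ [[O oO <-] Oy] OA].
apply: (filterS OA); apply: (cvg y O).
exact: open_nbhs_nbhs.
Qed.

Lemma prod_cvg (I : eqType) (K : I -> topologicalType) (T : Type) (F : set_system T)
  (f : T -> prod_topology K) (l : prod_topology K) : Filter F ->
  (forall i, (fun t => f t i) @ F --> l i) -> f @ F --> l.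
Proof.
move=> FF fl; apply/cvg_sup => i A [_ [[O oO <-] Ol] OA].
by apply: (filterS OA); apply: (fl i O); exact: open_nbhs_nbhs.
Qed.

Lemma continuous_prod (I : eqType) (K : I -> topologicalType) (X : topologicalType)
  (f : X -> prod_topology K) :
  (forall i, continuous (fun x => f x i)) -> continuous f.
Proof. by move=> cf x; apply: prod_cvg => i; exact: cf. Qed.

Lemma continuous_proj (I : eqType) (K : I -> topologicalType) (i : I) :
  continuous (fun f : prod_topology K => f i).
Proof. exact: (@proj_continuous I K i). Qed.

Definition profin_space (X : topologicalType) : Prop :=
  [/\ compact [set: X], hausdorff_space X & zero_dimensional X].

Lemma profin_prod (I : choiceType) (K : I -> topologicalType) :
  (forall i, profin_space (K i)) -> profin_space (prod_topology K).
Proof.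
move=> pK; split.
- have := @tychonoff I K (fun=> setT).
  rewrite (_ : [set f | _] = setT); last by apply/seteqP.
  by apply => i; have [] := pK i.
- by apply: hausdorff_product => i; have [] := pK i.
- by apply: zero_dimension_prod => i; have [] := pK i.
Qed.

HB.mixin Record isTopologicalComRing R of GRing.ComNzRing R & Topological R := {
  addr_continuous : continuous (fun xy : R * R => (xy.1 + xy.2)%R);
  oppr_continuous : continuous (fun x : R => (- x)%R);
  mulr_continuous : continuous (fun xy : R * R => (xy.1 * xy.2)%R)
}.

#[short(type="tcomRingType")]
HB.structure Definition TComRing :=
  {R of isTopologicalComRing R & GRing.ComNzRing R & Topological R}.

Section RingContinuity.
Variables (X : topologicalType) (R : tcomRingType).
Implicit Types f g : X -> R.
Local Open Scope ring_scope.

Lemma continuousDr f g : continuous f -> continuous g -> continuous (fun x => f x + g x).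
Proof.
move=> cf cg x; apply: (@continuous2_cvg _ _ _ _ _ _ f g (fun a b : R => a + b)).
- exact: (addr_continuous (f x, g x)).
- exact: cf.
- exact: cg.
Qed.

Lemma continuousMr f g : continuous f -> continuous g -> continuous (fun x => f x * g x).
Proof.
move=> cf cg x; apply: (@continuous2_cvg _ _ _ _ _ _ f g (fun a b : R => a * b)).
- exact: (mulr_continuous (f x, g x)).
- exact: cf.
- exact: cg.
Qed.

Lemma continuousNr f : continuous f -> continuous (fun x => - f x).
Proof. by move=> cf x; apply: (continuous_comp (cf x)); exact: oppr_continuous. Qed.

Lemma continuous_sumr (F : nat -> X -> R) n :
  (forall i, continuous (F i)) -> continuous (fun x => \sum_(i < n) F i x).
Proof.
move=> cF; elim: n => [|n IH].
  rewrite (_ : (fun x => _) = fun=> 0); first exact: cst_continuous.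
  by apply/funext => x; rewrite big_ord0.
rewrite (_ : (fun x => _) = fun x => (\sum_(i < n) F i x) + F n x).
  exact: continuousDr.
by apply/funext => x; rewrite big_ord_recr.
Qed.

End RingContinuity.

Section PAdicIntegers.
Variable k : nat.
Let q := k.+2.

(* The prime is written q = k.+2, so that q > 1 needs no hypothesis. *)
Record padic : Type := Padic {
  pres : nat -> nat;
  presP : forall n, (pres n < q ^ n)%N /\ pres n.+1 %% q ^ n = pres n
}.

HB.instance Definition _ := gen_eqMixin padic.
HB.instance Definition _ := gen_choiceMixin padic.
HB.instance Definition _ := Topological.copy padic
  (initial_topology (pres : padic -> prod_topology (fun _ : nat => nat))).

Implicit Types x y z : padic.

Lemma padicP x y : (forall n, pres x n = pres y n) -> x = y.
Proof.
case: x => f fP; case: y => g gP /= /funext fg; move: gP; rewrite -fg => gP.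
by congr Padic; exact: Prop_irrelevance.
Qed.

Lemma pres_inj : injective pres.
Proof. by move=> x y E; apply: padicP => n; rewrite E. Qed.

Let q0 n : (0 < q ^ n)%N. Proof. by rewrite expn_gt0. Qed.

Lemma pres_lt x n : (pres x n < q ^ n)%N. Proof. by case: (presP x n). Qed.

Lemma pres_mod x n : pres x n %% q ^ n = pres x n.
Proof. by rewrite modn_small // pres_lt. Qed.

Lemma presS x n : pres x n.+1 = pres x n %[mod q ^ n].
Proof. by rewrite pres_mod; case: (presP x n). Qed.

Lemma mod_modX a n : a %% q ^ n.+1 = a %[mod q ^ n].
Proof. by rewrite modn_dvdm // dvdn_exp2l. Qed.

Lemma padic_ofP (g : nat -> nat) : (forall n, g n.+1 = g n %[mod q ^ n]) ->
  forall n, (g n %% q ^ n < q ^ n)%N /\ (g n.+1 %% q ^ n.+1) %% q ^ n = g n %% q ^ n.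
Proof. by move=> gP n; split; [rewrite ltn_mod|rewrite mod_modX]. Qed.

Definition padic_of g gP := @Padic (fun n => g n %% q ^ n) (@padic_ofP g gP).

Lemma padic_addP x y n :
  pres x n.+1 + pres y n.+1 = pres x n + pres y n %[mod q ^ n].
Proof. by rewrite -modnDm !presS modnDm. Qed.

Lemma padic_mulP x y n :
  pres x n.+1 * pres y n.+1 = pres x n * pres y n %[mod q ^ n].
Proof. by rewrite -modnMm !presS modnMm. Qed.

Lemma padic_oppP x n :
  q ^ n.+1 - pres x n.+1 = q ^ n - pres x n %[mod q ^ n].
Proof.
apply/eqP; rewrite -(eqn_modDr (pres x n.+1)) subnK ?(ltnW (pres_lt _ _)) //.
rewrite -modnDmr presS modnDmr subnK ?(ltnW (pres_lt _ _)) //.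
by rewrite modnn; apply/eqP/eqP; rewrite -/(dvdn _ _) dvdn_exp2l.
Qed.

Definition padic_add x y := padic_of (padic_addP x y).
Definition padic_mul x y := padic_of (padic_mulP x y).
Definition padic_opp x := padic_of (padic_oppP x).
Definition padic_nat a := @padic_of (fun=> a) (fun=> erefl).

Lemma padic_addA : associative padic_add.
Proof. by move=> x y z; apply: padicP => n /=; rewrite modnDmr modnDml addnA. Qed.

Lemma padic_addC : commutative padic_add.
Proof. by move=> x y; apply: padicP => n /=; rewrite addnC. Qed.

Lemma padic_add0 : left_id (padic_nat 0) padic_add.
Proof. by move=> x; apply: padicP => n /=; rewrite mod0n pres_mod. Qed.

Lemma padic_addN : left_inverse (padic_nat 0) padic_opp padic_add.
Proof.
move=> x; apply: padicP => n /=.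
by rewrite modnDml subnK ?(ltnW (pres_lt _ _)) // modnn mod0n.
Qed.

HB.instance Definition _ := GRing.isZmodule.Build padic padic_addA padic_addC padic_add0 padic_addN.

Lemma padic_mulA : associative padic_mul.
Proof. by move=> x y z; apply: padicP => n /=; rewrite modnMmr modnMml mulnA. Qed.

Lemma padic_mulC : commutative padic_mul.
Proof. by move=> x y; apply: padicP => n /=; rewrite mulnC. Qed.

Lemma padic_mul1 : left_id (padic_nat 1) padic_mul.
Proof. by move=> x; apply: padicP => n /=; rewrite modnMml mul1n pres_mod. Qed.

Lemma padic_mulD : left_distributive padic_mul padic_add.
Proof.
by move=> x y z; apply: padicP => n /=; rewrite modnMml modnDm mulnDl.
Qed.

Lemma padic_1neq0 : padic_nat 1 != padic_nat 0.
Proof.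
apply/eqP => E; have : pres (padic_nat 1) 1 = pres (padic_nat 0) 1 by rewrite E.
by rewrite /= expn1.
Qed.

HB.instance Definition _ := GRing.Zmodule_isComNzRing.Build padic
  padic_mulA padic_mulC padic_mul1 padic_mulD padic_1neq0.

Local Open Scope ring_scope.

Lemma pres_nat a n : pres (a%:R : padic) n = (a %% q ^ n)%N.
Proof.
elim: a => [|a IH] //.
rewrite -addn1 natrD.
rewrite (_ : pres _ n = ((pres (a%:R : padic) n + pres (1%R : padic) n) %% q ^ n)%N) //.
by rewrite IH /= modnDm.
Qed.

Lemma pres0 n : pres (0 : padic) n = 0%N.
Proof. exact: mod0n. Qed.

Lemma pres_mul x y n : pres (x * y) n = (pres x n * pres y n %% q ^ n)%N.
Proof. by []. Qed.

Lemma pres_natmul a x n : pres (a%:R * x) n = (a * pres x n %% q ^ n)%N.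
Proof. by rewrite pres_mul pres_nat modnMml. Qed.

Lemma pres_continuous n : continuous (fun x : padic => pres x n).
Proof.
move=> x; apply: (@continuous_comp _ _ _ (pres : padic -> prod_topology (fun=> nat)) (fun f => f n)).
  exact: initial_continuous.
exact: continuous_proj.
Qed.

Lemma continuous_padic (X : topologicalType) (f : X -> padic) :
  (forall n, continuous (fun x : X => pres (f x) n)) -> continuous f.
Proof.
move=> cf; apply: (@continuous_initial _ _ _ (pres : padic -> prod_topology (fun _ : nat => nat)) f).
apply: (@continuous_prod nat (fun=> nat) X) => n; exact: cf.
Qed.

Lemma continuous_nat2 (X : topologicalType) (f g : X -> nat) (h : nat -> nat -> nat) :
  continuous f -> continuous g -> continuous (fun t => h (f t) (g t)).
Proof.
move=> cf cg t A nA.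
have H : nbhs t (f @^-1` [set f t] `&` g @^-1` [set g t]).
  by apply: filterI; [apply: cf; exact: discrete_set1|apply: cg; exact: discrete_set1].
change (nbhs t [set s | A (h (f s) (g s))]).
by apply: filterS H => s [/= -> ->]; exact: (nbhs_singleton nA).
Qed.

Let pres_fst n : continuous (fun xy : padic * padic => pres xy.1 n).
Proof. by move=> xy; apply: (@continuous_comp _ _ _ fst (fun x => pres x n)); [exact: cvg_fst|exact: pres_continuous]. Qed.

Let pres_snd n : continuous (fun xy : padic * padic => pres xy.2 n).
Proof. by move=> xy; apply: (@continuous_comp _ _ _ snd (fun x => pres x n)); [exact: cvg_snd|exact: pres_continuous]. Qed.

Lemma padic_add_continuous : continuous (fun xy : padic * padic => xy.1 + xy.2).
Proof.
apply: continuous_padic => n.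
exact: (@continuous_nat2 _ _ _ (fun a b => (a + b) %% q ^ n)%N).
Qed.

Lemma padic_mul_continuous : continuous (fun xy : padic * padic => xy.1 * xy.2).
Proof.
apply: continuous_padic => n.
exact: (@continuous_nat2 _ _ _ (fun a b => (a * b) %% q ^ n)%N).
Qed.

Lemma padic_opp_continuous : continuous (fun x : padic => - x).
Proof.
apply: continuous_padic => n.
exact: (continuous_nat2 (h := fun a _ => (q ^ n - a) %% q ^ n)%N
  (@pres_continuous n) (@pres_continuous n)).
Qed.

HB.instance Definition _ := isTopologicalComRing.Build padic
  padic_add_continuous padic_opp_continuous padic_mul_continuous.

Lemma padic_profin : profin_space padic.
Proof.
pose X := prod_topology (fun _ : nat => nat).
have hX : hausdorff_space X by apply: hausdorff_product => n; exact: discrete_hausdorff.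
split.
- apply: initial_compact.
  have cB := @tychonoff nat (fun=> nat) (fun n => [set a | (a < q ^ n)%N])
    (fun n => finite_compact (finite_II (q ^ n))).
  apply: (subclosed_compact _ cB); last by move=> _ [x _ <-] n; exact: pres_lt.
  have -> : range pres = [set f : X | forall n, setT n -> [set f : X | (f n < q ^ n)%N /\ (f n.+1 %% q ^ n)%N = f n] f].
    apply/seteqP; split => [_ [x _ <-] n _|f fP]; first exact: (presP x n).
    by exists (@Padic f (fun n => fP n I)).
  apply: closed_forall => n _.
  pose h a b : nat := ((a < q ^ n)%N && (b %% q ^ n == a)%N).
  have -> : [set f : X | (f n < q ^ n)%N /\ (f n.+1 %% q ^ n)%N = f n] =
      [set f : X | [set 1%N] (h (f n) (f n.+1))].
    apply/seteqP; split => f; rewrite /h /=; first by move=> [-> ->]; rewrite eqxx.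
    by case: ltnP => //; case: eqP.
  apply: (closed_preimage (f := fun f : X => h (f n) (f n.+1))); last exact: discrete_closed.
  by apply: (@continuous_nat2 X (fun f => f n) (fun f => f n.+1) h);
    exact: (@continuous_proj nat (fun=> nat)).
- by apply: initial_hausdorff => //; exact: pres_inj.
- apply: initial_zero_dimensional; first exact: pres_inj.
  by apply: zero_dimension_prod => n; exact: discrete_zero_dimension.
Qed.

Lemma padic_open_pres n : open [set x | pres x n = 0%N].
Proof.
apply: (open_comp (f := fun x : padic => pres x n) (D := [set 0%N])).
  by move=> x _; exact: pres_continuous.
exact: discrete_open.
Qed.

(** [x] is the limit of its own residues [pres x n], taken as natural numbers. *)
Lemma padic_nat_dense (K : set padic) : closed K -> (forall n, K n%:R) -> forall x, K x.
Proof.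
move=> cK Kn x; apply: (@closed_cvg nat padic \oo _ (fun n : nat => (pres x n)%:R : padic) K cK).
  by apply: nearW => n; exact: Kn.
move=> A [_ [[O oO <-] Ox] OA].
have H m : pres ((pres x n)%:R : padic) m @[n --> \oo] --> pres x m.
  apply: cvg_near_cst; exists m => // n /= mn.
  rewrite pres_nat; elim: n mn => [|n IH]; first by rewrite leqn0 => /eqP ->; rewrite pres_mod.
  rewrite leq_eqVlt => /orP[/eqP ->|]; first by rewrite pres_mod.
  rewrite ltnS => mn; rewrite -(IH mn).
  have := presS x n => /(congr1 (modn^~ (q ^ m)%N)).
  by rewrite !modn_dvdm // dvdn_exp2l.
have FF : Filter (\oo : set_system nat) by typeclasses eauto.
have H2 := @prod_cvg nat (fun=> nat) nat \oo (fun n m => pres ((pres x n)%:R : padic) m)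
  (pres x) FF H O (open_nbhs_nbhs (conj oO Ox)).
change (\oo [set n | A ((pres x n)%:R : padic)]).
by apply: (@filterS nat \oo FF _ _ _ H2) => n; exact: OA.
Qed.

Lemma padic_natr_inj x : q%:R * x = 0 -> x = 0.
Proof.
move=> qx; apply: padicP => n; have : pres (q%:R * x) n.+1 = 0%N by rewrite qx pres0.
rewrite pres_natmul expnS => /eqP; rewrite -muln_modr muln_eq0 /= => /eqP E.
by have [_ <-] := presP x n; rewrite E; apply/esym; exact: pres0.
Qed.

(** [e] is the residue modulo [q], and [y] has the residues [pres x n.+1 %/ q], a shift by one
    level. *)
Lemma padic_root x : exists e y, (e < q)%N /\ x = e%:R + q%:R * y.
Proof.
have xq n : pres x n.+1 = (q * (pres x n.+1 %/ q) + pres x 1%N)%N.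
  rewrite mulnC {1}(divn_eq (pres x n.+1) q); congr (_ + _)%N.
  elim: n => [|n IH]; first by have := pres_mod x 1%N; rewrite expn1.
  rewrite -IH; have := presS x n.+1 => /(congr1 (modn^~ q)).
  by rewrite !modn_dvdm // dvdn_exp.
have yP n : (pres x n.+2 %/ q = pres x n.+1 %/ q %[mod q ^ n])%N.
  have := divn_eq (pres x n.+2) (q ^ n.+1)%N; have [_ ->] := presP x n.+1 => ->.
  by rewrite expnSr mulnA divnMDl // modnMDl.
exists (pres x 1%N), (padic_of yP); split; first by have := pres_lt x 1%N; rewrite expn1.
apply: padicP => n.
rewrite (_ : pres (_ + _) n = ((pres ((pres x 1%N)%:R : padic) n + pres (q%:R * padic_of yP)%R n) %% q ^ n)%N) //.
rewrite pres_nat pres_natmul modnDm /= -modnDmr modnMmr modnDmr addnC -xq.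
by have [_ ->] := presP x n.
Qed.

Lemma padic_natr_neq1 x : 1 <> q%:R * x.
Proof.
move=> E; have := pres_natmul q x 1%N; rewrite -E expn1 modnMr => H.
by have := pres_nat 1 1%N; rewrite expn1 modn_small.
Qed.

Lemma padic_unit x : prime q -> (forall y, x <> q%:R * y) -> exists y, x * y = 1.
Proof.
move=> pq nx; have [e [y0 [eq xE]]] := padic_root x.
have e0 : (0 < e)%N.
  by case: e xE {eq} => // xE; case: (nx y0); rewrite xE add0r.
have x1 n : (pres x n.+1 = e %[mod q])%N.
  rewrite xE (_ : pres (_ + _) n.+1 = ((pres (e%:R : padic) n.+1 + pres (q%:R * y0)%R n.+1) %% q ^ n.+1)%N) //.
  rewrite pres_nat pres_natmul modnDm modn_dvdm ?dvdn_exp //.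
  by rewrite mulnC addnC modnMDl.
have cop n : coprime (pres x n) (q ^ n)%N.
  case: n => [|n]; first by rewrite expn0 coprimen1.
  rewrite coprime_pexpr // -coprime_modl x1 modn_small //.
  by rewrite coprime_sym prime_coprime // gtnNdvd.
(* The Bezout coefficient inverts the residue of [x] modulo [q ^ n]; uniqueness of inverses makes
   the [y n] compatible. *)
pose y n := (egcdn (pres x n) (q ^ n)%N).1.
have yE n : (pres x n * y n = 1 %[mod q ^ n])%N.
  case: n => [|n]; first by rewrite expn0 !modn1.
  have p0 : (0 < pres x n.+1)%N.
    case: (posnP (pres x n.+1)) => // E; have := x1 n; rewrite E mod0n modn_small //.
    by move=> E0; rewrite -E0 in e0.
  rewrite /y; case: (egcdnP (q ^ n.+1)%N p0) => u w E _ /=.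
  by rewrite mulnC E (eqP (cop n.+1)) modnMDl.
have yP n : (y n.+1 = y n %[mod q ^ n])%N.
  have E1 : (pres x n * y n.+1 = 1 %[mod q ^ n])%N.
    rewrite -modnMml -presS modnMml.
    by have := yE n.+1 => /(congr1 (modn^~ (q ^ n)%N)); rewrite !mod_modX.
  rewrite -[y n.+1]muln1 -modnMmr -(yE n) modnMmr mulnCA mulnA -modnMml E1 modnMml.
  by rewrite mul1n.
exists (padic_of yP); apply: padicP => n.
by rewrite pres_mul /= modnMmr yE.
Qed.

Lemma padic_separated x : (forall n, exists y, x = (q ^ n)%:R * y) -> x = 0.
Proof.
move=> H; apply: padicP => n; have [y ->] := H n.
by rewrite pres_natmul modnMr pres0.
Qed.

End PAdicIntegers.

(** * Iterated power series rings *)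

Local Open Scope ring_scope.

Section PowerSeries.
Variable R : tcomRingType.

Definition pser : Type := prod_topology (fun _ : nat => (R : topologicalType)).

HB.instance Definition _ := Topological.copy pser (prod_topology (fun _ : nat => (R : topologicalType))).

Definition coef (f : pser) (n : nat) : R := f n.
Definition pser_of (f : nat -> R) : pser := f.

Implicit Types f g h : pser.

Lemma pserP f g : (forall n, coef f n = coef g n) -> f = g.
Proof. by move=> fg; apply/funext => n; exact: fg. Qed.

(** The [n]-th coefficient of a product only depends on truncations, so the laws of multiplication
    can be borrowed from [{poly R}]. *)
Definition trunc n f : {poly R} := \poly_(i < n.+1) coef f i.

Lemma coef_trunc n f i : (i <= n)%N -> (trunc n f)`_i = coef f i.
Proof. by move=> ni; rewrite coef_poly ltnS ni. Qed.

Definition pser_add f g := pser_of (fun n => coef f n + coef g n).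
Definition pser_opp f := pser_of (fun n => - coef f n).
Definition pser_mul f g := pser_of (fun n => (trunc n f * trunc n g)`_n).
Definition pserC (a : R) := pser_of (fun n => if n is 0%N then a else 0).

Lemma coef_trunc_mul N n f g : (n <= N)%N -> coef (pser_mul f g) n = (trunc N f * trunc N g)`_n.
Proof.
move=> nN; rewrite /coef /pser_mul /pser_of !coefM; apply: eq_bigr => i _.
have iN : (i <= n)%N by rewrite -ltnS.
by rewrite !coef_trunc ?leq_subr // ?(leq_trans iN) // (leq_trans (leq_subr _ _)).
Qed.

Lemma coef_pser_mul f g n :
  coef (pser_mul f g) n = \sum_(i < n.+1) coef f i * coef g (n - i)%N.
Proof.
rewrite {1}/coef /pser_mul /pser_of coefM.
by apply: eq_bigr => i _; rewrite !coef_trunc ?leq_subr // -ltnS.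
Qed.

Lemma pser_addA : associative pser_add.
Proof. by move=> f g h; apply: pserP => n; exact: addrA. Qed.

Lemma pser_addC : commutative pser_add.
Proof. by move=> f g; apply: pserP => n; exact: addrC. Qed.

Lemma pser_add0 : left_id (pserC 0) pser_add.
Proof. by move=> f; apply: pserP => -[|n]; exact: add0r. Qed.

Lemma pser_addN : left_inverse (pserC 0) pser_opp pser_add.
Proof. by move=> f; apply: pserP => -[|n]; exact: addNr. Qed.

HB.instance Definition _ := GRing.isZmodule.Build pser pser_addA pser_addC pser_add0 pser_addN.

Lemma pser_mulC : commutative pser_mul.
Proof. by move=> f g; apply: pserP => n; rewrite /coef /pser_mul /pser_of mulrC. Qed.

Lemma coef_mul_trunc_l n f g h :
  coef (pser_mul (pser_mul f g) h) n = (trunc n f * trunc n g * trunc n h)`_n.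
Proof.
rewrite /coef {1}/pser_mul /pser_of !coefM; apply: eq_bigr => i _.
by rewrite coef_trunc -1?ltnS // (@coef_trunc_mul n) // -ltnS.
Qed.

Lemma pser_mulA : associative pser_mul.
Proof.
move=> f g h; apply: pserP => n.
by rewrite pser_mulC !coef_mul_trunc_l mulrC mulrA.
Qed.

Lemma pser_mul1 : left_id (pserC 1) pser_mul.
Proof.
move=> f; apply: pserP => n; rewrite /coef /pser_mul /pser_of coefM big_ord_recl.
rewrite big1 => [|i _]; first by rewrite !coef_trunc ?leq_subr // subn0 addr0 mul1r.
rewrite (@coef_trunc n); first by rewrite (_ : coef _ _ = 0) ?mul0r.
exact: (ltn_ord (lift ord0 i)).
Qed.

Lemma pser_mulD : left_distributive pser_mul pser_add.
Proof.
move=> f g h; apply: pserP => n.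
rewrite -[RHS]/(coef (pser_mul f h) n + coef (pser_mul g h) n) !coef_pser_mul -big_split.
by apply: eq_bigr => i _ /=; rewrite -mulrDl.
Qed.

Lemma pser_1neq0 : pserC 1 != pserC 0.
Proof.
apply/eqP => /(congr1 (coef^~ 0%N)) /eqP; apply/negP; exact: oner_neq0.
Qed.

HB.instance Definition _ := GRing.Zmodule_isComNzRing.Build pser
  pser_mulA pser_mulC pser_mul1 pser_mulD pser_1neq0.

Lemma coefD f g n : coef (f + g) n = coef f n + coef g n. Proof. by []. Qed.
Lemma coef0 n : coef 0 n = 0. Proof. by case: n. Qed.
Lemma coef1 n : coef 1 n = (n == 0)%:R. Proof. by case: n. Qed.

Lemma coefMs f g n : coef (f * g) n = \sum_(i < n.+1) coef f i * coef g (n - i)%N.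
Proof. exact: coef_pser_mul. Qed.

Lemma coef_sum (F : nat -> pser) m n :
  coef (\sum_(i < m) F i) n = \sum_(i < m) coef (F i) n.
Proof.
by elim: m => [|m IH]; rewrite ?big_ord0 ?coef0 // !big_ord_recr /= coefD IH.
Qed.

Lemma coef_continuous n : continuous (coef^~ n).
Proof. exact: (@continuous_proj nat (fun=> R)). Qed.

Lemma continuous_pser (X : topologicalType) (f : X -> pser) :
  (forall n, continuous (fun t => coef (f t) n)) -> continuous f.
Proof. by move=> cf; exact: (@continuous_prod nat (fun=> R) X f cf). Qed.

Let cfst n : continuous (fun fg : pser * pser => coef fg.1 n).
Proof. by move=> fg; apply: (@continuous_comp _ _ _ fst (coef^~ n)); [exact: cvg_fst|exact: coef_continuous]. Qed.

Let csnd n : continuous (fun fg : pser * pser => coef fg.2 n).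
Proof. by move=> fg; apply: (@continuous_comp _ _ _ snd (coef^~ n)); [exact: cvg_snd|exact: coef_continuous]. Qed.

Lemma pser_add_continuous : continuous (fun fg : pser * pser => fg.1 + fg.2).
Proof. by apply: continuous_pser => n; exact: continuousDr. Qed.

Lemma pser_opp_continuous : continuous (fun f : pser => - f).
Proof. by apply: continuous_pser => n; apply: continuousNr; exact: coef_continuous. Qed.

Lemma pser_mul_continuous : continuous (fun fg : pser * pser => fg.1 * fg.2).
Proof.
apply: continuous_pser => n.
rewrite (_ : (fun t => _) = fun fg : pser * pser => \sum_(i < n.+1) coef fg.1 i * coef fg.2 (n - i)%N).
  by apply: (@continuous_sumr _ _ (fun i fg => coef fg.1 i * coef fg.2 (n - i)%N)) => i; exact: continuousMr.
by apply/funext => fg; rewrite coefMs.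
Qed.

HB.instance Definition _ := isTopologicalComRing.Build pser
  pser_add_continuous pser_opp_continuous pser_mul_continuous.

Lemma pser_profin : profin_space R -> profin_space pser.
Proof. by move=> pR; apply: (@profin_prod nat (fun=> R)). Qed.

Definition pserY : pser := pser_of (fun n => (n == 1%N)%:R).
Definition pser_shift f : pser := pser_of (fun n => coef f n.+1).

Lemma coefCM a f n : coef (pserC a * f) n = a * coef f n.
Proof.
rewrite coefMs big_ord_recl subn0 big1 ?addr0 // => i _.
by rewrite /coef /= mul0r.
Qed.

Lemma coefC0 a : coef (pserC a) 0%N = a. Proof. by []. Qed.

Lemma coefYM0 f : coef (pserY * f) 0%N = 0.
Proof. by rewrite coefMs big_ord1 /coef /= mul0r. Qed.

Lemma coefYM f n : coef (pserY * f) n.+1 = coef f n.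
Proof.
rewrite coefMs big_ord_recl {1}/coef /= mul0r add0r big_ord_recl {1}/coef /= mul1r.
rewrite big1 ?addr0; first by rewrite /bump /= subSS subn0.
by move=> i _; rewrite /coef /= mul0r.
Qed.

Lemma pserCM : {morph pserC : a b / a * b}.
Proof. by move=> a b; apply: pserP => n; rewrite coefCM /coef; case: n => //= n; rewrite mulr0. Qed.

Lemma pserCD : {morph pserC : a b / a + b}.
Proof. by move=> a b; apply: pserP => -[|n]; rewrite ?coefD /coef //= addr0. Qed.

Lemma pserC1 : pserC 1 = 1. Proof. by []. Qed.

Lemma pserCX a n : pserC (a ^+ n) = pserC a ^+ n.
Proof. by elim: n => [|n IH]; rewrite ?expr0 // !exprS pserCM IH. Qed.

Lemma pserC_inj : injective pserC.
Proof. by move=> a b /(congr1 (coef^~ 0%N)). Qed.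

Lemma pserC_continuous : continuous pserC.
Proof.
apply: continuous_pser => -[|n]; first by move=> x; exact: cvg_id.
exact: cst_continuous.
Qed.

Lemma pserC_sum (F : nat -> R) m : pserC (\sum_(i < m) F i) = \sum_(i < m) pserC (F i).
Proof. by elim: m => [|m IH]; rewrite ?big_ord0 // !big_ord_recr /= pserCD IH. Qed.

Lemma pser_split f : f = pserC (coef f 0%N) + pserY * pser_shift f.
Proof.
by apply: pserP => -[|n]; rewrite coefD ?coefYM0 ?coefYM ?addr0 // {2}/coef /= add0r.
Qed.

Lemma coef_1Y N n : coef ((1 + pserY) ^+ N) n = ('C(N, n))%:R.
Proof.
elim: N n => [|N IH] [|n].
- by rewrite expr0 coef1.
- by rewrite expr0 coef1 bin0n.
- by rewrite exprS mulrDl mul1r coefD coefYM0 IH addr0 !bin0.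
- by rewrite exprS mulrDl mul1r coefD coefYM !IH binS natrD.
Qed.

Lemma coef_natM m f n : coef (m%:R * f) n = m%:R * coef f n.
Proof.
have -> : m%:R = pserC (m%:R : R); last by rewrite coefCM.
elim: m => [|m IH]; first by apply: pserP => n'; rewrite mulr0n coef0; case: n'.
by rewrite !mulrS IH pserCD pserC1.
Qed.

End PowerSeries.

(** From [(n + 1) C(N, n + 1) = N C(N - 1, n)] only the valuation of [n + 1] is lost, and it is
    crudely at most [n + 1]. For fixed [n] the bound tends to infinity with [m]. *)
Lemma dvdn_expX_bin q m j n : prime q -> (q ^ (m - n.+1) %| 'C(q ^ m * j, n.+1))%N.
Proof.
move=> pq; have [C0|C0] := posnP 'C((q ^ m * j)%N, n.+1); first by rewrite C0 dvdn0.
rewrite pfactor_dvdn // leq_subLR.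
have N0 : (0 < q ^ m * j)%N by rewrite lt0n; apply/eqP => E; rewrite E bin0n in C0.
have := mul_bin_diag (q ^ m * j)%N n => E.
have : (q ^ m %| n.+1 * 'C(q ^ m * j, n.+1))%N by rewrite -E -mulnA dvdn_mulr.
rewrite pfactor_dvdn ?muln_gt0 ?C0 // lognM // => /leq_trans; apply.
rewrite leq_add2r; have := pfactor_dvdnn q n.+1 => /dvdn_leq -/(_ isT).
by apply: leq_trans; apply: ltnW; apply: ltn_expl; exact: prime_gt1.
Qed.

(* The intended [L] is Z_q [[X_0, ..., X_(d-1)]], with [c] the constant term and
   [dl i] the coefficient of X_i. *)
Record is_iwasawa (k d : nat) (L : tcomRingType) (X : nat -> L)
    (c : L -> padic k) (dl : nat -> L -> padic k) : Prop := IsIwasawa {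
  iw_profin : profin_space L;
  iw_cD : {morph c : f g / f + g};
  iw_cM : {morph c : f g / f * g};
  iw_c1 : c 1 = 1;
  iw_c_cont : continuous c;
  iw_dlD : forall i, {morph dl i : f g / f + g};
  iw_dlM : forall i f g, dl i (f * g) = c f * dl i g + c g * dl i f;
  iw_dl_cont : forall i, continuous (dl i);
  iw_cX : forall i, (i < d)%N -> c (X i) = 0;
  iw_dlX : forall i j, (i < d)%N -> (j < d)%N -> dl j (X i) = (i == j)%:R;
  iw_aug : forall f, c f = 0 -> exists g : nat -> L, f = \sum_(i < d) X i * g i;
  iw_reg : forall r f (g : nat -> L), (r < d)%N -> X r * f = \sum_(i < r) X i * g i ->
    exists h : nat -> L, f = \sum_(i < r) X i * h i;
  iw_nzX : forall i f, (i < d)%N -> X i * f = 0 -> f = 0;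
  (* Meant for [f = 1 + u + ... + u ^ (q - 1)] with [q = k.+2] and [u] of constant term 1. *)
  iw_nzd : forall f g, c f = k.+2%:R -> f * g = 0 -> g = 0;
  (* A form of topological nilpotence: the closures of the powers of [1 + X i] with exponent
     divisible by [k.+2 ^ m] shrink to 1. *)
  iw_tn : forall i (u : L), (i < d)%N ->
    (forall m, closure [set v : L | exists j, v = (1 + X i) ^+ (k.+2 ^ m * j)] u) -> u = 1;
  iw_sep : forall f : L, (forall m, exists g, f = (k.+2 ^ m)%N%:R * g) -> f = 0
}.

Lemma closed_principal (L : tcomRingType) (a : L) : profin_space L ->
  closed [set f | exists g, f = a * g].
Proof.
move=> [cL hL _]; rewrite (_ : [set f | _] = (fun g => a * g) @` setT).
  apply: closed_image cL hL _ closedT.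
  by apply: continuousMr; [exact: cst_continuous|exact: id_continuous].
apply/seteqP; split => f; first by move=> [g ->]; exists g.
by move=> [g _ <-]; exists g.
Qed.

(** * Adjoining one power series variable *)

Section Tower.
Variables (k d : nat) (L : tcomRingType) (X : nat -> L).
Variables (c : L -> padic k) (dl : nat -> L -> padic k).
Hypothesis pk : prime k.+2.
Hypothesis iw : is_iwasawa d X c dl.

Let X' i : pser L := if (i < d)%N then pserC (X i) else pserY L.
Let c' (f : pser L) := c (coef f 0%N).
Let dl' i (f : pser L) := if (i < d)%N then dl i (coef f 0%N) else c (coef f 1%N).

Let X'lt i : (i < d)%N -> X' i = pserC (X i). Proof. by rewrite /X' => ->. Qed.
Let X'd : X' d = pserY L. Proof. by rewrite /X' ltnn. Qed.

Let coefM0 (f g : pser L) : coef (f * g) 0%N = coef f 0%N * coef g 0%N.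
Proof. by rewrite coefMs big_ord1. Qed.

Let coefX'sum r (g : nat -> pser L) n : (r <= d)%N ->
  coef (\sum_(i < r) X' i * g i) n = \sum_(i < r) X i * coef (g i) n.
Proof.
move=> rd; rewrite (coef_sum (fun i => X' i * g i)); apply: eq_bigr => i _.
by rewrite X'lt ?coefCM // (leq_trans (ltn_ord i)).
Qed.

(** Membership in the ideal of the old variables is read coefficientwise. Multiplication by the new
    variable shifts coefficients, multiplication by an old one acts on each of them. *)
Lemma tower_reg r f (g : nat -> pser L) : (r < d.+1)%N -> X' r * f = \sum_(i < r) X' i * g i ->
  exists h : nat -> pser L, f = \sum_(i < r) X' i * h i.
Proof.
rewrite ltnS leq_eqVlt => /orP[/eqP ->|rd] E.
  exists (fun i => pser_shift (g i)); apply: pserP => n.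
  by rewrite -coefYM -X'd E coefX'sum // (coefX'sum (fun i => pser_shift (g i))).
have H n : exists h : nat -> L, coef f n = \sum_(i < r) X i * h i.
  apply: (iw_reg iw rd (g := fun i => coef (g i) n)).
  by rewrite -coefX'sum ?(ltnW rd) // -E X'lt // coefCM.
have /choice[h Hh] := H.
exists (fun i => pser_of (fun m => h m i)); apply: pserP => m.
by rewrite (coefX'sum (fun i => pser_of (fun m => h m i))) ?(ltnW rd).
Qed.

(** For the new variable, [dvdn_expX_bin] bounds the coefficients from below in divisibility, a
    closed condition [J m]; as [m] grows, [iw_sep] kills those of positive degree. For an old
    variable everything stays among constant series. *)
Lemma tower_tn i (u : pser L) : (i < d.+1)%N ->
  (forall m, closure [set v : pser L | exists j, v = (1 + X' i) ^+ (k.+2 ^ m * j)] u) -> u = 1.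
Proof.
have pL := iw_profin iw; have [cL hL _] := pL; have [_ hP _] := pser_profin pL.
rewrite ltnS leq_eqVlt => /orP[/eqP ->|id] cu.
  pose J m : set (pser L) := [set f | coef f 0%N = 1 /\
    forall n, (fun f => [set a | exists b, a = (k.+2 ^ (m - n.+1))%N%:R * b] (coef f n.+1)) f].
  have cJ m : closed (J m).
    rewrite (_ : J m = [set f | [set 1] (coef f 0%N)] `&`
       [set f | forall n, setT n -> [set f | [set a | exists b, a = (k.+2 ^ (m - n.+1))%N%:R * b] (coef f n.+1)] f]).
      apply: closedI.
        apply: (@closed_preimage (pser L) L (fun f => coef f 0%N) [set 1]); first exact: coef_continuous.
        exact: hausdorff_closed1.
      apply: closed_forall => n _; apply: (@closed_preimage (pser L) L (fun f => coef f n.+1)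
          [set a : L | exists b, a = (k.+2 ^ (m - n.+1))%N%:R * b]).
        exact: coef_continuous.
      exact: closed_principal.
    by apply/seteqP; split => f [f0 fn]; split => // n; [move=> _; exact: fn|exact: (fn n I)].
  have uJ m : J m u.
    rewrite ((closure_id (J m)).1 (cJ m)); apply: closureS (cu m) => _ [j ->].
    rewrite X'd; split; first by rewrite coef_1Y bin0.
    move=> n; rewrite /= coef_1Y; have /dvdnP[b ->] := dvdn_expX_bin m j n pk.
    by exists b%:R; rewrite mulnC natrM.
  apply: pserP => -[|n]; first by have [-> _] := uJ 0%N.
  rewrite coef1; apply: (iw_sep iw) => m.
  by have [_ /(_ n) /=] := uJ (m + n.+1)%N; rewrite addnK.
have cC m : closure [set v : pser L | exists j, v = (1 + X' i) ^+ (k.+2 ^ m * j)] `<=`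
    @pserC L @` closure [set v : L | exists j, v = (1 + X i) ^+ (k.+2 ^ m * j)].
  have clI : closed (@pserC L @` closure [set v : L | exists j, v = (1 + X i) ^+ (k.+2 ^ m * j)]).
    by apply: closed_image => //; [exact: pserC_continuous|exact: closed_closure].
  rewrite [X in _ `<=` X](closure_id _).1 //; apply: closureS => _ [j ->].
  exists ((1 + X i) ^+ (k.+2 ^ m * j)).
    by apply: subset_closure; exists j.
  by rewrite pserCX pserCD X'lt.
have [u0 _ uE] := cC 0%N _ (cu 0%N).
rewrite -uE (_ : u0 = 1) //; apply: (iw_tn iw id) => m.
have [u1 cu1 u1E] := cC m _ (cu m).
by rewrite (_ : u0 = u1) //; apply: (@pserC_inj L); rewrite uE.
Qed.

Lemma tower : is_iwasawa d.+1 X' c' dl'.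
Proof.
have pL := iw_profin iw; split.
- exact: pser_profin.
- by move=> f g; rewrite /c' coefD (iw_cD iw).
- by move=> f g; rewrite /c' coefM0 (iw_cM iw).
- by rewrite /c' coef1 (iw_c1 iw).
- move=> f; apply: (@continuous_comp (pser L) L (padic k) (fun f => coef f 0%N) c); first exact: coef_continuous.
  exact: (iw_c_cont iw).
- by move=> i f g; rewrite /dl'; case: ifP => _; rewrite coefD ?(iw_dlD iw) ?(iw_cD iw).
- move=> i f g; rewrite /dl' /c'; case: ifP => _; first by rewrite coefM0 (iw_dlM iw).
  by rewrite coefMs big_ord_recr big_ord1 /= subnn subn0 (iw_cD iw) !(iw_cM iw) (mulrC (c (coef f 1%N))).
- move=> i f; case id: (i < d)%N.
    rewrite (_ : dl' i = fun f => dl i (coef f 0%N)); last by apply/funext => g; rewrite /dl' id.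
    apply: (@continuous_comp (pser L) L (padic k) (fun f => coef f 0%N) (dl i)); first exact: coef_continuous.
    exact: (iw_dl_cont iw).
  rewrite (_ : dl' i = fun f => c (coef f 1%N)); last by apply/funext => g; rewrite /dl' id.
  apply: (@continuous_comp (pser L) L (padic k) (fun f => coef f 1%N) c); first exact: coef_continuous.
  exact: (iw_c_cont iw).
- have c0 : c 0 = 0 by apply: (addrI (c 0)); rewrite -(iw_cD iw) !addr0.
  move=> i; rewrite ltnS leq_eqVlt => /orP[/eqP ->|id]; first by rewrite X'd /c' c0.
  by rewrite X'lt // /c' coefC0 (iw_cX iw).
- have c0 : c 0 = 0 by apply: (addrI (c 0)); rewrite -(iw_cD iw) !addr0.
  have dl0 j : dl j 0 = 0 by apply: (addrI (dl j 0)); rewrite -(iw_dlD iw) !addr0.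
  move=> i j; rewrite !ltnS leq_eqVlt => /orP[/eqP ->|id]; rewrite leq_eqVlt => /orP[/eqP ->|jd].
  + by rewrite X'd /dl' ltnn eqxx (iw_c1 iw).
  + by rewrite X'd /dl' jd dl0 gtn_eqF.
  + by rewrite X'lt // /dl' ltnn c0 ltn_eqF.
  + by rewrite X'lt // /dl' jd coefC0 (iw_dlX iw).
- move=> f /(iw_aug iw) [g gE]; exists (fun i => if (i < d)%N then pserC (g i) else pser_shift f).
  rewrite big_ord_recr /= ltnn X'd {1}(pser_split f); congr (_ + _).
  rewrite gE (pserC_sum (fun i => X i * g i)); apply: eq_bigr => i _.
  by rewrite ltn_ord X'lt // pserCM.
- exact: tower_reg.
- move=> i f; rewrite ltnS leq_eqVlt => /orP[/eqP ->|id] E; apply: pserP => n; rewrite coef0.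
    by rewrite -coefYM -X'd E coef0.
  by apply: (iw_nzX iw id); rewrite -coefCM -X'lt // E coef0.
(* Once the lower coefficients of [g] vanish, the [n]-th coefficient of [f * g] is
   [coef f 0 * coef g n], and the hypothesis on [L] applies. *)
- move=> f g cf fg; apply: pserP => n; rewrite coef0; elim/ltn_ind: n => n IH.
  apply: (iw_nzd iw cf); have : coef (f * g) n = 0 by rewrite fg coef0.
  rewrite coefMs big_ord_recl subn0 big1 ?addr0 //.
  by move=> i _; rewrite IH ?mulr0 // ltn_subrL (leq_ltn_trans _ (ltn_ord i)).
- exact: tower_tn.
- move=> f H; apply: pserP => n; rewrite coef0; apply: (iw_sep iw) => m.
  by have [g ->] := H m; exists (coef g n); rewrite coef_natM.
Qed.

End Tower.

Theorem iwasawa_exists (k d : nat) : prime k.+2 ->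
  exists (L : tcomRingType) (X : nat -> L) c dl, @is_iwasawa k d L X c dl.
Proof.
move=> pk; elim: d => [|d [L [X [c [dl iw]]]]]; last first.
  by eexists; eexists; eexists; eexists; exact: (tower pk iw).
exists (padic k), (fun=> 0), id, (fun _ _ => 0); split => //.
- exact: padic_profin.
- by move=> x; exact: cvg_id.
- by move=> i f g; rewrite addr0.
- by move=> i f g; rewrite !mulr0 addr0.
- by move=> i; exact: cst_continuous.
- by move=> f f0; exists (fun=> 0); rewrite big_ord0.
- by move=> f g -> ; exact: padic_natr_inj.
- exact: padic_separated.
Qed.

(** * The groups of one-variable units *)

Record iwasawa (k d : nat) : Type := Iwasawa {
  iwR :> tcomRingType;
  iwX : nat -> iwR;
  iwc : iwR -> padic k;
  iwdl : nat -> iwR -> padic k;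
  iw_prime : prime k.+2;
  iw_gt1 : (1 < d)%N;
  iwP : is_iwasawa d iwX iwc iwdl
}.

Lemma sum_single (R : zmodType) (F : nat -> R) r i : (i < r)%N ->
  (forall j, j != i -> F j = 0) -> \sum_(j < r) F j = F i.
Proof.
move=> ir F1; rewrite (bigD1 (Ordinal ir)) //= big1 ?addr0 // => j ji.
by apply: F1; apply: contra ji => /eqP ji; apply/eqP/val_inj.
Qed.

Section Units.
Variables (k d : nat) (I : iwasawa k d).
Let X := @iwX _ _ I.
Let c := @iwc _ _ I.
Let dl := @iwdl _ _ I.
Let iw : is_iwasawa d X c dl := iwP I.
Let q := k.+2.

Implicit Types f g u v : iwR I.

Let pL : profin_space I. Proof. exact: iw_profin iw. Qed.
Let cL : compact [set: I]. Proof. by case: pL. Qed.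
Let hL : hausdorff_space I. Proof. by case: pL. Qed.

Lemma iwc0 : c 0 = 0.
Proof. by apply: (addrI (c 0)); rewrite -(iw_cD iw) !addr0. Qed.

Lemma iwcN f : c (- f) = - c f.
Proof. by apply: (addrI (c f)); rewrite -(iw_cD iw) !subrr iwc0. Qed.

Lemma iwdl0 i : dl i 0 = 0.
Proof. by apply: (addrI (dl i 0)); rewrite -(iw_dlD iw) !addr0. Qed.

Lemma iwdlN i f : dl i (- f) = - dl i f.
Proof. by apply: (addrI (dl i f)); rewrite -(iw_dlD iw) !subrr iwdl0. Qed.

Lemma iwdl1 i : dl i 1 = 0.
Proof.
have := iw_dlM iw i 1 1; rewrite mulr1 (iw_c1 iw) !mul1r => E.
by apply: (addrI (dl i 1)); rewrite addr0 -E.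
Qed.

Lemma iwcX f n : c (f ^+ n) = c f ^+ n.
Proof. by elim: n => [|n IH]; rewrite ?expr0 ?(iw_c1 iw) // !exprS (iw_cM iw) IH. Qed.

Lemma iwc_sum (F : nat -> I) n : c (\sum_(i < n) F i) = \sum_(i < n) c (F i).
Proof. by elim: n => [|n IH]; rewrite ?big_ord0 ?iwc0 // !big_ord_recr (iw_cD iw) IH. Qed.

Lemma iwdl_sum j (F : nat -> I) n : dl j (\sum_(i < n) F i) = \sum_(i < n) dl j (F i).
Proof. by elim: n => [|n IH]; rewrite ?big_ord0 ?iwdl0 // !big_ord_recr (iw_dlD iw) IH. Qed.

Lemma iwdlXM i j f : (i < d)%N -> (j < d)%N -> dl j (X i * f) = (i == j)%:R * c f.
Proof.
by move=> id jd; rewrite (iw_dlM iw) (iw_cX iw) // mul0r add0r (iw_dlX iw) // mulrC.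
Qed.

Lemma iwdl_lin j (v : nat -> I) : (j < d)%N -> dl j (\sum_(i < d) X i * v i) = c (v j).
Proof.
move=> jd; rewrite (iwdl_sum j (fun i => X i * v i)).
rewrite (eq_bigr (fun i : 'I_d => (fun i => (i == j)%:R * c (v i)) (i : nat))); last first.
  by move=> i _; rewrite iwdlXM.
rewrite (sum_single (F := fun i => (i == j)%:R * c (v i)) jd) ?eqxx ?mul1r //.
by move=> i /negbTE ->; rewrite mul0r.
Qed.

(* By compactness the closure of the natural powers already contains inverses. *)
Definition unitX i : set I := closure [set u | exists n, u = (1 + X i) ^+ n].

Lemma unitX_min i (K : set I) : closed K -> (forall n, K ((1 + X i) ^+ n)) -> unitX i `<=` K.
Proof.
move=> cK Kn; rewrite [X in _ `<=` X](closure_id K).1 //; apply: closureS => _ [n ->].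
exact: Kn.
Qed.

Lemma unitX_gen i n : unitX i ((1 + X i) ^+ n).
Proof. by apply: subset_closure; exists n. Qed.

Lemma unitX1 i : unitX i 1.
Proof. by have := @unitX_gen i 0%N; rewrite expr0. Qed.

Lemma unitXM i u v : unitX i u -> unitX i v -> unitX i (u * v).
Proof.
move=> Uu; move: v; apply: unitX_min.
  apply: (closed_preimage (f := fun v => u * v)); last exact: closed_closure.
  by apply: continuousMr; [exact: cst_continuous|exact: id_continuous].
move=> n; move: u Uu; apply: unitX_min.
  apply: (closed_preimage (f := fun v => v * (1 + X i) ^+ n)); last exact: closed_closure.
  by apply: continuousMr; [exact: id_continuous|exact: cst_continuous].
by move=> m; rewrite -exprD; exact: unitX_gen.
Qed.

Lemma unitX_c i u : (i < d)%N -> unitX i u -> c u = 1.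
Proof.
move=> id; move: u; apply: (unitX_min (K := [set u | [set 1] (c u)])).
  apply: closed_preimage; first exact: (iw_c_cont iw).
  by apply: hausdorff_closed1; case: (padic_profin k).
move=> n /=; rewrite iwcX (iw_cD iw) (iw_c1 iw) (iw_cX iw) // addr0.
by rewrite expr1n.
Qed.

Lemma unitX_dlM i j u v : (i < d)%N -> unitX i u -> unitX i v -> dl j (u * v) = dl j u + dl j v.
Proof. by move=> id Uu Uv; rewrite (iw_dlM iw) !(unitX_c id) // !mul1r addrC. Qed.

Lemma dl_1X i j n : (i < d)%N -> (j < d)%N -> dl j ((1 + X i) ^+ n) = (i == j)%:R * n%:R.
Proof.
move=> id jd; elim: n => [|n IH]; first by rewrite expr0 iwdl1 mulr0.
have -> : (1 + X i) ^+ n.+1 = (1 + X i) ^+ 1 * (1 + X i) ^+ n by rewrite -exprS.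
rewrite (unitX_dlM j id (@unitX_gen i 1%N) (@unitX_gen i n)) IH expr1 (iw_dlD iw) iwdl1 add0r.
by rewrite (iw_dlX iw) // -natr1 mulrDr mulr1 addrC.
Qed.

Lemma unitX_dl_neq i j u : (i < d)%N -> (j < d)%N -> i != j -> unitX i u -> dl j u = 0.
Proof.
move=> id jd ij; move: u; apply: (unitX_min (K := [set u | [set 0] (dl j u)])).
  apply: closed_preimage; first exact: (iw_dl_cont iw).
  by apply: hausdorff_closed1; case: (padic_profin k).
by move=> n /=; rewrite dl_1X // (negbTE ij) mul0r.
Qed.

Lemma unitX_principal i u : unitX i u -> exists f, u = 1 + X i * f.
Proof.
suff H : unitX i `<=` [set u | [set f | exists g, f = X i * g] (u - 1)].
  by move=> /H [f E]; exists f; rewrite -E addrC subrK.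
apply: unitX_min.
  apply: (closed_preimage (f := fun u => u - 1)); last exact: closed_principal.
  by apply: continuousDr; [exact: id_continuous|exact: cst_continuous].
move=> n /=; elim: n => [|n [f fE]]; first by exists 0; rewrite expr0 subrr mulr0.
exists (f + (1 + X i) ^+ n).
by rewrite exprS mulrDl mul1r mulrDr -fE addrAC.
Qed.

Lemma unitX_dl_surj i l : (i < d)%N -> exists2 u, unitX i u & dl i u = l.
Proof.
move=> id; suff [u Uu <-] : (dl i @` unitX i) l by exists u.
move: l; apply: padic_nat_dense.
  apply: closed_image => //; first by case: (padic_profin k).
    exact: (iw_dl_cont iw).
  exact: closed_closure.
by move=> n; exists ((1 + X i) ^+ n); [exact: unitX_gen|rewrite dl_1X // eqxx mul1r].
Qed.

(** Near [u], the derivative at [(1 + X i) ^+ n], which is [n], must be divisible by [q ^ m], and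
    [iw_tn] applies. With [unitX_dl_surj], [dl i] identifies [unitX i] with the additive group
    Z_q. *)
Lemma unitX_dl0 i u : (i < d)%N -> unitX i u -> dl i u = 0 -> u = 1.
Proof.
move=> id Uu u0; apply: (iw_tn iw id) => m A nA.
have oD : open [set v | pres (dl i v) m = 0%N].
  apply: (open_comp (f := dl i) (D := [set l | pres l m = 0%N])).
    by move=> x _; exact: (iw_dl_cont iw).
  exact: padic_open_pres.
have nD : nbhs u [set v | pres (dl i v) m = 0%N].
  by apply: open_nbhs_nbhs; split => //; rewrite /= u0 pres0.
have [_ [[n ->] [An /=]]] := Uu _ (filterI nA nD).
rewrite dl_1X // eqxx mul1r pres_nat => /eqP; rewrite -/(dvdn _ _) => /dvdnP[j nE].
exists ((1 + X i) ^+ n); split => //; exists j.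
by rewrite nE mulnC.
Qed.

Lemma unitXV i u : (i < d)%N -> unitX i u -> exists2 v, unitX i v & u * v = 1.
Proof.
move=> id Uu; have [v Uv vE] := unitX_dl_surj (- dl i u) id.
exists v => //; apply: (unitX_dl0 id); first exact: unitXM.
by rewrite (unitX_dlM _ id) // vE subrr.
Qed.

Lemma unitX_inj i u v : (i < d)%N -> unitX i u -> unitX i v -> dl i u = dl i v -> u = v.
Proof.
move=> id Uu Uv E; have [w Uw vw] := unitXV id Uv.
have uw : u * w = 1.
  apply: (unitX_dl0 id); first exact: unitXM.
  by rewrite (unitX_dlM _ id) // E -(unitX_dlM _ id) // vw iwdl1.
by rewrite -[LHS]mulr1 -vw mulrCA uw mulr1.
Qed.

Definition units n : set I :=
  [set u | exists s : nat -> I, (forall i, (i < n)%N -> unitX i (s i)) /\ u = \prod_(i < n) s i].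

Lemma closed_units n : closed (units n).
Proof.
elim: n => [|n IH].
  rewrite (_ : units 0 = [set 1]); first exact: hausdorff_closed1.
  apply/seteqP; split => [u [s [_ ->]]|_ ->]; first by rewrite big_ord0.
  by exists (fun=> 1); rewrite big_ord0.
rewrite (_ : units n.+1 = (fun uv : I * I => uv.1 * uv.2) @` (units n `*` unitX n)).
  apply: compact_closed => //; apply: continuous_compact.
    by apply: continuous_subspaceT; exact: mulr_continuous.
  by apply: compact_setX; apply: subclosed_compact cL _ => //; exact: closed_closure.
apply/seteqP; split => [u [s [Us ->]]|_ [[u v] [/= [s [Us ->]] Uv] <-]].
  exists (\prod_(i < n) s i, s n); last by rewrite big_ord_recr.
  by split => /=; [exists s; split => // i /ltnW|]; exact: Us.
exists (fun j => if j == n then v else s j); split.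
  by move=> i; case: eqP => [->//|/eqP ni]; rewrite ltnS leq_eqVlt (negbTE ni) => /Us.
rewrite big_ord_recr /= eqxx; congr (_ * _); apply: eq_bigr => i _.
by rewrite ltn_eqF.
Qed.

Lemma units1 n : units n 1.
Proof. by exists (fun=> 1); split; [move=> i _; exact: unitX1|rewrite big1]. Qed.

Lemma unitsM n u v : units n u -> units n v -> units n (u * v).
Proof.
move=> [s [Us ->]] [t [Ut ->]]; exists (fun i => s i * t i); split.
  by move=> i id; apply: unitXM; [exact: Us|exact: Ut].
by rewrite big_split.
Qed.

Lemma unitsV u : units d u -> exists2 v, units d v & u * v = 1.
Proof.
move=> [s [Us ->]].
have /choice[t Ht] : forall i, exists t, (i < d)%N -> unitX i t /\ s i * t = 1.
  move=> i; case: (ltnP i d) => id; last by exists 1.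
  by have [t Ut E] := unitXV id (Us i id); exists t.
exists (\prod_(i < d) t i); first by exists t; split => // i id; have [] := Ht i id.
by rewrite -big_split big1 // => i _; have [] := Ht i (ltn_ord i).
Qed.

Lemma units_single i u : (i < d)%N -> unitX i u -> units d u.
Proof.
move=> id Uu; exists (fun j => if j == i then u else 1); split.
  by move=> j _; case: eqP => [->//|_]; exact: unitX1.
rewrite (bigD1 (Ordinal id)) //= eqxx big1 ?mulr1 // => j ji.
by case: eqP => // E; case/eqP: ji; exact: val_inj.
Qed.

(** On elements of constant term 1, [dl j] turns products into sums, and it vanishes on [unitX i]
    for [i] other than [j]. The factors of an element of [units d] are therefore determined by
    it. *)
Lemma dl_units (s : nat -> I) n j : (n <= d)%N -> (j < n)%N ->
  (forall i, (i < n)%N -> unitX i (s i)) -> dl j (\prod_(i < n) s i) = dl j (s j).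
Proof.
have cprod m (t : nat -> I) : (m <= d)%N -> (forall i, (i < m)%N -> unitX i (t i)) ->
    c (\prod_(i < m) t i) = 1.
  elim: m => [|m IH] md Ut; first by rewrite big_ord0 (iw_c1 iw).
  rewrite big_ord_recr /= (iw_cM iw) (unitX_c md (Ut m (leqnn _))) mulr1; apply: IH.
    exact: ltnW.
  by move=> i /ltnW; exact: Ut.
have dl0 m (t : nat -> I) : (m <= j)%N -> (m <= d)%N -> (j < d)%N -> (forall i, (i < m)%N -> unitX i (t i)) ->
    dl j (\prod_(i < m) t i) = 0.
  elim: m => [|m IH] mj md jd Ut; first by rewrite big_ord0 iwdl1.
  rewrite big_ord_recr /= (iw_dlM iw) (cprod m t (ltnW md)) ?mul1r; last by move=> i /ltnW; exact: Ut.
  rewrite IH ?(ltnW mj) ?(ltnW md) // ?mulr0 ?addr0; last by move=> i /ltnW; exact: Ut.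
  by apply: (unitX_dl_neq (i := m) md jd); [rewrite ltn_eqF|exact: Ut].
elim: n => // n IH nd; rewrite ltnS leq_eqVlt => jn Us.
have Us' i : (i < n)%N -> unitX i (s i) by move=> /ltnW; exact: Us.
rewrite big_ord_recr /= (iw_dlM iw) (cprod n s (ltnW nd) Us') (unitX_c nd (Us n (leqnn _))) !mul1r.
case/orP: jn => [/eqP jn|jn].
  have nj : (n <= j)%N by rewrite jn.
  have jd : (j < d)%N by rewrite jn.
  by rewrite (dl0 n s nj (ltnW nd) jd Us') addr0 jn.
rewrite (IH (ltnW nd) jn Us') (unitX_dl_neq (i := n) nd (leq_trans jn (ltnW nd)) _ (Us n (leqnn _))) ?add0r //.
by rewrite gtn_eqF.
Qed.

End Units.

(** * The Magnus group *)

Section Magnus.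
Variables (k d : nat) (I : iwasawa k d).
Let q := k.+2.
Let X := @iwX _ _ I.
Let c := @iwc _ _ I.
Let dl := @iwdl _ _ I.
Let iw : is_iwasawa d X c dl := iwP I.

(** The first Koszul differential of the [X i]; for a Magnus pair it gives the fundamental formula
    [u - 1 = sum v_i X_i] of Fox calculus. *)
Definition delta (v : nat -> I) : I := \sum_(i < d) X i * v i.

(* The element [v] stands for the matrix [[1 + delta v, 0], [v, 1]] of the
   Magnus representation: (v * w)_i = v_i (1 + delta w) + w_i. *)
Record mag : Type := Mag {
  mv : nat -> I;
  mvP : (forall i, (d <= i)%N -> mv i = 0) /\ units d (1 + delta mv)
}.

Definition magu (g : mag) : I := 1 + delta (mv g).

Lemma maguE g : magu g = 1 + delta (mv g). Proof. by []. Qed.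

HB.instance Definition _ := gen_eqMixin mag.
HB.instance Definition _ := gen_choiceMixin mag.
HB.instance Definition _ := Topological.copy mag
  (initial_topology (mv : mag -> prod_topology (fun _ : nat => (I : topologicalType)))).

Lemma magP (g h : mag) : (forall i, (i < d)%N -> mv g i = mv h i) -> g = h.
Proof.
case: g => v vP; case: h => w wP /= E.
have {}E : v = w.
  apply/funext => i; case: (ltnP i d) => [/E //|di].
  by rewrite (proj1 vP) // (proj1 wP).
by move: wP; rewrite -E => wP; congr Mag; exact: Prop_irrelevance.
Qed.

Lemma mv_inj : injective mv.
Proof. by move=> g h E; apply: magP => i _; rewrite E. Qed.

Lemma deltaD (v w : nat -> I) : delta (fun i => v i + w i) = delta v + delta w.
Proof. by rewrite /delta -big_split; apply: eq_bigr => i _; rewrite mulrDr. Qed.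

Lemma deltaM (v : nat -> I) f : delta (fun i => v i * f) = delta v * f.
Proof. by rewrite /delta mulr_suml; apply: eq_bigr => i _; rewrite mulrA. Qed.

Lemma deltaN (v : nat -> I) : delta (fun i => - v i) = - delta v.
Proof. by rewrite /delta -sumrN; apply: eq_bigr => i _; rewrite mulrN. Qed.

Lemma eq_delta (v w : nat -> I) : (forall i, (i < d)%N -> v i = w i) -> delta v = delta w.
Proof. by move=> E; apply: eq_bigr => i _; rewrite E. Qed.

Lemma delta_sum (v : nat -> nat -> I) n :
  delta (fun l => \sum_(i < n) v i l) = \sum_(i < n) delta (v i).
Proof.
elim: n => [|n IH].
  by rewrite big_ord0 /delta big1 // => i _; rewrite big_ord0 mulr0.
rewrite big_ord_recr /= -IH -deltaD; apply: eq_delta => i _.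
by rewrite big_ord_recr.
Qed.

Lemma delta_single i f : (i < d)%N -> delta (fun j => if j == i then f else 0) = X i * f.
Proof.
move=> id; rewrite /delta (sum_single (F := fun j => X j * (if j == i then f else 0)) id) ?eqxx //.
by move=> j /negbTE ->; rewrite mulr0.
Qed.

Lemma mag_mulP (g h : mag) :
  (forall i, (d <= i)%N -> mv g i * magu h + mv h i = 0) /\
  units d (1 + delta (fun i => mv g i * magu h + mv h i)).
Proof.
split=> [i di|]; first by rewrite (proj1 (mvP g)) // (proj1 (mvP h)) // mul0r addr0.
rewrite deltaD deltaM (_ : _ + _ = magu g * magu h); last first.
  by rewrite (maguE g) mulrDl mul1r addrCA [RHS]addrC -maguE.
by apply: unitsM; [exact: (proj2 (mvP g))|exact: (proj2 (mvP h))].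
Qed.

Definition mag_mul g h := Mag (mag_mulP g h).

Lemma mag_oneP : (forall i, (d <= i)%N -> (0 : I) = 0) /\ units d (1 + delta (fun=> 0)).
Proof.
split => //; rewrite (_ : delta _ = 0) ?addr0; first exact: units1.
by rewrite /delta big1 // => i _; rewrite mulr0.
Qed.

Definition mag_one := @Mag (fun=> 0) mag_oneP.

Lemma magu_mul g h : magu (mag_mul g h) = magu g * magu h.
Proof.
rewrite (maguE (mag_mul g h)) /= deltaD deltaM (maguE g) mulrDl mul1r.
by rewrite addrCA [RHS]addrC -maguE.
Qed.

Lemma magu_one : magu mag_one = 1.
Proof.
by rewrite /magu /delta big1 ?addr0 // => i _; rewrite /= mulr0.
Qed.

Definition mag_uinv (g : mag) : I := xget 1 [set t | units d t /\ magu g * t = 1].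

Lemma mag_uinvP g : units d (mag_uinv g) /\ magu g * mag_uinv g = 1.
Proof.
rewrite /mag_uinv; case: xgetP => [t _ //|H].
by have [t Ut E] := unitsV (proj2 (mvP g)); case: (H t).
Qed.

Lemma mag_invP g : (forall i, (d <= i)%N -> - mv g i * mag_uinv g = 0) /\
  units d (1 + delta (fun i => - mv g i * mag_uinv g)).
Proof.
have [Ut E] := mag_uinvP g; split.
  by move=> i di; rewrite (proj1 (mvP g)) // oppr0 mul0r.
rewrite deltaM deltaN (_ : 1 + _ = mag_uinv g) //.
by rewrite -{1}E /magu -mulrDl addrK mul1r.
Qed.

Definition mag_inv g := Mag (mag_invP g).

Lemma mag_mulA : associative mag_mul.
Proof.
move=> g h l; apply: magP => i _; rewrite /= magu_mul.
by rewrite [in RHS]mulrDl mulrA addrA.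
Qed.

Lemma mag_mul1 : left_id mag_one mag_mul.
Proof. by move=> g; apply: magP => i _; rewrite /= mul0r add0r. Qed.

Lemma mag_1mul : right_id mag_one mag_mul.
Proof. by move=> g; apply: magP => i _; rewrite /= magu_one mulr1 addr0. Qed.

Lemma mag_mulV : left_inverse mag_one mag_inv mag_mul.
Proof.
move=> g; apply: magP => i _ /=; have [_ E] := mag_uinvP g.
by rewrite -mulrA (mulrC (mag_uinv g)) E mulr1 addNr.
Qed.

Lemma mag_Vmul : right_inverse mag_one mag_inv mag_mul.
Proof.
move=> g; apply: magP => i _ /=; have [_ E] := mag_uinvP g.
have -> : magu (mag_inv g) = mag_uinv g.
  by rewrite /magu /= deltaM deltaN -{1}E /magu -mulrDl addrK mul1r.
by rewrite mulNr subrr.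
Qed.

HB.instance Definition _ := isGroup.Build mag mag_mulA mag_mul1 mag_1mul mag_mulV mag_Vmul.

Let pL : profin_space I. Proof. exact: iw_profin iw. Qed.

Lemma mv_continuous i : continuous (fun g : mag => mv g i).
Proof.
move=> g; apply: (@continuous_comp _ _ _ (mv : mag -> prod_topology (fun _ : nat => (I : topologicalType))) (fun f => f i)).
  exact: initial_continuous.
exact: continuous_proj.
Qed.

Lemma continuous_mag (Y : topologicalType) (f : Y -> mag) :
  (forall i, continuous (fun t : Y => mv (f t) i)) -> continuous f.
Proof.
move=> cf; apply: (@continuous_initial _ _ _ (mv : mag -> prod_topology (fun _ : nat => (I : topologicalType))) f).
by apply: (@continuous_prod nat (fun=> I) Y) => n; exact: cf.
Qed.

Lemma delta_continuous (Y : topologicalType) (f : nat -> Y -> I) :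
  (forall i, continuous (f i)) -> continuous (fun t => delta (fun i => f i t)).
Proof.
move=> cf; apply: (@continuous_sumr _ _ (fun i t => X i * f i t)) => i.
by apply: continuousMr => //; exact: cst_continuous.
Qed.

Lemma magu_continuous : continuous magu.
Proof.
apply: continuousDr; first exact: cst_continuous.
by apply: (delta_continuous (f := fun i g => mv g i)) => i; exact: mv_continuous.
Qed.

Lemma mag_mul_continuous : continuous (fun gh : mag * mag => (gh.1 * gh.2)%g).
Proof.
have c1 i : continuous (fun gh : mag * mag => mv gh.1 i).
  by move=> gh; apply: (@continuous_comp _ _ _ fst (fun g => mv g i)); [exact: cvg_fst|exact: mv_continuous].
have c2 i : continuous (fun gh : mag * mag => mv gh.2 i).
  by move=> gh; apply: (@continuous_comp _ _ _ snd (fun g => mv g i)); [exact: cvg_snd|exact: mv_continuous].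
have c3 : continuous (fun gh : mag * mag => magu gh.2).
  by move=> gh; apply: (@continuous_comp _ _ _ snd magu); [exact: cvg_snd|exact: magu_continuous].
apply: continuous_mag => i.
by apply: (@continuousDr _ _ (fun gh => mv gh.1 i * magu gh.2) (fun gh => mv gh.2 i)) => //; exact: continuousMr.
Qed.

Lemma mag_profin : profin_space mag.
Proof.
have pX := @profin_prod nat (fun=> (I : topologicalType)) (fun=> pL).
have [cX hX zX] := pX; have [_ hL _] := pL; split.
- apply: initial_compact.
  apply: (subclosed_compact _ cX) => //.
  pose V := prod_topology (fun _ : nat => (I : topologicalType)).
  have cv i : continuous (fun v : V => v i) by exact: (@continuous_proj nat (fun=> I)).
  rewrite (_ : range mv = [set v : V | forall i, (d <= i)%N -> [set v : V | [set 0] (v i)] v] `&`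
      [set v : V | units d (1 + delta v)]).
    apply: closedI.
      apply: closed_forall => i _.
      by apply: (@closed_preimage V I (fun v => v i) [set 0]) => //; exact: hausdorff_closed1.
    apply: (@closed_preimage V I (fun v => 1 + delta v) (@units k d I d)); last exact: closed_units.
    apply: continuousDr; first exact: cst_continuous.
    exact: (@delta_continuous V (fun i v => v i)).
  apply/seteqP; split => [_ [g _ <-]|v vP]; first exact: (mvP g).
  by exists (@Mag v vP).
- by apply: initial_hausdorff => //; exact: mv_inj.
- by apply: initial_zero_dimensional => //; exact: mv_inj.
Qed.

(* The graph of inversion is closed and [mag] is compact. *)
Lemma mag_inv_continuous : continuous (fun g : mag => (g^-1)%g).
Proof.
have [cM hM _] := mag_profin.
apply/continuous_closedP => K cK.
have -> : (fun g : mag => (g^-1)%g) @^-1` K =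
    fst @` ([set gh : mag * mag | [set 1%g] (gh.1 * gh.2)%g] `&` [set gh : mag * mag | K gh.2]).
  apply/seteqP; split => [g Kg|_ [[g h] [/= E Kh] <-]].
    by exists (g, g^-1%g) => //; split => //=; exact: mulgV.
  by rewrite /preimage /= (mulg1_eq E).
apply: compact_closed => //; apply: continuous_compact.
  by apply: continuous_subspaceT => gh; exact: cvg_fst.
have cMM : compact [set: mag * mag] by rewrite -setXTT; exact: compact_setX.
apply: (subclosed_compact _ cMM) => //; apply: closedI.
  by apply: closed_preimage; [exact: mag_mul_continuous|exact: hausdorff_closed1].
by apply: closed_preimage => // gh; exact: cvg_snd.
Qed.

HB.instance Definition _ := isTopologicalGroup.Build mag
  mag_mul_continuous mag_inv_continuous.

End Magnus.

(** * Koszul relations *)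

Section Koszul.
Variables (k d : nat) (I : iwasawa k d).
Local Notation X := (@iwX _ _ I).
Local Notation c := (@iwc _ _ I).
Local Notation dl := (@iwdl _ _ I).
Let iw : is_iwasawa d X c dl := iwP I.
Local Notation D := (@delta k d I).

(** Induction on the length: regularity puts the last coefficient [t r] into the ideal of the
    earlier variables, and absorbing it into the other coefficients leaves a shorter syzygy. *)
Lemma koszul r (t : nat -> I) : (r <= d)%N -> \sum_(i < r) X i * t i = 0 ->
  exists s : nat -> nat -> I, [/\ forall i j, s i j = - s j i, forall i, s i i = 0 &
    forall i, (i < r)%N -> t i = \sum_(j < r) X j * s i j].
Proof.
elim: r t => [|r IH] t rd.
  by exists (fun _ _ => 0); split => // i j; rewrite oppr0.
rewrite big_ord_recr /= => E.
have [h hE] : exists h : nat -> I, t r = \sum_(i < r) X i * h i.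
  apply: (iw_reg iw rd (g := fun i => - t i)).
  apply: (addrI (\sum_(i < r) X i * t i)); rewrite E -big_split big1 // => i _.
  by rewrite mulrN /= subrr.
have [|s [sN s0 sE]] := IH (fun i => t i + X r * h i) (ltnW rd).
  rewrite -[RHS]E hE mulr_sumr -big_split; apply: eq_bigr => i _ /=.
  by rewrite mulrDr mulrCA.
(* The antisymmetric matrix of the shorter syzygy is bordered by [h] in row [r] and by its opposite
   in column [r]. *)
exists (fun i j => if i == r then (if j == r then 0 else h j)
                   else if j == r then - h i else s i j); split.
- by move=> i j; case: eqP => _; case: eqP => _ //; rewrite ?oppr0 ?opprK.
- by move=> i; case: eqP => _.
move=> i; rewrite ltnS leq_eqVlt => /orP[/eqP ->|ir]; rewrite big_ord_recr /= eqxx.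
  by rewrite mulr0 addr0 hE; apply: eq_bigr => j _; rewrite ltn_eqF.
rewrite (ltn_eqF ir) mulrN; apply: (addIr (X r * h i)); rewrite subrK sE //.
by apply: eq_bigr => j _; rewrite ltn_eqF.
Qed.

(** These are the vectors of the elements with [magu] equal to 1, on which the Magnus product is
    addition. *)
Definition Kvec (v : nat -> I) : Prop := (forall i, (d <= i)%N -> v i = 0) /\ D v = 0.

(** The vectors of [Dset]: for [a] in [Acen], the commutator with the [i]-th generator multiplies
    the vector of [a] by [X i]. *)
Definition Dvec r (v : nat -> I) : Prop :=
  exists b : nat -> nat -> I, (forall i, (i < r)%N -> Kvec (b i)) /\
    forall l, v l = \sum_(i < r) X i * b i l.

Lemma Kvec0 : Kvec (fun=> 0).
Proof. by split => //; rewrite /delta big1 // => i _; rewrite mulr0. Qed.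

Lemma KvecD v w : Kvec v -> Kvec w -> Kvec (fun l => v l + w l).
Proof.
move=> [v0 vD] [w0 wD]; split; first by move=> i di; rewrite v0 // w0 // addr0.
by rewrite deltaD vD wD addr0.
Qed.

Lemma KvecM f v : Kvec v -> Kvec (fun l => v l * f).
Proof.
move=> [v0 vD]; split; first by move=> i di; rewrite v0 // mul0r.
by rewrite deltaM vD mul0r.
Qed.

(** The constant term of [v i] is the coefficient of [X i] in [D v]. *)
Lemma Kvec_c v i : Kvec v -> c (v i) = 0.
Proof.
move=> [v0 vD]; case: (ltnP i d) => [id|di]; last by rewrite v0 // (iwc0 I).
by rewrite -(iwdl_lin v id) -/(delta v) vD (iwdl0 I).
Qed.

Lemma Dvec0 r : Dvec r (fun=> 0).
Proof.
exists (fun _ _ => 0); split; first by move=> i _; exact: Kvec0.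
by move=> l; rewrite big1 // => i _; rewrite mulr0.
Qed.

Lemma DvecD r v w : Dvec r v -> Dvec r w -> Dvec r (fun l => v l + w l).
Proof.
move=> [a [Ka va]] [b [Kb wb]]; exists (fun i l => a i l + b i l); split.
  by move=> i ir; apply: KvecD; [exact: Ka|exact: Kb].
by move=> l; rewrite va wb -big_split; apply: eq_bigr => i _; rewrite mulrDr.
Qed.

Lemma DvecM r f v : Dvec r v -> Dvec r (fun l => v l * f).
Proof.
move=> [a [Ka va]]; exists (fun i l => a i l * f); split.
  by move=> i ir; apply: KvecM; exact: Ka.
by move=> l; rewrite va mulr_suml; apply: eq_bigr => i _; rewrite mulrA.
Qed.

Lemma Dvec_ext r v w : (forall l, v l = w l) -> Dvec r v -> Dvec r w.
Proof. by move=> /funext ->. Qed.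

Lemma Dvec_sum r (F : nat -> nat -> I) n : (forall i, (i < n)%N -> Dvec r (F i)) ->
  Dvec r (fun l => \sum_(i < n) F i l).
Proof.
elim: n => [|n IH] DF; first by apply: Dvec_ext (Dvec0 r) => l; rewrite big_ord0.
apply: (@Dvec_ext _ (fun l => \sum_(i < n) F i l + F n l)).
  by move=> l; rewrite big_ord_recr.
by apply: DvecD; [apply: IH => i /ltnW|]; exact: DF.
Qed.

Lemma Dvec_gen r i v : (i < r)%N -> Kvec v -> Dvec r (fun l => X i * v l).
Proof.
move=> ir Kv; exists (fun j => if j == i then v else (fun=> 0)); split.
  by move=> j _; case: ifP => _; [exact: Kv|exact: Kvec0].
move=> l; rewrite (sum_single (F := fun j => X j * (if j == i then v else (fun=> 0)) l) ir) ?eqxx //.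
by move=> j /negbTE ->; rewrite mulr0.
Qed.

(** The Koszul syzygy between [X i] and [X j], which is also the Magnus vector of the commutator of
    the generators [i] and [j]. *)
Definition cvec i j : nat -> I := fun l => (l == i)%:R * X j - (l == j)%:R * X i.

Lemma Kvec_cvec i j : (i < d)%N -> (j < d)%N -> Kvec (cvec i j).
Proof.
move=> id jd; split.
  by move=> l dl'; rewrite /cvec !gtn_eqF ?(leq_trans _ dl') // !mul0r subrr.
have single m f : (m < d)%N -> delta (fun l => (l == m)%:R * f) = X m * f.
  move=> md; rewrite -(delta_single f md); apply: eq_delta => l _.
  by case: eqP; rewrite ?mul1r ?mul0r.
rewrite /cvec (deltaD (fun l => (l == i)%:R * X j) (fun l => - ((l == j)%:R * X i))).
by rewrite (deltaN (fun l => (l == j)%:R * X i)) !single // mulrC subrr.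
Qed.

(** The Koszul relation [X_m c_ij = X_j c_im - X_i c_jm], the linear form of the Jacobi identity,
    trades a factor [X m] with arbitrary [m] for factors of index below [r]. *)
Lemma Dvec_Xcvec r i j m : (r <= d)%N -> (i < r)%N -> (j < r)%N -> (m < d)%N ->
  Dvec r (fun l => cvec i j l * X m).
Proof.
move=> rd ir jr md; have id := leq_trans ir rd; have jd := leq_trans jr rd.
apply: (@Dvec_ext _ (fun l => X j * cvec i m l + (X i * cvec j m l) * - 1)); last first.
  apply: DvecD; first by apply: Dvec_gen => //; exact: Kvec_cvec.
  by apply: DvecM; apply: Dvec_gen => //; exact: Kvec_cvec.
by move=> l; rewrite /cvec; ring.
Qed.

Lemma Dvec_cvec r i j f : (r <= d)%N -> (i < r)%N -> (j < r)%N -> c f = 0 ->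
  Dvec r (fun l => cvec i j l * f).
Proof.
move=> rd ir jr /(iw_aug iw) [g ->].
apply: (@Dvec_ext _ (fun l => \sum_(m < d) cvec i j l * X m * g m)).
  by move=> l; rewrite mulr_sumr; apply: eq_bigr => m _; rewrite mulrA.
apply: (@Dvec_sum r (fun m l => cvec i j l * X m * g m)) => m md.
by apply: DvecM; exact: Dvec_Xcvec.
Qed.

Lemma antisym_cvec r (s : nat -> nat -> I) l :
  (forall i j, s i j = - s j i) -> (forall i, s i i = 0) ->
  \sum_(i < r) X i * (if (l < r)%N then s i l else 0) =
  \sum_(j < r) \sum_(i < j) cvec i j l * - s i j.
Proof.
move=> sN s0; elim: r => [|r IH]; first by rewrite !big_ord0.
rewrite [in RHS]big_ord_recr /= -IH.
have E : \sum_(i < r) cvec i r l * - s i r =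
    (if (l < r)%N then X r * s r l else 0) + (if l == r then \sum_(i < r) X i * s i r else 0).
  case: (ltngtP l r) => lr.
  - rewrite addr0 (sum_single (F := fun i => cvec i r l * - s i r) lr).
      by rewrite /cvec eqxx (ltn_eqF lr) mul1r mul0r subr0 -sN mulrC; congr (_ * _).
    by move=> i il; rewrite /cvec eq_sym (negbTE il) (ltn_eqF lr) !mul0r subrr mul0r.
  - rewrite addr0 big1 // => i _; rewrite /cvec (gtn_eqF lr) (gtn_eqF (ltn_trans (ltn_ord i) lr)).
    by rewrite !mul0r subrr mul0r.
  - rewrite add0r; apply: eq_bigr => i _.
    by rewrite /cvec lr eqxx (gtn_eqF (ltn_ord i)) mul0r mul1r sub0r mulrNN.
rewrite E big_ord_recr /= ltnS leq_eqVlt orbC.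
case: (ltngtP l r) => lr /=.
- by rewrite addr0.
- by rewrite mulr0 !addr0 !big1 // => i _; rewrite mulr0.
- rewrite lr s0 mulr0 addr0 add0r [X in _ = X + _]big1 ?add0r // => i _.
  by rewrite mulr0.
Qed.

(* The syzygies of X_0, ..., X_(r-1) are the trivial ones. *)
Lemma Kvec_decomp r v : (r <= d)%N -> Kvec v ->
  (forall l, exists h : nat -> I, v l = \sum_(i < r) X i * h i) ->
  exists s : nat -> nat -> I,
    forall f : nat -> nat -> I,
    (forall j i, (j < r)%N -> (i < j)%N -> c (f j i) = c (s j i)) ->
    Dvec r (fun l => v l - \sum_(j < r) \sum_(i < j) cvec i j l * f j i).
Proof.
move=> rd [v0 vD] H.
have /choice[w Hw] : forall l, exists h : nat -> I, ((d <= l)%N -> forall i, h i = 0) /\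
    v l = \sum_(i < r) X i * h i.
  move=> l; case: (ltnP l d) => [ld|dl'].
    by have [h hE] := H l; exists h.
  by exists (fun=> 0); rewrite v0 // big1 // => i _; rewrite mulr0.
(* Applying [D] to the expansion of [v] gives a syzygy with coefficients [t i]. Subtracting its
   Koszul matrix [s] from [w] makes the columns lie in [Kvec]; what was subtracted is a combination
   of the [cvec], where only constant terms count modulo [Dvec r]. *)
pose t i := D (fun l => w l i).
have [|s [sN s0 sE]] := @koszul r t rd.
  rewrite -[RHS]vD (@eq_delta _ _ _ v (fun l => \sum_(i < r) X i * w l i)); last first.
    by move=> l _; have [_ ->] := Hw l.
  rewrite (delta_sum (fun i l => X i * w l i)); apply: eq_bigr => i _.
  by rewrite mulrC -deltaM; apply: eq_delta => l _; rewrite mulrC.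
exists (fun j i => - s i j) => f fs.
apply: (@Dvec_ext _ (fun l => \sum_(i < r) X i * (w l i - (if (l < r)%N then s i l else 0)) +
   \sum_(j < r) \sum_(i < j) cvec i j l * (- s i j - f j i))).
  move=> l; have [_ ->] := Hw l.
  under [X in _ + X]eq_bigr => j _.
    under eq_bigr do rewrite mulrBr.
    rewrite sumrB; over.
  rewrite [X in _ + X]sumrB -(antisym_cvec r l sN s0) addrA; congr (_ - _).
  by rewrite -big_split; apply: eq_bigr => i _ /=; rewrite -mulrDr subrK.
apply: DvecD.
  apply: (@Dvec_sum r (fun i l => X i * (w l i - (if (l < r)%N then s i l else 0)))) => i ir.
  apply: (Dvec_gen ir (v := fun l => w l i - (if (l < r)%N then s i l else 0))); split.
    move=> l dl'; have [-> //] := Hw l; rewrite ltnNge (leq_trans rd dl') /=.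
    by rewrite subrr.
  rewrite (deltaD (fun l => w l i) (fun l => - (if (l < r)%N then s i l else 0))).
  rewrite deltaN -/(t i) sE //.
  rewrite /delta (big_ord_widen d (fun j => X j * s i j) rd) [X in X - _]big_mkcond -sumrB.
  by rewrite big1 // => l _; case: ifP => _; rewrite ?mulr0 subrr.
apply: (@Dvec_sum r (fun j l => \sum_(i < j) cvec i j l * (- s i j - f j i))) => j jr.
apply: (@Dvec_sum r (fun i l => cvec i j l * (- s i j - f j i))) => i ij.
apply: Dvec_cvec => //; first exact: ltn_trans ij jr.
by rewrite (iw_cD iw) (iwcN (f j i)) fs // subrr.
Qed.

End Koszul.

(** * The Magnus group satisfies the axioms *)

Section MagnusModel.
Variables (k d : nat) (I : iwasawa k d).
Local Notation X := (@iwX _ _ I).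
Local Notation c := (@iwc _ _ I).
Local Notation dl := (@iwdl _ _ I).
Local Notation q := k.+2.
Let iw : is_iwasawa d X c dl := iwP I.
Let pq : prime q := iw_prime I.
Let d1 : (1 < d)%N := iw_gt1 I.
Let d0 : (0 < d)%N := ltnW d1.

Implicit Types g h a b : mag I.

Lemma mvM g h i : mv (g * h)%g i = mv g i * magu h + mv h i. Proof. by []. Qed.

Lemma mv1 i : mv (1%g : mag I) i = 0. Proof. by []. Qed.

Lemma maguM g h : magu (g * h)%g = magu g * magu h. Proof. exact: magu_mul. Qed.

Lemma magu1 : magu (1%g : mag I) = 1. Proof. exact: magu_one. Qed.

Lemma magu_unit g f : magu g * f = magu g -> f = 1.
Proof.
have E : magu (g^-1)%g * magu g = 1 by rewrite -maguM mulVg magu1.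
by move=> H; rewrite -[LHS]mul1r -E -mulrA H.
Qed.

Lemma magu_comm g h : magu [~ g, h]%g = 1.
Proof.
apply: (@magu_unit (h * g)%g); rewrite -maguM -commgC !maguM.
by rewrite mulrC.
Qed.

Lemma mv_comm g h i : mv [~ g, h]%g i = mv g i * (magu h - 1) - mv h i * (magu g - 1).
Proof.
have := mvM (h * g)%g [~ g, h]%g i; rewrite -commgC magu_comm mulr1 => E.
rewrite -[LHS](addKr (mv (h * g)%g i)) -E !mvM.
by ring.
Qed.

Lemma mv_commK a g i : magu a = 1 -> mv [~ a, g]%g i = mv a i * (magu g - 1).
Proof. by move=> a1; rewrite mv_comm a1 subrr mulr0 subr0. Qed.

Lemma magu1_delta g : magu g = 1 <-> delta (mv g) = 0.
Proof.
rewrite maguE; split => [E|->]; last by rewrite addr0.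
by apply: (addrI 1); rewrite E addr0.
Qed.

Lemma magu_Kvec g : magu g = 1 <-> Kvec (mv g).
Proof.
rewrite magu1_delta; split => [E|[]//]; split => //.
by have [] := mvP g.
Qed.

Lemma Kvec_mag v : Kvec v -> exists2 a : mag I, magu a = 1 & forall i, mv a i = v i.
Proof.
move=> [v0 vD].
have vP : (forall i, (d <= i)%N -> v i = 0) /\ units d (1 + delta v).
  by split => //; rewrite vD addr0; exact: units1.
by exists (Mag vP) => //; apply/magu1_delta.
Qed.

Lemma xmagP i : (forall j, (d <= j)%N -> (if (j == i) && (i < d)%N then 1 else 0 : I) = 0) /\
  units d (1 + delta (fun j => if (j == i) && (i < d)%N then 1 else 0 : I)).
Proof.
split => [j dj|].
  by case: eqP => [<-|//]; rewrite ltnNge dj.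
case: (ltnP i d) => id.
  rewrite (@eq_delta _ _ _ _ (fun j => if j == i then 1 else 0)) => [|j _]; last by rewrite andbT.
  rewrite (delta_single _ id) mulr1; apply: (units_single id).
  by have := @unitX_gen _ _ I i 1%N; rewrite expr1.
rewrite (_ : delta _ = 0) ?addr0; first exact: units1.
by rewrite /delta big1 // => j _; rewrite andbF mulr0.
Qed.

Definition xmag i : mag I := Mag (xmagP i).

Lemma mv_xmag i j : (i < d)%N -> mv (xmag i) j = (j == i)%:R.
Proof. by move=> id; rewrite /= id andbT; case: eqP. Qed.

Lemma magu_xmag i : (i < d)%N -> magu (xmag i) = 1 + X i.
Proof.
move=> id; rewrite maguE (@eq_delta _ _ _ _ (fun j => if j == i then 1 else 0)).
  by rewrite (delta_single _ id) mulr1.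
by move=> j _; rewrite mv_xmag //; case: eqP.
Qed.

Lemma mulXr_eq0 i f : (i < d)%N -> f * X i = 0 -> f = 0.
Proof. by move=> id; rewrite mulrC; exact: (iw_nzX iw). Qed.

(** Coordinate 1 of the commutator of [[x_0, x_1]] with [g] is [- X_0 (u - 1)], where [u = magu g],
    and [X_0] is no zero divisor. *)
Lemma AcenP g : Acen xmag g <-> magu g = 1.
Proof.
have c1 : magu [~ xmag 0%N, xmag 1%N]%g = 1 by exact: magu_comm.
split=> [/= gc|g1].
  have : [~ [~ xmag 0%N, xmag 1%N], g]%g = 1%g by apply/eqP/commgP; exact/esym.
  move=> /(congr1 (fun g => mv g 1%N)); rewrite mv1 mv_commK // mv_comm !mv_xmag // !magu_xmag //.
  rewrite mul0r mul1r sub0r [1 + X 0%N - 1]addrC addKr mulNr => /eqP; rewrite oppr_eq0 => /eqP.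
  by move=> /(iw_nzX iw d0) /eqP; rewrite subr_eq0 => /eqP.
apply/commgP/eqP; apply: magP => i id.
by rewrite mv_comm g1 c1 subrr !mulr0 subrr.
Qed.

(** Coordinate [j] of [[~ g, xmag i]] is [mv g j * X i] for [j] other than [i]; the coordinate [i]
    then takes care of itself. *)
Lemma CxP i g : (i < d)%N -> Cx xmag i g <-> forall j, j != i -> mv g j = 0.
Proof.
move=> id; split=> [gx j ji|g0].
  have : [~ g, xmag i]%g = 1%g by apply/eqP/commgP.
  move=> /(congr1 (fun g => mv g j)); rewrite mv1 mv_comm mv_xmag // (negbTE ji) mul0r subr0.
  by rewrite magu_xmag // [1 + X i - 1]addrC addKr => /(mulXr_eq0 id).
apply/commgP/eqP; apply: magP => j jd; rewrite mv1 mv_comm mv_xmag // magu_xmag //.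
have -> : magu g - 1 = X i * mv g i.
  rewrite maguE [1 + _ - 1]addrC addKr -(delta_single _ id); apply: eq_delta => l _.
  by case: eqP => [->//|/eqP /g0].
case: eqVneq => [->|/g0 ->]; last by rewrite !mul0r subrr.
by rewrite mul1r [1 + X i - 1]addrC addKr mulrC subrr.
Qed.

Lemma Cx_magu i g : (i < d)%N -> Cx xmag i g -> magu g = 1 + X i * mv g i.
Proof.
move=> id /(CxP _ id) g0; rewrite maguE -(delta_single _ id); congr (_ + _).
by apply: eq_delta => l _; case: eqP => [->//|/eqP /g0].
Qed.

(** [magu g = 1 + X i * mv g i] has no linear term in the other [X j], so the factors of [magu g]
    with index other than [i] are trivial. *)
Lemma Cx_unitX i g : (i < d)%N -> Cx xmag i g -> unitX i (magu g).
Proof.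
move=> id Cg; have E := Cx_magu id Cg.
have [_ [s [Us sE]]] := mvP g; rewrite -maguE in sE.
have s1 j : (j < d)%N -> j != i -> s j = 1.
  move=> jd ji; apply: (unitX_dl0 jd); first exact: Us.
  rewrite -(dl_units (leqnn d) jd Us) -sE E (iw_dlD iw) (iwdl1 I) add0r iwdlXM // eq_sym.
  by rewrite (negbTE ji) mul0r.
rewrite sE (bigD1 (Ordinal id)) //= big1 ?mulr1; first exact: Us.
by move=> j ji; apply: s1 => //; apply: contra ji => /eqP ji; apply/eqP/val_inj.
Qed.

Lemma dl_Cx i g : (i < d)%N -> Cx xmag i g -> dl i (magu g) = c (mv g i).
Proof.
move=> id Cg; rewrite (Cx_magu id Cg) (iw_dlD iw) (iwdl1 I) add0r iwdlXM //.
by rewrite eqxx mul1r.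
Qed.

Lemma Cx_magu_inj i g h : (i < d)%N -> Cx xmag i g -> Cx xmag i h -> magu g = magu h -> g = h.
Proof.
move=> id Cg Ch E; apply: magP => j jd.
move: E; rewrite (Cx_magu id Cg) (Cx_magu id Ch) => /addrI E.
have {}E : mv g i = mv h i.
  by apply/eqP; rewrite -subr_eq0; apply/eqP/(iw_nzX iw id); rewrite mulrBr E subrr.
move/(CxP _ id) in Cg; move/(CxP _ id) in Ch.
by case: (eqVneq j i) => [->//|ji]; rewrite Cg // Ch.
Qed.

(** [c (mv g i)] is the exponent of [g] as a p-adic power of [xmag i]. With [Cx_of] and [Cx_cM] it
    identifies the centralizer with Z_q. *)
Lemma Cx_inj i g h : (i < d)%N -> Cx xmag i g -> Cx xmag i h -> c (mv g i) = c (mv h i) -> g = h.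
Proof.
move=> id Cg Ch E; apply: (Cx_magu_inj id Cg Ch).
by apply: (unitX_inj id); [exact: Cx_unitX|exact: Cx_unitX|rewrite !dl_Cx].
Qed.

Lemma Cx_eq1 i g : (i < d)%N -> Cx xmag i g -> c (mv g i) = 0 -> g = 1%g.
Proof.
move=> id Cg g0; apply: (Cx_inj id Cg); first by case: (subgrp_cen (xmag i)).
by rewrite mv1 g0 (iwc0 I).
Qed.

Lemma Cx_ofu i u : (i < d)%N -> unitX i u -> exists2 g, Cx xmag i g & magu g = u.
Proof.
move=> id Uu; have [f fE] := unitX_principal Uu.
have vP : (forall j, (d <= j)%N -> (if j == i then f else 0) = 0) /\
    units d (1 + delta (fun j => if j == i then f else 0)).
  split=> [j dj|]; first by rewrite gtn_eqF // (leq_trans id).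
  by rewrite (delta_single _ id) -fE; exact: units_single Uu.
exists (Mag vP).
  by apply/(CxP _ id) => j ji; rewrite /= (negbTE ji).
by rewrite maguE /= (delta_single _ id) fE.
Qed.

Lemma Cx_of i l : (i < d)%N -> exists2 g, Cx xmag i g & c (mv g i) = l.
Proof.
move=> id; have [u Uu <-] := unitX_dl_surj I l id.
by have [g Cg <-] := Cx_ofu id Uu; exists g => //; rewrite dl_Cx.
Qed.

Lemma Cx_cM i g h : (i < d)%N -> Cx xmag i g -> Cx xmag i h ->
  c (mv (g * h)%g i) = c (mv g i) + c (mv h i).
Proof.
move=> id Cg Ch; rewrite mvM (iw_cD iw) (iw_cM iw).
by rewrite (unitX_c id (Cx_unitX id Ch)) mulr1.
Qed.

Lemma Cx_cX i g n : (i < d)%N -> Cx xmag i g -> c (mv (g ^+ n)%g i) = n%:R * c (mv g i).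
Proof.
move=> id Cg; elim: n => [|n IH]; first by rewrite expg0 mv1 (iwc0 I) mul0r.
rewrite expgS Cx_cM // ?IH; last exact: (subgrpX n (subgrp_cen (xmag i)) Cg).
by rewrite mulrS mulrDl mul1r.
Qed.

Lemma xmag_c i : (i < d)%N -> c (mv (xmag i) i) = 1.
Proof. by move=> id; rewrite mv_xmag // eqxx (iw_c1 iw). Qed.

Lemma mv_prodK (E : nat -> mag I) n l : (forall i, magu (E i) = 1) ->
  magu (\prod_(i < n) E i)%g = 1 /\ mv (\prod_(i < n) E i)%g l = \sum_(i < n) mv (E i) l.
Proof.
move=> E1; elim: n => [|n [IH1 IH2]]; first by rewrite !big_ord0 magu1 mv1.
by rewrite !big_ord_recr maguM IH1 mvM E1 IH2 !mulr1.
Qed.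

Lemma magu_prod (E : nat -> mag I) n :
  magu (\prod_(i < n) E i)%g = \prod_(i < n) magu (E i).
Proof. by elim: n => [|n IH]; rewrite ?big_ord0 ?magu1 // !big_ord_recr maguM IH. Qed.

Lemma DsetP r z : (r <= d)%N -> Dset (Acen xmag) xmag r z <-> Dvec r (mv z).
Proof.
move=> rd; split=> [[a [Aa ->]]|[b [Kb zE]]].
  exists (fun i => mv (a i)); split.
    by move=> i ir; apply/magu_Kvec/AcenP; exact: Aa.
  move=> l; have [_ ->] := mv_prodK r l (fun i => magu_comm (a i) (xmag i)).
  apply: eq_bigr => i _; rewrite mv_commK; last by apply/AcenP; exact: Aa.
  rewrite magu_xmag ?(leq_trans (ltn_ord i)) // [1 + _ - 1]addrC addKr mulrC.
  by [].
have /choice[a Ha] : forall i, exists a, (i < r)%N -> magu a = 1 /\ forall l, mv a l = b i l.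
  move=> i; case: (ltnP i r) => [/Kb /Kvec_mag [a a1 aE]|_]; last by exists 1%g.
  by exists a.
exists a; split.
  by move=> i ir; apply/AcenP; have [] := Ha i ir.
apply: magP => l _; have [_ ->] := mv_prodK r l (fun i => magu_comm (a i) (xmag i)).
rewrite zE; apply: eq_bigr => i _; have [a1 aE] := Ha i (ltn_ord i).
by rewrite mv_commK // aE magu_xmag ?(leq_trans (ltn_ord i)) // [1 + _ - 1]addrC addKr mulrC.
Qed.

Lemma mv_comm_CC i j g h l : (i < d)%N -> (j < d)%N -> Cx xmag i g -> Cx xmag j h ->
  mv [~ g, h]%g l = cvec I i j l * (mv g i * mv h j).
Proof.
move=> id jd Cg Ch; rewrite mv_comm (Cx_magu id Cg) (Cx_magu jd Ch).
rewrite ![1 + _ - 1]addrC !addKr /cvec.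
have gl : mv g l = (l == i)%:R * mv g i.
  by case: eqVneq => [->|li]; rewrite ?mul1r // mul0r; move/(CxP _ id): Cg => ->.
have hl : mv h l = (l == j)%:R * mv h j.
  by case: eqVneq => [->|lj]; rewrite ?mul1r // mul0r; move/(CxP _ jd): Ch => ->.
by rewrite gl hl; ring.
Qed.

Lemma mv_comm_Cx i j g l : (i < d)%N -> (j < d)%N -> Cx xmag i g ->
  mv [~ g, xmag j]%g l = cvec I i j l * mv g i.
Proof.
move=> id jd Cg; rewrite (mv_comm_CC l id jd Cg (_ : Cx xmag j (xmag j))) //.
by rewrite mv_xmag // eqxx mulr1.
Qed.

Lemma mv_comm2 (g : nat -> nat -> mag I) r l : (r <= d)%N ->
  (forall j i, (j < r)%N -> (i < j)%N -> Cx xmag i (g j i)) ->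
  mv (\prod_(j < r) \prod_(i < j) [~ g j i, xmag j])%g l =
  \sum_(j < r) \sum_(i < j) cvec I i j l * mv (g j i) i.
Proof.
move=> rd Cg; have K1 j l' := @mv_prodK (fun i => [~ g j i, xmag j]%g) j l' (fun i => magu_comm (g j i) (xmag j)).
have [_ ->] := @mv_prodK (fun j => \prod_(i < j) [~ g j i, xmag j])%g r l (fun j => proj1 (K1 j l)).
apply: eq_bigr => j _; have [_ ->] := K1 j l.
apply: eq_bigr => i _; have jd := leq_trans (ltn_ord j) rd.
by apply: mv_comm_Cx => //; [exact: ltn_trans (ltn_ord i) jd|exact: Cg].
Qed.

Lemma magu_comm2 (g : nat -> nat -> mag I) r :
  magu (\prod_(j < r) \prod_(i < j) [~ g j i, xmag j])%g = 1.
Proof.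
have K1 j := @mv_prodK (fun i => [~ g j i, xmag j]%g) j 0%N (fun i => magu_comm (g j i) (xmag j)).
by have [] := @mv_prodK (fun j => \prod_(i < j) [~ g j i, xmag j])%g r 0%N (fun j => proj1 (K1 j)).
Qed.

Lemma mvV_K a l : magu a = 1 -> mv (a^-1)%g l = - mv a l.
Proof.
move=> a1; have := mvM (a^-1)%g a l; rewrite mulVg mv1 a1 mulr1 => E.
by apply: (addIr (mv a l)); rewrite -E addNr.
Qed.

(** [Kvec_decomp] only prescribes constant terms, and every constant term is the exponent of some
    element of the centralizer. Serves [ax_span] with [r = d] and [ax_reg] in general. *)
Lemma span_of_ideal r a : (r <= d)%N -> magu a = 1 ->
  (forall l, exists h : nat -> I, mv a l = \sum_(i < r) X i * h i) ->
  mulset (Dset (Acen xmag) xmag r) (Lset (Cx xmag) xmag r) a.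
Proof.
move=> rd a1 H; have [s Hs] := Kvec_decomp rd ((magu_Kvec a).1 a1) H.
have /choice[g Hg] : forall j, exists g : nat -> mag I, forall i, (j < r)%N -> (i < j)%N ->
    Cx xmag i (g i) /\ c (mv (g i) i) = c (s j i).
  move=> j; suff /choice[g Hg] : forall i, exists g, (j < r)%N -> (i < j)%N ->
      Cx xmag i g /\ c (mv g i) = c (s j i) by exists g.
  move=> i; case: (ltnP j r) => jr; last by exists 1%g.
  case: (ltnP i j) => ij; last by exists 1%g.
  have [g Cg gE] := Cx_of (c (s j i)) (ltn_trans ij (leq_trans jr rd)).
  by exists g.
have Cg j i : (j < r)%N -> (i < j)%N -> Cx xmag i (g j i).
  by move=> jr ij; have [] := Hg j i jr ij.
have := Hs (fun j i => mv (g j i) i).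
set z := (\prod_(j < r) \prod_(i < j) [~ g j i, xmag j])%g => Dz.
have z1 : magu z = 1 by exact: magu_comm2.
exists (a * z^-1)%g, z; split; last by rewrite mulgVK.
  apply/(DsetP _ rd); apply: Dvec_ext (Dz _) => [l|j i jr ij].
    rewrite mvM (mvV_K _ z1) mv_comm2 //.
    by rewrite (_ : magu _ = 1) ?mulr1 //; apply: (@magu_unit z); rewrite -maguM mulgV magu1 z1.
  by have [] := Hg j i jr ij.
by exists g.
Qed.

(** Entries of [Kvec] lie in the augmentation ideal, so those of [Dvec d] lie in its square. *)
Lemma dl_Dvec v i j : Dvec d v -> (j < d)%N -> dl j (v i) = 0.
Proof.
move=> [b [Kb ->]] jd; rewrite (iwdl_lin (fun m => b m i) jd).
by apply: Kvec_c; exact: Kb.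
Qed.

Lemma dl_cvec i j f : (i < d)%N -> (j < d)%N -> i != j -> dl j (cvec I i j i * f) = c f.
Proof.
move=> id jd ij; rewrite /cvec eqxx (negbTE ij) mul1r mul0r subr0.
by rewrite iwdlXM // eqxx mul1r.
Qed.

(** The coefficient of [X j] in coordinate [i] vanishes on [Dvec d], and on the double product it
    isolates the exponent of [g j i]. *)
Lemma mag_ax_free (g : nat -> nat -> mag I) :
  (forall j i, (j < d)%N -> (i < j)%N -> Cx xmag i (g j i)) ->
  Dset (Acen xmag) xmag d (\prod_(j < d) \prod_(i < j) [~ g j i, xmag j])%g ->
  forall j i, (j < d)%N -> (i < j)%N -> g j i = 1%g.
Proof.
move=> Cg /(DsetP _ (leqnn d)) Dz j i jd ij.
have id : (i < d)%N by exact: ltn_trans ij jd.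
apply: (Cx_eq1 id (Cg j i jd ij)).
have := dl_Dvec i Dz jd; rewrite mv_comm2 //.
rewrite (iwdl_sum j (fun j' => \sum_(i' < j') cvec I i' j' i * mv (g j' i') i')).
have E j' : (j' < d)%N -> dl j (\sum_(i' < j') cvec I i' j' i * mv (g j' i') i') =
    \sum_(i' < j') ((i == i')%:R * (j == j')%:R - (i == j')%:R * (j == i')%:R) * c (mv (g j' i') i').
  move=> j'd; rewrite (iwdl_sum j (fun i' => cvec I i' j' i * mv (g j' i') i')).
  apply: eq_bigr => i' _; rewrite /cvec mulrBl (iw_dlD iw) iwdlN mulrBl.
  have i'd : (i' < d)%N by exact: ltn_trans (ltn_ord i') j'd.
  have P (bb : bool) m f : (m < d)%N -> dl j (bb%:R * X m * f) = bb%:R * (j == m)%:R * c f.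
    move=> md; case: bb; last by rewrite !mul0r (iwdl0 I).
    by rewrite !mul1r iwdlXM // eq_sym.
  by rewrite !P.
rewrite (eq_bigr (fun j' : 'I_d => (fun j' => \sum_(i' < j') ((i == i')%:R * (j == j')%:R - (i == j')%:R * (j == i')%:R) * c (mv (g j' i') i')) (j' : nat))); last first.
  by move=> j' _; exact: E.
rewrite (sum_single (F := fun j' => \sum_(i' < j') ((i == i')%:R * (j == j')%:R - (i == j')%:R * (j == i')%:R) * c (mv (g j' i') i')) jd).
  rewrite eqxx (ltn_eqF ij).
  rewrite (sum_single (F := fun i' => ((i == i')%:R * 1 - 0 * (j == i')%:R) * c (mv (g j i') i')) ij).
    by rewrite eqxx mul1r mul0r subr0 mul1r.
  by move=> i'; rewrite eq_sym => /negbTE ->; rewrite !mul0r subrr mul0r.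
move=> j' j'j; rewrite big1 // => i' _; rewrite [j == j']eq_sym (negbTE j'j) mulr0.
case: (eqVneq i j') => [E'|_]; last by rewrite mul0r subrr mul0r.
rewrite gtn_eqF ?mulr0 ?subrr ?mul0r //; apply: ltn_trans ij.
by rewrite E'.
Qed.

Lemma eqm_Dset g h : magu g = 1 -> magu h = 1 ->
  eqm (Dset (Acen xmag) xmag d) g h <-> Dvec d (fun l => mv g l - mv h l).
Proof.
move=> g1 h1; rewrite /eqm (DsetP _ (leqnn d)).
have E l : mv (g * h^-1)%g l = mv g l - mv h l.
  rewrite mvM mvV_K // (_ : magu _ = 1) ?mulr1 //.
  by apply: (@magu_unit h); rewrite -maguM mulgV magu1 h1.
by split; apply: Dvec_ext.
Qed.

Lemma mag_ax_unit i : (i < d)%N -> forall j, (j < d)%N -> i <> j -> forall z h, Cx xmag i z -> Cx xmag j h ->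
  (forall y, Cx xmag i y -> z <> (y ^+ q)%g) ->
  exists2 h', Cx xmag j h' & eqm (Dset (Acen xmag) xmag d) [~ z, h']%g [~ xmag i, h]%g.
Proof.
move=> id j jd _ z h Cz Ch nz.
have [m mE] : exists m, c (mv z i) * m = 1.
  apply: padic_unit => // n zn; have [y Cy yn] := Cx_of n id.
  apply: (nz y Cy); apply: (Cx_inj id Cz); last by rewrite Cx_cX // yn.
  exact: (subgrpX q (subgrp_cen (xmag i)) Cy).
(* [m] inverts the exponent of [z], so both commutators have the same product of exponents and
   differ by an element of [Dvec d]. *)
have [h' Ch' hE] := Cx_of (m * c (mv h j)) jd.
exists h' => //; apply/eqm_Dset; [exact: magu_comm|exact: magu_comm|].
apply: (@Dvec_ext _ _ _ _ (fun l => cvec I i j l * (mv z i * mv h' j - mv h j))).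
  move=> l; rewrite (mv_comm_CC l id jd Cz Ch').
  rewrite (mv_comm_CC l id jd (_ : Cx xmag i (xmag i)) Ch) // mv_xmag // eqxx mul1r.
  by rewrite mulrBr.
apply: Dvec_cvec => //; rewrite (iw_cD iw) iwcN (iw_cM iw) hE mulrA mE mul1r.
by rewrite subrr.
Qed.

(** The exponent of [w] is that of [z] times that of [h], so [w] lies in the closure [P] of the
    powers of [z]. Each [[~ a, z ^+ n]] is some [[~ b, z]], and such commutators form a closed
    set. *)
Lemma mag_ax_dvd w z h : Cx xmag 0%N w -> Cx xmag 0%N z -> Cx xmag 1%N h ->
  eqm (Dset (Acen xmag) xmag d) [~ w, xmag 1%N]%g [~ z, h]%g ->
  forall a, Acen xmag a -> exists2 b, Acen xmag b & [~ a, w]%g = [~ b, z]%g.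
Proof.
move=> Cw Cz Ch /eqm_Dset E a Aa.
have {}E := E (magu_comm _ _) (magu_comm _ _).
have wE : c (mv w 0%N) = c (mv z 0%N) * c (mv h 1%N).
  have := dl_Dvec 0%N E d1.
  rewrite (mv_comm_Cx _ d0 d1 Cw) (mv_comm_CC _ d0 d1 Cz Ch) (iw_dlD iw) iwdlN !dl_cvec // (iw_cM iw).
  by move=> /eqP; rewrite subr_eq0 => /eqP.
have [cM hM zM] := mag_profin I.
have pA := padic_profin k; have [_ hP _] := pA.
pose P := closure [set g | exists n, g = (z ^+ n)%g].
have cA : closed (Acen xmag : set (mag I)) by exact: closed_cen.
have gA := subgrp_cen [~ xmag 0%N, xmag 1%N]%g.
have clD : closed [set g | commset (Acen xmag) z [~ a, g]%g].
  apply: (closed_preimage (f := fun g => [~ a, g]%g)).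
    by apply: continuousRg; [exact: cst_continuous|exact: id_continuous].
  exact: closed_commset.
have Pmin K : closed K -> (forall n, K (z ^+ n)%g) -> P `<=` K.
  move=> cK Kn; rewrite [X in _ `<=` X](closure_id K).1 //; apply: closureS => _ [n ->].
  exact: Kn.
have PD : P `<=` [set g | commset (Acen xmag) z [~ a, g]%g].
  apply: Pmin => // n /=; elim: n => [|n [b Ab bE]].
    by exists 1%g; [case: gA|rewrite comm1g expg0 commg1].
  have A1 := (AcenP a).1 Aa; have b1 := (AcenP b).1 Ab.
  have bz1 : magu (b ^ z)%g = 1.
    rewrite conj_comm maguM b1 mul1r; exact: magu_comm.
  exists (a * b ^ z)%g.
    by apply/AcenP; rewrite maguM A1 bz1 mulr1.
  rewrite expgSr commMr -bE.
  have mJ : ([~ b, z] ^ z = [~ b ^ z, z])%g by rewrite conjRg (_ : z ^ z = z)%g // conjgE mulKg.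
  have ab1 : magu (a * b ^ z)%g = 1 by rewrite maguM A1 bz1 mulr1.
  rewrite mJ; apply: magP => l _; rewrite (mv_commK _ _ ab1).
  rewrite (mvM [~ a, z]%g) magu_comm mulr1 (mv_commK _ _ A1) (mv_commK _ _ bz1) (mvM a) bz1 mulr1.
  by rewrite mulrDl.
have PC : P `<=` Cx xmag 0%N.
  apply: Pmin; first exact: closed_cen.
  by move=> n; exact: (subgrpX n (subgrp_cen (xmag 0%N)) Cz).
have [g Pg gE] : ((fun g => c (mv g 0%N)) @` P) (c (mv z 0%N) * c (mv h 1%N)).
  have cc : continuous (fun g : mag I => c (mv g 0%N)).
    move=> g; apply: (@continuous_comp _ _ _ (fun g => mv g 0%N) c); first exact: mv_continuous.
    exact: (iw_c_cont iw).
  have clI : closed ((fun g : mag I => c (mv g 0%N)) @` P).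
    by apply: closed_image => //; exact: closed_closure.
  apply: (padic_nat_dense (K := [set l | ((fun g : mag I => c (mv g 0%N)) @` P) (c (mv z 0%N) * l)])).
    apply: (closed_preimage (f := fun l => c (mv z 0%N) * l)) => //.
    by apply: continuousMr; [exact: cst_continuous|exact: id_continuous].
  move=> n; exists (z ^+ n)%g; first by apply: subset_closure; exists n.
  by rewrite Cx_cX // mulrC.
have -> : w = g by apply: (Cx_inj d0 Cw (PC g Pg)); rewrite wE -gE.
by have [b Ab bE] := PD g Pg; exists b.
Qed.

Theorem mag_axioms : pres_axioms q d xmag.
Proof.
have gC i := subgrp_cen (xmag i).
split.
- by move=> g h; apply/AcenP; exact: magu_comm.
- move=> a b /AcenP a1 /AcenP b1; apply: magP => i _.
  by rewrite !mvM a1 b1 !mulr1 addrC.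
- move=> g; have [_ [s [Us sE]]] := mvP g; rewrite -maguE in sE.
  have /choice[h Hh] : forall i, exists h, (i < d)%N -> Cx xmag i h /\ magu h = s i.
    move=> i; case: (ltnP i d) => id; last by exists 1%g.
    by have [h Ch hE] := Cx_ofu id (Us i id); exists h.
  exists h, ((\prod_(i < d) h i)^-1 * g)%g; split.
  + by move=> i id; have [] := Hh i id.
  + apply/AcenP; rewrite maguM sE; have <- : magu (\prod_(i < d) h i)%g = \prod_(i < d) s i.
      by rewrite magu_prod; apply: eq_bigr => i _; have [] := Hh i (ltn_ord i).
    by rewrite -maguM mulVg magu1.
  + by rewrite mulVKg.
- move=> h Ch /AcenP; rewrite magu_prod => E i id; apply: (Cx_eq1 id (Ch i id)).
  rewrite -dl_Cx //; last exact: Ch.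
  rewrite -(dl_units (s := fun i => magu (h i)) (leqnn d) id) ?E ?(iwdl1 I) // => j jd.
  by apply: Cx_unitX => //; exact: Ch.
- move=> i id g Cg; have [e [m [eq gE]]] := padic_root (c (mv g i)).
  have [h Ch hE] := Cx_of m id; exists e, h; split => //.
  apply: (Cx_inj id Cg).
    have [_ CM _] := gC i; apply: CM; first exact: (subgrpX e (gC i) (_ : Cx xmag i (xmag i))).
    exact: (subgrpX q (gC i) Ch).
  rewrite Cx_cM //; [|exact: (subgrpX e (gC i) (_ : Cx xmag i (xmag i)))|exact: (subgrpX q (gC i) Ch)].
  by rewrite !Cx_cX // xmag_c // mulr1 hE gE.
- move=> i id z a Cz /AcenP a1; apply/(DsetP _ (leqnn d)).
  apply: (@Dvec_ext _ _ _ _ (fun l => X i * (mv a l * mv z i))).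
    move=> l; rewrite mv_commK // (Cx_magu id Cz) [1 + _ - 1]addrC addKr.
    by rewrite mulrCA.
  by apply: (Dvec_gen id (v := fun l => mv a l * mv z i)); apply: KvecM; exact/magu_Kvec.
- move=> i id h Ch E; have := xmag_c id; rewrite E Cx_cX // => H.
  exact: (padic_natr_neq1 (esym H)).
- move=> i id j jd ij h Ch /(DsetP _ (leqnn d)) /dl_Dvec -/(_ i j jd).
  rewrite (mv_comm_CC _ id jd (_ : Cx xmag i (xmag i)) Ch) // mv_xmag // eqxx mul1r.
  rewrite dl_cvec //; last exact/eqP.
  exact: Cx_eq1.
- exact: mag_ax_unit.
- exact: mag_ax_dvd.
- move=> y a Cy /AcenP a1 E; apply: magP => l _; rewrite mv1 mv_commK //.
  have : mv [~ a, y ^+ q]%g l = 0 by rewrite E mv1.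
  have uX n : magu (y ^+ n)%g = magu y ^+ n.
    by elim: n => [|n IH]; rewrite ?expg0 ?expr0 ?magu1 // expgS exprS maguM IH.
  rewrite mv_commK // uX subrX1 mulrA mulrC => H.
  (* With [u = magu y], the factor [1 + u + ... + u ^ (q - 1)] of [u ^ q - 1] has constant term [q],
     so it can be cancelled. *)
  apply: (iw_nzd iw _ H); rewrite (iwc_sum (fun i => magu y ^+ i)).
  rewrite (eq_bigr (fun=> 1)) ?sumr_const ?card_ord // => i _.
  by rewrite iwcX (unitX_c d0 (Cx_unitX d0 Cy)) expr1n.
- move=> a /AcenP a1; apply: span_of_ideal => // l.
  by apply: (iw_aug iw); apply: Kvec_c; exact/magu_Kvec.
- exact: mag_ax_free.
- move=> i id h Ch E; apply: (Cx_eq1 id Ch); apply: padic_natr_inj.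
  by rewrite -Cx_cX // E mv1 (iwc0 I).
- move=> r rd a /AcenP a1 /(DsetP _ (ltnW rd)) [b [_ bE]].
  apply: span_of_ideal => // [|l]; first exact: ltnW.
  apply: (iw_reg iw rd (g := fun i => b i l)).
  by rewrite -bE mv_commK // magu_xmag // [1 + _ - 1]addrC addKr mulrC.
Qed.

End MagnusModel.

(* The group structure recovered from [topg (mag I)] differs from the original
   one by proofs of laws only: the unfolded axioms are convertible, while
   [pres_axioms], an inductive type indexed by the structure, is not. *)
Lemma mag_topg_axioms k d (I : iwasawa k d) :
  exists x : nat -> gs (topg (mag I)), pres_axioms k.+2 d x.
Proof. by exists (xmag I); apply/pres_axiomsE; exact: (pres_axiomsE _ _ _).1 (mag_axioms I). Qed.

Theorem theorem1 (p d : nat) (Phi : TopGroup) (iota : 'I_d -> Phi)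
    (F : TopGroup) (pi : Phi -> F) :
  prime p -> (2 <= d)%N ->
  @free_pro_p p d Phi iota ->
  profinite F ->
  @quotient_map_by_derived2 Phi F pi ->
  exists sigma : gform,
    [/\ is_sentence sigma, @models F sigma &
        forall G : TopGroup, profinite G -> @models G sigma ->
          topgroup_isomorphic G F].
Proof.
move=> pp d2 freePhi proF quoF.
have [sigma sent sigmaP] := definable_sentence (definable_pres_axioms p d).
exists sigma; split => // [|G proG /sigmaP [x ax]]; last first.
  have [phi [psi [phiM phiC psiM psiC [phiK psiK]]]] :=
    pres_axioms_iso pp d2 freePhi proF quoF (profinite_profin proG) ax.
  by exists psi, phi.
have [k pE] : exists k, p = k.+2 by case: p pp {freePhi sigmaP} => [|[|k]] // _; exists k.
subst p; have [L [X [c [dl iw]]]] := iwasawa_exists d pp.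
pose I := Iwasawa pp d2 iw.
(* The uniqueness half, applied to the Magnus group as a model, identifies it with [F] and carries
   the sentence over. *)
have [phi [psi [phiM phiC psiM psiC [phiK psiK]]]] :=
  pres_axioms_iso pp d2 freePhi proF quoF (mag_profin I) (mag_axioms I).
apply/(models_iso (G := topg (mag I)) (H := F) psiM psiK phiK)/sigmaP.
exact: mag_topg_axioms.
Qed.
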